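(* Let $d=1$ and let $(\rho,u)$ be a global-in-time classical solution of $$\partial_t\rho+\partial_x(\rho u)=0,\qquad \partial_t(\rho u)+\partial_x(\rho u^2)=-\rho\,(W'\star\rho)-\rho\int_{\mathbb R}\psi(x-y)\,(u(t,x)-u(t,y))\,\rho(t,y)\,dy$$ on $\mathbb R_+\times\mathbb R$ with initial data $(\rho_0,u_0)$. Suppose that there are constants $0<\lambda\le\Lambda<\infty$ such that $$\lambda(x-y)\le W'(x)-W'(y)\le\Lambda(x-y)\qquad\text{for all }x>y,$$ and that $\rho_0$ is compactly supported. Define $\rho_\infty(t,\cdot):=\delta_{\eta_c(t)}$ (the Dirac mass at the center of mass $\eta_c(t)$). Then: (i) If there are constants $R>0$ and $0<\psi_{\rm m}\le\psi_{\rm M}<\infty$ with $\psi_{\rm m}\le\psi(x)\le\psi_{\rm M}$ for all $|x|\le R$, then $${\rm d}_\infty(\rho(t),\rho_\infty(t))+\|u(t,\cdot)-u_\infty\|_{L^\infty(\mathrm{supp}(\rho(t)))}\to0$$ exponentially fast as $t\to\infty$. (ii) If there are $\alpha\in(0,1)$, $R>0$ and constants $A,B>0$ with $\dfrac{A}{|x|^\alpha}\le\psi(x)\le\dfrac{B}{|x|^\alpha}$ for all $|x|\le R$, then $${\rm d}_\infty(\rho(t),\rho_\infty(t))=\Theta\big(t^{-\frac1\alpha}\big),\qquad \|u(t,\cdot)-u_\infty\|_{L^\infty(\mathrm{supp}(\rho(t)))}=\mathcal O\big(t^{-(\frac1\alpha-1)}\big)$$ as $t\to\infty$.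
   Context: Standing assumptions: $W:\mathbb R\to\mathbb R$ is $C^1$ and symmetric, $W(x)=W(-x)$. The communication weight is $\psi(x)=\phi(|x|)$ with $\phi$ nonnegative and nonincreasing on $(0,\infty)$ (in case (ii) $\phi$ is singular at $0$; pointwise bounds are understood for $x\neq0$ there). $\rho\ge0$ is a probability density: $\|\rho(t)\|_{L^1}=1$ for all $t\ge0$ (mass is conserved). ''Global-in-time classical solution'' means that $(\rho,u)$ is defined for all $t\ge0$ and is regular enough for the equations to hold in the classical sense and for the forward characteristics $\partial_t\eta(t,x)=u(t,\eta(t,x))$, $\eta(0,x)=x$, $x\in\mathrm{supp}(\rho_0)$, to be well defined and non-colliding, with $\rho(t)=\eta(t,\cdot)\#\rho_0$. Notation: $\eta_c(t):=\int_{\mathbb R}x\,\rho(t,x)\,dx$; $u_\infty:=\int_{\mathbb R}\rho_0u_0\,dx$. The $\infty$-Wasserstein distance is ${\rm d}_\infty(\mu,\nu):=\inf_{\pi\in\Pi(\mu,\nu)}\sup_{(x,y)\in\mathrm{supp}\,\pi}|x-y|$, where $\Pi(\mu,\nu)$ is the set of couplings of $\mu,\nu$. ''$f(t)\to0$ exponentially fast'' means $f(t)\le Ce^{-ct}$ for all $t\ge 0$ for some $C,c>0$ independent of $t$. For nonnegative $f,g$: $f=\mathcal O(g)$ as $t\to\infty$ means $f(t)\le Cg(t)$ for some $C>0$ and all large $t$; $f=\Theta(g)$ means $f=\mathcal O(g)$ and $g=\mathcal O(f)$. *)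

(* Defs.v *)
From mathcomp Require Import all_boot all_order all_algebra.
From mathcomp Require Import all_classical all_reals all_analysis.

Set Implicit Arguments.
Unset Strict Implicit.
Unset Printing Implicit Defensive.

Import Order.TTheory GRing.Theory Num.Theory.
Import numFieldNormedType.Exports.

Local Open Scope classical_set_scope.
Local Open Scope ring_scope.

Section EulerAlignment.
Context {R : realType}.
Local Notation mu := (@lebesgue_measure R).

Definition supp (f : R -> R) : set R := closure [set x | f x != 0].

(* The set function [A |-> \int_A f]; a probability measure when f is a
   probability density. *)
Definition density_measure (f : R -> R) (A : set R) : \bar R :=
  (\int[mu]_(x in A) (f x)%:E)%E.

Definition Linfty_on (A : set R) (f : R -> R) : \bar R :=
  ('N[mu]_+oo[(EFin \o f) \_ A])%E.

Local Notation plane := (measurableTypeR R * measurableTypeR R)%type.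

Definition measure_supp (pi : set plane -> \bar R) : set (R * R) :=
  [set p : R * R | forall U : set (R * R), open U -> U p -> (0 < pi U)%E].

Definition is_coupling (m n : set R -> \bar R) (pi : probability plane R) :=
  forall A : set R, measurable A ->
    pushforward pi (fst : plane -> measurableTypeR R) A = m A /\
    pushforward pi (snd : plane -> measurableTypeR R) A = n A.

Definition dinfty (m n : set R -> \bar R) : \bar R :=
  ereal_inf [set ereal_sup [set `|p.1 - p.2|%:E | p in measure_supp pi]
            | pi in [set pi | is_coupling m n pi]].

Definition exp_fast (f : R -> \bar R) :=
  exists C c : R, [/\ 0 < C, 0 < c &
    forall t : R, 0 <= t -> (f t <= (C * expR (- (c * t)))%:E)%E].

Definition bigO_pinfty (f g : R -> \bar R) :=
  exists2 C : R, 0 < C & \forall t \near +oo, (f t <= C%:E * g t)%E.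

Definition bigTheta_pinfty (f g : R -> \bar R) :=
  bigO_pinfty f g /\ bigO_pinfty g f.

Definition dt (f : R -> R -> R) (t x : R) : R := derive1 (fun s => f s x) t.
Definition dx (f : R -> R -> R) (t x : R) : R := derive1 (f t) x.

Definition C1 (f : R -> R) :=
  (forall x : R, derivable f x 1) /\ continuous (derive1 f).

(* C^1 on (0, +oo) x R, and continuous up to t = 0. *)
Definition classically_regular (f : R -> R -> R) :=
  {within [set p : R * R | 0 <= p.1], continuous (fun p : R * R => f p.1 p.2)}
  /\ forall t x : R, 0 < t ->
     [/\ derivable (fun s => f s x) t 1,
         derivable (f t) x 1,
         {for (t, x), continuous (fun p : R * R => dt f p.1 p.2)} &
         {for (t, x), continuous (fun p : R * R => dx f p.1 p.2)}].

Definition prob_density (f : R -> R) :=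
  [/\ measurable_fun setT f, forall x, 0 <= f x &
      (\int[mu]_x (f x)%:E = 1)%E].

Definition attraction (W rho : R -> R) (x : R) : R :=
  \int[mu]_y (derive1 W (x - y) * rho y).

Definition alignment (psi rho u : R -> R) (x : R) : R :=
  \int[mu]_y (psi (x - y) * (u x - u y) * rho y).

(* Only the values of eta(t, .) on supp rho0 are relevant. *)
Definition is_flow (rho0 : R -> R) (rho u eta : R -> R -> R) :=
  [/\ forall x, supp rho0 x ->
        [/\ eta 0 x = x,
            {within [set t : R | 0 <= t], continuous (fun t => eta t x)} &
            forall t : R, 0 < t ->
              is_derive t (1 : R) (fun s => eta s x) (u t (eta t x))],
      forall t : R, 0 <= t -> set_inj (supp rho0) (eta t) &
      forall t : R, 0 <= t -> forall A, measurable A ->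
        density_measure (rho t) A =
        density_measure rho0 (supp rho0 `&` eta t @^-1` A)].

Record classical_solution (W psi rho0 u0 : R -> R) (rho u : R -> R -> R) :
    Prop := ClassicalSolution {
  sol_rho_init : rho 0 = rho0;
  sol_u_init : u 0 = u0;
  sol_rho_reg : classically_regular rho;
  sol_u_reg : classically_regular u;
  sol_density : forall t : R, 0 <= t -> prob_density (rho t);
  sol_attraction : forall t x : R, 0 < t ->
    mu.-integrable setT (fun y => (derive1 W (x - y) * rho t y)%:E);
  sol_alignment : forall t x : R, 0 < t ->
    mu.-integrable setT
      (fun y => (psi (x - y) * (u t x - u t y) * rho t y)%:E);
  sol_continuity : forall t x : R, 0 < t ->
    dt rho t x + dx (fun s y => rho s y * u s y) t x = 0;
  sol_momentum : forall t x : R, 0 < t ->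
    dt (fun s y => rho s y * u s y) t x +
    dx (fun s y => rho s y * u s y ^+ 2) t x =
    - (rho t x * attraction W (rho t) x)
    - rho t x * alignment psi (rho t) (u t) x;
  sol_flow : exists eta, is_flow rho0 rho u eta }.

Definition center_of_mass (f : R -> R) : R := \int[mu]_x (x * f x).

Definition mean_velocity (rho0 u0 : R -> R) : R :=
  \int[mu]_x (rho0 x * u0 x).

Definition dirac_center (f : R -> R) : set R -> \bar R :=
  @dirac _ (measurableTypeR R) (center_of_mass f) R.

Definition position_error (rho : R -> R -> R) (t : R) : \bar R :=
  dinfty (density_measure (rho t)) (dirac_center (rho t)).

Definition velocity_error (rho0 u0 : R -> R) (rho u : R -> R -> R) (t : R) :
    \bar R :=
  Linfty_on (supp (rho t)) (fun x => u t x - mean_velocity rho0 u0).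

End EulerAlignment.

(* Main.v *)
Require Import Defs.
From HB Require Import structures.
From mathcomp Require Import all_boot all_order all_algebra.
From mathcomp Require Import all_classical all_reals all_analysis.
From mathcomp Require Import measurable_realfun ess_sup_inf.
From mathcomp Require Import ring lra.

Set Implicit Arguments.
Unset Strict Implicit.
Unset Printing Implicit Defensive.

Import Order.TTheory GRing.Theory Num.Theory.
Import numFieldNormedType.Exports.

Local Open Scope classical_set_scope.
Local Open Scope ring_scope.

(** Label the trajectories by their starting points, distributed as [rho0], and
    write [X t z] and [V t z] for position and velocity.  The density does not
    vanish along a trajectory that starts where [rho0] is positive, so the
    momentum equation can be divided by it and becomes
      [V' = - E dW (X - X_y) - E psi (X - X_y) (V - V_y)],
    the expectation being over the label [y].  If [Psi] is an odd primitive of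
    [psi], the second term is minus the time derivative of
    [E Psi (X - X_y)] (the damping).  Hence the modified velocity
    [om = V + E Psi (X - X_y)] is driven by the attraction alone.

    For two labels let [D > 0] be the gap of the positions, [w] that of the
    modified velocities and [F >= 0] that of the dampings.  Then
      [D' = w - F]   and   [- Lam D <= w' <= - lam D].
    The flow never collides, which forces [w >= 0]: a negative [w] stays
    negative and would close the gap in finite time ([pair_mom_ge0]).  It follows
    that [w ^ 2 + lam D ^ 2] decreases ([pair_energy]), so gaps stay bounded.
    If both labels enclose a fixed interval of positive mass, then [F] is
    comparable with [D ^ b], where [b = 1 - alpha] and [alpha = 0] stands for a
    bounded weight ([pair_damping_le], [pair_damping_ge]).  Since the gap grows
    whenever [w] exceeds [F], a barrier argument gives [w <= M D ^ b]
    ([pair_mom_le_gap]), and then [w' <= - lam D] becomes an inequality for [w]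
    alone: [w' <= - c w] if [b = 1], and [w' <= - c w ^ (1 / b)] otherwise.  So [w]
    decays exponentially, respectively like [t ^ (- (1 / alpha - 1))], and
    [D ^ b] follows at the same rate, since [D] shrinks as long as [F] exceeds
    [w] ([pair_exp_decay], [pair_power_decay]).  In the singular case
    the damping eventually outruns the attraction, so that a pair with
    [w < (kap / 2) D ^ b] would collide; hence [w] is comparable with [D ^ b]
    from both sides and the estimates reverse ([pair_power_lower]).

    Because [w >= 0] for all pairs, [om] increases with the label, and every
    pair is controlled by a wider one that encloses the fixed interval.  This
    bounds all gaps of [X] and [V] at once ([flow_exp_decay],
    [flow_power_decay]).  The distance from [rho t] to the point mass at its
    center is the largest distance of a trajectory from the mean position, and
    [u_infty] is the mean velocity at all times, since the interactions are
    antisymmetric ([flow_mean_velocity]).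

    The monotone [phi] need not be continuous, so [Psi] is characterised by
    secant bounds.  It is differentiable except at countably many gaps, and as
    the flow is injective these concern countably many labels, a null set
    ([ae_regular]).  Differentiation under the expectation is dominated because
    [r phi r <= Psi r] is bounded although [phi] is not ([pot_gap_lipschitz]). *)

(** * Barriers and powers *)

Section Calculus.
Context {R : realType}.
Implicit Types (f g df dg : R -> R) (r s t T : R).

Lemma is_derive_continuous f t d : is_derive t (1 : R) f d ->
  {for t, continuous f}.
Proof.
by move=> h; apply: differentiable_continuous; apply/derivable1_diffP.
Qed.

Lemma is_derive_nincr f df s t : s <= t ->
  {within `[s, t], continuous f} ->
  (forall r, s < r < t -> is_derive r (1 : R) f (df r)) ->
  (forall r, s < r < t -> df r <= 0) -> f t <= f s.
Proof.
rewrite le_eqVlt => /predU1P[->//|st] cf hf df0.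
have hf' r : r \in `]s, t[ -> is_derive r (1 : R) f (df r).
  by rewrite in_itv/=; exact: hf.
have [c] := MVT st hf' cf.
rewrite in_itv/= => sct; rewrite -subr_le0 => ->.
by apply: mulr_le0_ge0; [exact: df0|rewrite subr_ge0 ltW].
Qed.

Lemma derive_within_continuous f df s t :
  (forall r, s <= r <= t -> is_derive r (1 : R) f (df r)) ->
  {within `[s, t], continuous f}.
Proof.
move=> hf; apply: derivable_within_continuous => r.
by rewrite in_itv/= => /hf[].
Qed.

(** The barrier principle: were [g] positive at [t], then after its last
    nonpositive time before [t] it would be positive and nonincreasing. *)
Lemma stays_nonpos g dg T :
  (forall t, T <= t -> is_derive t (1 : R) g (dg t)) ->
  g T <= 0 -> (forall t, T < t -> 0 < g t -> dg t <= 0) ->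
  forall t, T <= t -> g t <= 0.
Proof.
move=> hg gT dg0 t Tt; rewrite leNgt; apply/negP => gt0.
pose E := [set s | T <= s <= t /\ g s <= 0].
have ET : E T by split; rewrite ?lexx.
have supE : has_sup E.
  by split; [exists T|exists t => s [/andP[]]].
have cg s : T <= s -> {for s, continuous g} by move=> /hg /is_derive_continuous.
pose s := sup E.
have Ts : T <= s by apply: sup_upper_bound.
have st : s <= t by apply: ge_sup => [|x [/andP[]]//]; exists T.
have gs : g s <= 0.
  rewrite leNgt; apply/negP => gs0.
  have /nbhs_ballP[e /= e0 he] : \forall x \near s, 0 < g x.
    by have := cvgr_gt _ (cg s Ts); apply.
  have [x [Ex sx]] := sup_adherent e0 supE => sex.
  have /he : ball s e x.
    rewrite /ball/= ger0_norm ?subr_ge0; last by apply: sup_upper_bound.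
    by rewrite ltrBlDr -ltrBlDl.
  by rewrite ltNge sx.
suff /le_trans/(_ gs) : g t <= g s by rewrite leNgt gt0.
have dgs r : s <= r <= t -> is_derive r (1 : R) g (dg r).
  by move=> /andP[sr _]; apply: hg; exact: le_trans sr.
apply: (@is_derive_nincr g dg) => //.
- exact: (derive_within_continuous dgs).
- by move=> r /andP[sr rt]; apply: dgs; rewrite !ltW.
- move=> r /andP[sr rt]; apply: dg0; first exact: le_lt_trans sr.
  rewrite ltNge; apply/negP => gr.
  suff : r <= s by rewrite leNgt sr.
  apply: sup_upper_bound => //; split=> //.
  by rewrite (ltW rt) (le_trans Ts (ltW sr)).
Qed.

Lemma is_derive_powR_comp f t (d b : R) : 0 < f t -> is_derive t (1 : R) f d ->
  is_derive t (1 : R) (fun s => f s `^ b) (b * f t `^ (b - 1) * d).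
Proof.
move=> ft0 hf; have hp := is_derive1_powR b ft0.
exact: (is_derive1_comp hp hf).
Qed.

Lemma le_powR (b x y : R) : 0 <= b -> 0 <= x -> x <= y -> x `^ b <= y `^ b.
Proof.
move=> b0 x0 xy; apply: ge0_ler_powR => //; rewrite ?nnegrE//.
exact: le_trans xy.
Qed.

Lemma powRD_gt0 (x r s : R) : 0 < x -> x `^ (r + s) = x `^ r * x `^ s.
Proof. by move=> x0; rewrite powRD// (gt_eqF x0) implybT. Qed.

Lemma powR_large (b A : R) : 0 < b ->
  exists2 Y0 : R, 1 <= Y0 & forall Y, Y0 <= Y -> A <= Y `^ b.
Proof.
move=> b0; exists ((1 + `|A|) `^ b^-1).
  rewrite -[leLHS](powRr0 (1 + `|A|)).
  by apply: ler_powR; rewrite ?lerDl// ltW// invr_gt0.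
move=> Y hY.
apply: (@le_trans _ _ (((1 + `|A|) `^ b^-1) `^ b)).
  rewrite -powRrM mulVf ?gt_eqF// powRr1 ?addr_ge0//.
  by rewrite (le_trans (ler_norm A))// lerDr.
by apply: le_powR hY; rewrite ?(ltW b0)// powR_ge0.
Qed.

Lemma powR_small (b e : R) : 0 < b -> 0 < e ->
  exists2 y0 : R, 0 < y0 & forall y, 0 <= y <= y0 -> y `^ b <= e.
Proof.
move=> b0 e0; exists (e `^ b^-1); first exact: powR_gt0.
move=> y /andP[y0 hy]; apply: (@le_trans _ _ ((e `^ b^-1) `^ b)).
  by apply: le_powR hy => //; exact: ltW.
by rewrite -powRrM mulVf ?gt_eqF// powRr1// ltW.
Qed.

End Calculus.

(** * Dynamics of a pair of trajectories *)

Section PairDynamics.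
Context {R : realType}.
Implicit Types (D w F dw : R -> R) (r s t T : R).

(** [D] is the gap of two trajectories, [w] that of their modified velocities
    and [F] that of their dampings.  The initial time is left out because the
    equations of motion hold at positive times only; constants are read off at
    time one. *)
Record pair_dynamics (lam Lam : R) D w F dw : Prop := PairDynamics {
  pair_gap : forall t, 0 < t -> is_derive t (1 : R) D (w t - F t);
  pair_mom : forall t, 0 < t -> is_derive t (1 : R) w (dw t);
  pair_attr : forall t, 0 < t -> - (Lam * D t) <= dw t <= - (lam * D t);
  pair_gap_gt0 : forall t, 0 < t -> 0 < D t;
  pair_damping_ge0 : forall t, 0 < t -> 0 <= F t }.

Variables (lam Lam : R).
Hypothesis lam0 : 0 < lam.

Section OnePair.
Variables (D w F dw : R -> R).
Hypothesis pd : pair_dynamics lam Lam D w F dw.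

Let dD t : 0 < t -> is_derive t (1 : R) D (w t - F t). Proof. exact: (pair_gap pd). Qed.
Let dwE t : 0 < t -> is_derive t (1 : R) w (dw t). Proof. exact: (pair_mom pd). Qed.
Let D0 t : 0 < t -> 0 < D t. Proof. exact: (pair_gap_gt0 pd). Qed.

Lemma pair_mom_nincr s t : 0 < s -> s <= t -> w t <= w s.
Proof.
move=> s0 st; apply: (@is_derive_nincr _ _ dw) => //.
- apply: derive_within_continuous => r /andP[sr _].
  by apply: dwE; exact: lt_le_trans sr.
- by move=> r /andP[sr _]; apply: dwE; exact: lt_trans sr.
- move=> r /andP[sr _]; have r0 := lt_trans s0 sr.
  have /andP[_ /le_trans] := pair_attr pd r0; apply.
  by rewrite oppr_le0 mulr_ge0 ?ltW// D0.
Qed.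

(** [w] is nonincreasing and [D' <= w], so a negative value of [w] would bring
    the gap to zero in finite time. *)
Lemma pair_mom_ge0 t : 0 < t -> 0 <= w t.
Proof.
move=> t0; rewrite leNgt; apply/negP => wt.
pose g s := D s - w t * s.
have dg s : 0 < s -> is_derive s (1 : R) g (w s - F s - w t).
  move=> s0; have := dD s0 => ?.
  rewrite /g; apply: is_derive_eq; rewrite /GRing.scale/=; ring.
(* The time at which the tangent bound for the gap reaches zero. *)
pose s := t - D t / w t.
have ts : t <= s.
  by rewrite /s lerDl oppr_ge0 mulr_ge0_le0 ?invr_le0 ?ltW// D0.
have : g s <= g t.
  apply: (@is_derive_nincr _ _ (fun s => w s - F s - w t)) => //.
  - apply: derive_within_continuous => r /andP[tr _].
    by apply: dg; exact: lt_le_trans tr.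
  - by move=> r /andP[tr _]; apply: dg; exact: lt_trans tr.
  - move=> r /andP[tr _]; have r0 := lt_trans t0 tr.
    have := pair_damping_ge0 pd r0.
    have := pair_mom_nincr t0 (ltW tr); lra.
rewrite /g => h.
have : D s <= 0.
  have : D s <= D t + w t * (s - t) by lra.
  by rewrite /s addrAC subrr add0r mulrN mulrCA divff ?lt_eqF// mulr1 subrr.
by rewrite leNgt D0// (lt_le_trans t0).
Qed.

(** The damping enters the derivative as [- 2 lam D F], and the attraction
    bound cancels the remaining terms because [w] is nonnegative. *)
Lemma pair_energy s t : 0 < s -> s <= t ->
  w t ^+ 2 + lam * D t ^+ 2 <= w s ^+ 2 + lam * D s ^+ 2.
Proof.
move=> s0 st; pose g r := w r ^+ 2 + lam * D r ^+ 2.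
pose dg r := 2 * w r * dw r + lam * (2 * D r * (w r - F r)).
have dgE r : 0 < r -> is_derive r (1 : R) g (dg r).
  move=> r0; have := dD r0 => ?; have := dwE r0 => ?.
  rewrite /g /dg; apply: is_derive_eq; rewrite /GRing.scale/= ; ring.
apply: (@is_derive_nincr _ g dg) => //.
- apply: derive_within_continuous => r /andP[sr _].
  by apply: dgE; exact: lt_le_trans sr.
- by move=> r /andP[sr _]; apply: dgE; exact: lt_trans sr.
- move=> r /andP[sr _]; have r0 := lt_trans s0 sr.
  have /andP[_ h] := pair_attr pd r0.
  have w0 := pair_mom_ge0 r0; have F0 := pair_damping_ge0 pd r0.
  have := D0 r0 => Dr; rewrite /dg.
  have h1 : w r * dw r <= w r * - (lam * D r) by rewrite ler_wpM2l.
  have h2 : 0 <= lam * D r * F r by rewrite !mulr_ge0// ltW.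
  lra.
Qed.

End OnePair.
End PairDynamics.

(** * Decay of the gap between two trajectories *)

Section PairDecay.
Context {R : realType}.
Implicit Types (D w F dw : R -> R) (r s t T : R).
Variables (lam Lam : R).
Hypothesis lam0 : 0 < lam.

(** Barrier for [w - M D ^ b]: where it is positive, [w] exceeds the damping, so
    the gap grows while [w] decreases.  This trades the momentum for the gap in
    the attraction bound. *)
Lemma pair_mom_le_gap (b C M : R) D w F dw :
  pair_dynamics lam Lam D w F dw -> 0 < b -> 0 < M -> C <= M ->
  (forall t, 1 <= t -> F t <= C * D t `^ b) ->
  w 1 <= M * D 1 `^ b -> forall t, 1 <= t -> w t <= M * D t `^ b.
Proof.
move=> pd b0 M0 CM FC w1 t t1; rewrite -subr_le0.
pose g (r : R) := w r - M * D r `^ b.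
pose dg (r : R) := dw r - M * (b * D r `^ (b - 1) * (w r - F r)).
apply: (@stays_nonpos _ g dg 1); rewrite /g ?subr_le0//.
- move=> r r1; have r0 : 0 < r by exact: lt_le_trans r1.
  have Dr := pair_gap_gt0 pd r0.
  have := is_derive_powR_comp b Dr (pair_gap pd r0) => ?.
  have := pair_mom pd r0 => ?.
  by apply: is_derive_eq; rewrite /dg /GRing.scale/=; ring.
- move=> r r1 gr; have r0 : 0 < r by exact: lt_trans r1.
  have Dr := pair_gap_gt0 pd r0.
  have wF : 0 <= w r - F r.
    have := FC r (ltW r1) => h.
    have : C * D r `^ b <= M * D r `^ b by rewrite ler_wpM2r// powR_ge0.
    lra.
  have : 0 <= M * (b * D r `^ (b - 1) * (w r - F r)).
    by rewrite !mulr_ge0// ?powR_ge0// ltW.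
  have /andP[_ h] := pair_attr pd r0.
  have : 0 <= lam * D r by rewrite mulr_ge0// ltW.
  rewrite /dg; lra.
Qed.

(** With [w <= M D] the attraction gives [w' <= - (lam / M) w], and then
    [D' <= w - kap D] with an exponentially small source.  The constants depend
    on the pair only through bounds at time one. *)
Lemma pair_exp_decay (kap C delta M0 : R) :
  0 < kap -> 0 <= C -> 0 < delta -> delta <= M0 ->
  exists K c : R, [/\ 0 < K, 0 < c & forall D w F dw,
    pair_dynamics lam Lam D w F dw ->
    (forall t, 1 <= t -> kap * D t <= F t <= C * D t) ->
    w 1 <= M0 -> delta <= D 1 <= M0 ->
    forall t, 1 <= t -> w t <= K * expR (- (c * t)) /\ D t <= K * expR (- (c * t))].
Proof.
move=> kap0 C0 delta0 dM.
have M00 : 0 < M0 by exact: lt_le_trans dM.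
pose M := C + M0 / delta.
have MC : M0 / delta <= M by rewrite /M lerDr.
have Mg : 0 < M by apply: lt_le_trans MC; rewrite divr_gt0.
pose c := Num.min (lam / M) (kap / 2).
have c0 : 0 < c by rewrite lt_min !divr_gt0.
have cl : c <= lam / M by rewrite ge_min lexx.
have ck : c <= kap / 2 by rewrite ge_min lexx orbT.
pose K1 := M0 + 2 * M0 / kap.
have h2 : 0 < 2 * M0 / kap by rewrite !divr_gt0 ?mulr_gt0.
have K10 : 0 < K1 by rewrite /K1 addr_gt0.
have kK1 : 2 * M0 <= kap * K1.
  rewrite /K1 mulrDr [kap * (_ / _)]mulrC divfK ?gt_eqF// lerDr.
  by rewrite mulr_ge0 // ltW.
exists (K1 * expR c), c; split=> //; first by rewrite mulr_gt0 ?expR_gt0.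
move=> D w F dw pd FD w1 /andP[D1 D1'].
pose e (t : R) := expR (- (c * (t - 1))).
have dE t : is_derive t (1 : R) e (- c * e t).
  rewrite /e; have dl : is_derive t (1 : R) (fun s => - (c * (s - 1))) (- c).
    by apply: is_derive_eq; rewrite /GRing.scale/=; ring.
  have h := @is_derive1_comp _ expR _ t _ _ (is_derive_expR _) dl.
  by apply: (is_derive_eq h); rewrite mulrC.
have e0 t : 0 < e t by exact: expR_gt0.
have e1 : e 1 = 1 by rewrite /e subrr mulr0 oppr0 expR0.
have wM t : 1 <= t -> w t <= M * D t.
  move=> t1; have t0 : 0 < t by exact: lt_le_trans t1.
  have Dt := pair_gap_gt0 pd t0.
  rewrite -(powRr1 (ltW Dt)).
  apply: (@pair_mom_le_gap 1 C M _ _ _ _ pd) => //.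
  - by rewrite /M lerDl divr_ge0 // ltW.
  - move=> r r1; rewrite powRr1; first by have /andP[] := FD r r1.
    by rewrite ltW// (pair_gap_gt0 pd)// (lt_le_trans _ r1).
  - rewrite powRr1; last by rewrite (le_trans _ D1)// ltW.
    apply: (le_trans w1); apply: (@le_trans _ _ (M0 / delta * delta)).
      by rewrite divfK ?gt_eqF.
    by rewrite ler_pM// ?divr_ge0// ltW.
have we t : 1 <= t -> w t <= M0 * e t.
  move=> t1; rewrite -subr_le0.
  apply: (@stays_nonpos _ (fun r => w r - M0 * e r)
    (fun r => dw r + c * (M0 * e r)) 1) => //.
  - move=> r r1; have r0 : 0 < r by exact: lt_le_trans r1.
    have := pair_mom pd r0 => ?; have := dE r => ?.
    by apply: is_derive_eq; rewrite /GRing.scale/=; ring.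
  - by rewrite e1 mulr1 subr_le0.
  - move=> r r1 gr; have r0 : 0 < r by exact: lt_trans r1.
    have /andP[_ h] := pair_attr pd r0.
    have h3 : c * (M0 * e r) <= c * w r by rewrite ler_wpM2l ?(ltW c0)//; lra.
    have h4 : c * w r <= lam / M * (M * D r).
      apply: ler_pM => //; first exact: ltW.
        by apply: pair_mom_ge0 pd _ _.
      by apply: wM; exact: ltW.
    have : lam / M * (M * D r) = lam * D r by field; rewrite gt_eqF.
    lra.
have De t : 1 <= t -> D t <= K1 * e t.
  move=> t1; rewrite -subr_le0.
  apply: (@stays_nonpos _ (fun r => D r - K1 * e r)
    (fun r => w r - F r + c * (K1 * e r)) 1) => //.
  - move=> r r1; have r0 : 0 < r by exact: lt_le_trans r1.
    have := pair_gap pd r0 => ?; have := dE r => ?.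
    by apply: is_derive_eq; rewrite /GRing.scale/=; ring.
  - by rewrite e1 mulr1 subr_le0 (le_trans D1')// /K1 lerDl ltW.
  - move=> r r1 gr; have r0 : 0 < r by exact: lt_trans r1.
    have /andP[h _] := FD r (ltW r1).
    have h3 : c * (K1 * e r) <= kap / 2 * (K1 * e r).
      by rewrite ler_wpM2r ?mulr_ge0// ltW.
    have h4 : kap * (K1 * e r) <= kap * D r by rewrite ler_wpM2l ?(ltW kap0)//; lra.
    have h5 : 2 * M0 * e r <= kap * K1 * e r by rewrite ler_wpM2r// ltW.
    have := we r (ltW r1).
    lra.
have eE t : expR c * expR (- (c * t)) = e t.
  by rewrite /e -expRD; congr expR; ring.
move=> t t1; rewrite -mulrA eE; split; last exact: De.
by apply: (le_trans (we t t1)); rewrite ler_wpM2r ?(ltW (e0 _))// /K1 lerDl ltW.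
Qed.
End PairDecay.

Section PairPowerDecay.
Context {R : realType}.
Implicit Types (D w F dw : R -> R) (r s t T : R).
Variables (lam Lam alpha : R).
Hypothesis lam0 : 0 < lam.
Hypothesis Lam0 : 0 < Lam.
Hypothesis alpha0 : 0 < alpha.
Hypothesis alpha1 : alpha < 1.

Local Notation b := (1 - alpha).
Local Notation e := (alpha^-1 - 1).

Let b0 : 0 < b. Proof. by rewrite subr_gt0. Qed.
Let e0 : 0 < e. Proof. by rewrite subr_gt0 invf_gt1. Qed.
Let ai0 : 0 < alpha^-1. Proof. by rewrite invr_gt0. Qed.

(** The two rates of the theorem correspond through [w ~ D ^ b]. *)
Lemma powR_gap_mom t : (t `^ (- alpha^-1)) `^ b = t `^ (- e).
Proof. by rewrite -powRrM; congr powR; field; rewrite gt_eqF. Qed.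

Lemma is_derive_cpowR (K a t : R) : 0 < t ->
  is_derive t (1 : R) (fun s => K * s `^ (- a)) (- (K * a * t `^ (- a - 1))).
Proof.
move=> t0; have := is_derive1_powR (- a) t0 => ?.
by apply: is_derive_eq; rewrite /GRing.scale/=; ring.
Qed.

(** Each bound is a barrier.  If [w] exceeds [K t ^ (- e)], then [w <= M D ^ b]
    bounds [D] below by [Y t ^ (- 1 / alpha)], and [Y] is so large that the
    attraction makes [w] fall faster than the barrier; if [D] exceeds its
    barrier, then [F >= 2 w] and [D] falls faster. *)
Lemma pair_power_decay (kap C delta M0 : R) :
  0 < kap -> 0 <= C -> 0 < delta -> 0 < M0 ->
  exists K T : R, [/\ 0 < K, 1 <= T & forall D w F dw,
    pair_dynamics lam Lam D w F dw ->
    (forall t, 1 <= t -> kap * D t `^ b <= F t <= C * D t `^ b) ->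
    w 1 <= M0 -> delta <= D 1 -> (forall t, 1 <= t -> D t <= M0) ->
    (forall t, 1 <= t -> w t <= K * t `^ (- e)) /\
    (forall t, T <= t -> D t <= K * t `^ (- alpha^-1))].
Proof.
move=> kap0 C0 delta0 M00.
pose M := C + M0 / delta `^ b.
have db0 : 0 < delta `^ b by exact: powR_gt0.
have MC : M0 / delta `^ b <= M by rewrite /M lerDr.
have Mg : 0 < M by apply: lt_le_trans MC; rewrite divr_gt0.
have [Y1 Y11 hY1] := powR_large (e * M / lam) alpha0.
have [Y2 Y21 hY2] := powR_large (M0 / M) b0.
(* [Y1] lets the attraction beat the slope of the barrier for [w]; [Y2] puts
   the barrier above [M0] at time one. *)
pose Y := Num.max Y1 Y2.
have Y1' : 1 <= Y by rewrite le_max Y11.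
have Y0 : 0 < Y by exact: lt_le_trans Y1'.
have {hY1}hY1 : e * M / lam <= Y `^ alpha by apply: hY1; rewrite le_max lexx.
have {hY2}hY2 : M0 / M <= Y `^ b by apply: hY2; rewrite le_max lexx orbT.
pose K := M * Y `^ b.
have K0 : 0 < K by rewrite mulr_gt0// powR_gt0.
have MK : M0 <= K by rewrite /K mulrC -ler_pdivrMr.
have YK : e * K <= lam * Y.
  have YE : Y = Y `^ b * Y `^ alpha.
    rewrite -powRD_gt0//.
    by rewrite subrK powRr1// ltW.
  rewrite /K [in leRHS]YE.
  have -> : e * (M * Y `^ b) = Y `^ b * (e * M) by ring.
  have -> : lam * (Y `^ b * Y `^ alpha) = Y `^ b * (Y `^ alpha * lam) by ring.
  by rewrite ler_wpM2l ?powR_ge0// -ler_pdivrMr.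
have Mb0 : 0 < kap * M0 `^ b by rewrite mulr_gt0// powR_gt0.
have [T1 T11 hT1] := powR_large (2 * K / (kap * M0 `^ b)) e0.
(* From [T] on, half of the damping at the barrier absorbs [w], by [T1], and the
   other half absorbs the slope of the barrier. *)
pose T := Num.max T1 (2 * M0 / alpha / (kap * M0 `^ b)).
have T1' : 1 <= T by rewrite le_max T11.
have T0 : 0 < T by exact: lt_le_trans T1'.
have {hT1}hT1 : 2 * K <= T `^ e * (kap * M0 `^ b).
  by rewrite -ler_pdivrMr//; apply: hT1; rewrite le_max lexx.
have hT2 : 2 * M0 / alpha <= T * (kap * M0 `^ b).
  by rewrite -ler_pdivrMr// le_max lexx orbT.
pose K2 := M0 * T `^ alpha^-1.
have K20 : 0 < K2 by rewrite mulr_gt0// powR_gt0.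
have K2b : K2 `^ b = M0 `^ b * T `^ e.
  rewrite /K2 powRM ?powR_ge0 ?(ltW M00)// -powRrM; congr (_ * _ `^ _).
  by field; rewrite gt_eqF.
exists (Num.max K K2), T; split=> //; first by rewrite lt_max K0.
move=> D w F dw pd FD w1 D1 DM.
have wM : forall t, 1 <= t -> w t <= M * D t `^ b.
  apply: (@pair_mom_le_gap _ _ _ lam0 b C M _ _ _ _ pd) => //.
  - by rewrite /M lerDl divr_ge0 // ltW.
  - by move=> r r1; have /andP[] := FD r r1.
  - apply: (le_trans w1); apply: (@le_trans _ _ (M0 / delta `^ b * delta `^ b)).
      by rewrite divfK ?gt_eqF.
    rewrite ler_pM// ?divr_ge0// ?(ltW M00)// ?(ltW db0)//.
    by apply: le_powR => //; exact: ltW.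
have wK t : 1 <= t -> w t <= K * t `^ (- e).
  move=> t1; rewrite -subr_le0.
  apply: (@stays_nonpos _ (fun r => w r - K * r `^ (- e))
    (fun r => dw r + K * e * r `^ (- e - 1)) 1) => //.
  - move=> r r1; have r0 : 0 < r by exact: lt_le_trans r1.
    have := pair_mom pd r0 => ?; have := @is_derive_cpowR K e r r0 => ?.
    by apply: is_derive_eq; rewrite opprK.
  - by rewrite powR1 mulr1 subr_le0 (le_trans w1).
  - move=> r r1 gr; have r0 : 0 < r by exact: lt_trans r1.
    have /andP[_ h] := pair_attr pd r0.
    have Dr := pair_gap_gt0 pd r0.
    have YD : Y * r `^ (- alpha^-1) <= D r.
      rewrite leNgt; apply/negP => hD.
      have h1 : D r `^ b <= (Y * r `^ (- alpha^-1)) `^ b.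
        by apply: le_powR; rewrite ltW.
      have h2 : M * D r `^ b <= K * r `^ (- e).
        rewrite /K -mulrA ler_wpM2l ?(ltW Mg)//; apply: (le_trans h1).
        by rewrite powRM ?powR_ge0 ?(ltW Y0)// powR_gap_mom.
      have := le_trans (wM r (ltW r1)) h2.
      by rewrite -subr_le0 leNgt gr.
    have -> : - e - 1 = - alpha^-1 by ring.
    have h3 : lam * (Y * r `^ (- alpha^-1)) <= lam * D r.
      by rewrite ler_wpM2l// ltW.
    have h4 : e * K * r `^ (- alpha^-1) <= lam * Y * r `^ (- alpha^-1).
      by rewrite ler_wpM2r// powR_ge0.
    lra.
have DK t : T <= t -> D t <= K2 * t `^ (- alpha^-1).
  move=> tT; rewrite -subr_le0.
  apply: (@stays_nonpos _ (fun r => D r - K2 * r `^ (- alpha^-1))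
    (fun r => w r - F r + K2 * alpha^-1 * r `^ (- alpha^-1 - 1)) T) => //.
  - move=> r r1; have r0 : 0 < r by exact: lt_le_trans r1.
    have := pair_gap pd r0 => ?; have := @is_derive_cpowR K2 (alpha^-1) r r0 => ?.
    by apply: is_derive_eq; rewrite opprK.
  - rewrite /K2 -mulrA -powRD_gt0//.
    by rewrite subrr powRr0 mulr1 subr_le0 DM.
  - move=> r rT gr; have r1 : 1 < r by exact: le_lt_trans rT.
    have r0 : 0 < r by exact: lt_trans r1.
    have /andP[h _] := FD r (ltW r1).
    have h0 := wK r (ltW r1).
    have h1 : M0 `^ b * T `^ e * r `^ (- e) <= D r `^ b.
      rewrite -K2b -powR_gap_mom -powRM ?powR_ge0 ?(ltW K20)//.
      apply: le_powR; rewrite ?(ltW b0)// ?(mulr_ge0 (ltW K20)) ?powR_ge0//.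
      by move: gr; rewrite subr_gt0 => /ltW.
    have h2 : kap * (M0 `^ b * T `^ e * r `^ (- e)) <= kap * D r `^ b.
      by rewrite ler_wpM2l// ltW.
    have -> : - alpha^-1 - 1 = - e + (- 2) by ring.
    rewrite powRD_gt0//.
    have h3 : r `^ (-2) <= T `^ (-2).
      rewrite !powRN lef_pV2 ?posrE ?powR_gt0//.
      by apply: le_powR => //; exact: ltW.
    have h4 : K2 * alpha^-1 * (r `^ (- e) * r `^ (-2)) <=
       K2 * alpha^-1 * (r `^ (- e) * T `^ (-2)).
      rewrite ler_wpM2l//; last by rewrite ler_wpM2l ?powR_ge0.
      by rewrite (mulr_ge0 (ltW K20)) ?(ltW ai0).
    have K2T : K2 * T `^ (-2) = M0 * T `^ e / T.
      have TE : T `^ alpha^-1 * T `^ (- 2) = T `^ e / T.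
        rewrite -(powR_inv1 (ltW T0)) -!powRD_gt0//; congr powR; ring.
      by rewrite /K2 -mulrA TE mulrA.
    have h5 : 2 * (M0 / T * alpha^-1) <= kap * M0 `^ b.
      have -> : 2 * (M0 / T * alpha^-1) = 2 * M0 / alpha / T by ring.
      by rewrite ler_pdivrMr// [leRHS]mulrC.
    have h6 : 2 * (K2 * alpha^-1 * (r `^ (- e) * T `^ (-2))) <=
        kap * M0 `^ b * (T `^ e * r `^ (- e)).
      have -> : 2 * (K2 * alpha^-1 * (r `^ (- e) * T `^ (-2))) =
          2 * alpha^-1 * r `^ (- e) * (K2 * T `^ (- 2)) by ring.
      rewrite K2T.
      have -> : 2 * alpha^-1 * r `^ (- e) * (M0 * T `^ e / T) =
         2 * (M0 / T * alpha^-1) * (T `^ e * r `^ (- e)) by ring.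
      by rewrite ler_wpM2r// mulr_ge0 ?powR_ge0.
    have h7 : 2 * K * r `^ (- e) <= T `^ e * (kap * M0 `^ b) * r `^ (- e).
      by rewrite ler_wpM2r ?powR_ge0.
    lra.
split=> t ht.
  by apply: (le_trans (wK t ht)); rewrite ler_wpM2r ?powR_ge0// le_max lexx.
by apply: (le_trans (DK t ht)); rewrite ler_wpM2r ?powR_ge0// le_max lexx orbT.
Qed.

(** Here [w] is bounded below by a multiple of [D ^ b] at late times: otherwise
    [D' <= - ep D ^ (1 - alpha)], and the gap would close in finite time.
    The barriers of the decay estimate are then used with reversed inequalities,
    the constants depending on the pair. *)
Lemma pair_power_lower (kap C K T0 : R) D w F dw :
  pair_dynamics lam Lam D w F dw -> 0 < kap -> 0 <= C -> 0 < K -> 1 <= T0 ->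
  (forall t, 1 <= t -> kap * D t `^ b <= F t <= C * D t `^ b) ->
  (forall t, T0 <= t -> D t <= K * t `^ (- alpha^-1)) ->
  exists c T : R, [/\ 0 < c, 1 <= T & forall t, T <= t -> c * t `^ (- alpha^-1) <= D t].
Proof.
move=> pd kap0 C0 K0 T01 FD DK.
pose ep := kap / 2.
have ep0 : 0 < ep by rewrite divr_gt0.
have ep2 : kap = 2 * ep by rewrite /ep; field.
have Dgt0 t : 1 <= t -> 0 < D t.
  by move=> t1; apply: (pair_gap_gt0 pd); exact: lt_le_trans t1.
have fast t : 1 <= t -> w t < ep * D t `^ b -> w t - F t <= - (ep * D t `^ b).
  move=> t1 wt; have /andP[h _] := FD t t1; rewrite ep2 in h; lra.
(* Eventually the gap is so small that, where [w < ep * D ^ b], the damping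
   lowers [D ^ b] faster than the attraction lowers [w]. *)
have [T1 T11 hT1] : exists2 T1, 1 <= T1 & forall t, T1 <= t ->
    D t `^ (2 * alpha) <= ep ^+ 2 * b / Lam.
  have a20 : 0 < 2 * alpha by rewrite mulr_gt0.
  have y0 : 0 < ep ^+ 2 * b / Lam by rewrite divr_gt0// mulr_gt0// exprn_gt0.
  have [y1 y10 hy1] := powR_small a20 y0.
  have [Y Y1 hY] := powR_large (K / y1) ai0.
  exists (Num.max T0 Y); first by rewrite le_max T01.
  move=> t; rewrite ge_max => /andP[tT tY].
  have t0 : 0 < t by rewrite (lt_le_trans _ tY)// (lt_le_trans _ Y1).
  apply: hy1; rewrite ltW ?Dgt0 ?(le_trans T01)//=.
  apply: (le_trans (DK t tT)); rewrite powRN ler_pdivrMr ?powR_gt0//.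
  by rewrite mulrC -ler_pdivrMr//; exact: hY.
(* Otherwise the power [D ^ alpha] would decrease at a constant rate and the
   gap would close in finite time. *)
have [T2 T12 wT2] : exists2 T2, T1 <= T2 & ep * D T2 `^ b <= w T2.
  apply: contrapT => hn.
  have wlt t : T1 <= t -> w t < ep * D t `^ b.
    by move=> tT; rewrite ltNge; apply/negP => h; apply: hn; exists t.
  pose s := T1 + D T1 `^ alpha / (alpha * ep).
  have Ts : T1 <= s by rewrite lerDl divr_ge0 ?powR_ge0 ?mulr_ge0 ?ltW.
  have : D s `^ alpha - (D T1 `^ alpha - alpha * ep * (s - T1)) <= 0.
    apply: (@stays_nonpos _
      (fun r => D r `^ alpha - (D T1 `^ alpha - alpha * ep * (r - T1)))
      (fun r => alpha * D r `^ (alpha - 1) * (w r - F r) + alpha * ep) T1) => //.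
    - move=> r Tr; have r1 := le_trans T11 Tr.
      have r0 : 0 < r by exact: lt_le_trans r1.
      have := is_derive_powR_comp alpha (Dgt0 r r1) (pair_gap pd r0) => ?.
      by apply: is_derive_eq; rewrite /GRing.scale/=; ring.
    - by rewrite subrr mulr0 subr0 subrr.
    - move=> r Tr _; have r1 := le_trans T11 (ltW Tr).
      have h := fast r r1 (wlt r (ltW Tr)).
      have PQ : D r `^ (alpha - 1) * D r `^ b = 1.
        rewrite -powRD_gt0 ?Dgt0//.
        by rewrite (_ : alpha - 1 + b = 0) ?powRr0//; ring.
      have -> : alpha * ep = alpha * D r `^ (alpha - 1) * (ep * D r `^ b).
        by rewrite -[LHS]mulr1 -[in LHS]PQ; ring.
      rewrite -mulrDr mulr_ge0_le0 ?mulr_ge0 ?powR_ge0 ?(ltW alpha0)//; lra.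
  have sE : alpha * ep * (s - T1) = D T1 `^ alpha.
    rewrite /s [T1 + _ - _]addrAC subrr add0r [LHS]mulrC divfK//.
    by rewrite gt_eqF// mulr_gt0.
  rewrite sE.
  by rewrite subrr subr0 leNgt powR_gt0// Dgt0// (le_trans T11).
have T21 : 1 <= T2 by exact: le_trans T12.
have T20 : 0 < T2 by exact: lt_le_trans T21.
have wD t : T2 <= t -> ep * D t `^ b <= w t.
  move=> tT; rewrite -subr_le0.
  apply: (@stays_nonpos _ (fun r => ep * D r `^ b - w r)
    (fun r => ep * (b * D r `^ (b - 1) * (w r - F r)) - dw r) T2 _ _ _ t tT).
  - move=> r Tr; have r1 := le_trans T21 Tr.
    have r0 : 0 < r by exact: lt_le_trans r1.
    have := is_derive_powR_comp b (Dgt0 r r1) (pair_gap pd r0) => ?.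
    have := pair_mom pd r0 => ?.
    by apply: is_derive_eq; rewrite /GRing.scale/=; ring.
  - by rewrite subr_le0.
  - move=> r Tr; rewrite subr_gt0 => gr; have r1 := le_trans T21 (ltW Tr).
    have r0 : 0 < r by exact: lt_le_trans r1.
    have h := fast r r1 gr.
    have /andP[h0 _] := pair_attr pd r0.
    have DE : D r = D r `^ (b - 1) * D r `^ b * D r `^ (2 * alpha).
      rewrite -!powRD_gt0 ?Dgt0//.
      have -> : b - 1 + b + 2 * alpha = 1 by ring.
      by rewrite powRr1// ltW// Dgt0.
    have h1 : Lam * D r <= ep ^+ 2 * b * (D r `^ (b - 1) * D r `^ b).
      rewrite [in leLHS]DE mulrCA [leRHS]mulrC.
      rewrite ler_wpM2l ?mulr_ge0 ?powR_ge0// mulrC -ler_pdivlMr//.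
      by apply: hT1; rewrite (le_trans T12)// ltW.
    have h2 : ep * (b * D r `^ (b - 1)) * (w r - F r) <=
              ep * (b * D r `^ (b - 1)) * - (ep * D r `^ b).
      by apply: ler_wpM2l => //; rewrite (mulr_ge0 (ltW ep0))// (mulr_ge0 (ltW b0))// powR_ge0.
    have h3 : ep * (b * D r `^ (b - 1)) * - (ep * D r `^ b) =
              - (ep ^+ 2 * b * (D r `^ (b - 1) * D r `^ b)) by ring.
    rewrite h3 in h2.
    have -> : ep * (b * D r `^ (b - 1) * (w r - F r)) =
       ep * (b * D r `^ (b - 1)) * (w r - F r) by ring.
    lra.
have wT20 : 0 < w T2.
  by apply: lt_le_trans wT2; rewrite mulr_gt0// powR_gt0// Dgt0.
have [Y1 Y10 hY1] := powR_small alpha0 (divr_gt0 (mulr_gt0 e0 ep0) Lam0).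
have [Y2 Y20 hY2] := powR_small b0 (divr_gt0 wT20 ep0).
pose Y := Num.min Y1 Y2.
have Y0 : 0 < Y by rewrite lt_min Y10.
have {hY1}hY1 : Lam * Y `^ alpha <= e * ep.
  rewrite mulrC -ler_pdivlMr//; apply: hY1.
  by rewrite (ltW Y0) ge_min lexx.
have {hY2}hY2 : ep * Y `^ b <= w T2.
  rewrite mulrC -ler_pdivlMr//; apply: hY2.
  by rewrite (ltW Y0) ge_min lexx orbT.
have YE : Y = Y `^ b * Y `^ alpha.
  by rewrite -powRD_gt0// subrK powRr1// ltW.
pose k := ep * Y `^ b.
have k0 : 0 < k by rewrite mulr_gt0// powR_gt0.
have kY : Lam * Y <= k * e.
  rewrite [in leLHS]YE mulrCA /k.
  have -> : ep * Y `^ b * e = Y `^ b * (e * ep) by ring.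
  by rewrite ler_wpM2l ?powR_ge0.
have wk t : T2 <= t -> k * t `^ (- e) <= w t.
  move=> tT; rewrite -subr_le0.
  apply: (@stays_nonpos _ (fun r => k * r `^ (- e) - w r)
    (fun r => - (k * e * r `^ (- e - 1)) - dw r) T2 _ _ _ t tT).
  - move=> r Tr; have r0 : 0 < r by exact: lt_le_trans Tr.
    have := is_derive_cpowR k e r0 => ?; have := pair_mom pd r0 => ?.
    by apply: is_derive_eq.
  - rewrite subr_le0; apply: le_trans hY2.
    rewrite -[leRHS]mulr1 ler_wpM2l ?(ltW k0)//.
    rewrite -[leRHS](powRr0 T2); apply: ler_powR => //.
    by rewrite oppr_le0 ltW.
  - move=> r Tr; rewrite subr_gt0 => gr; have r1 := le_trans T21 (ltW Tr).
    have r0 : 0 < r by exact: lt_le_trans r1.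
    have /andP[h0 _] := pair_attr pd r0.
    have DY : D r <= Y * r `^ (- alpha^-1).
      rewrite leNgt; apply/negP => hD.
      have h1 : (Y * r `^ (- alpha^-1)) `^ b <= D r `^ b.
        by apply: le_powR; rewrite ?(ltW b0) ?(mulr_ge0 (ltW Y0)) ?powR_ge0// ltW.
      rewrite powRM ?powR_ge0 ?(ltW Y0)// powR_gap_mom in h1.
      have h2 : k * r `^ (- e) <= ep * D r `^ b.
        by rewrite /k -mulrA ler_wpM2l// ltW.
      have := le_trans h2 (wD r (ltW Tr)).
      by rewrite leNgt gr.
    have -> : - e - 1 = - alpha^-1 by ring.
    have h3 : Lam * D r <= Lam * (Y * r `^ (- alpha^-1)).
      by rewrite ler_wpM2l// ltW.
    have h4 : Lam * Y * r `^ (- alpha^-1) <= k * e * r `^ (- alpha^-1).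
      by rewrite ler_wpM2r// powR_ge0.
    lra.
have D10 := Dgt0 1 (lexx _).
have w10 : 0 <= w 1 by apply: pair_mom_ge0 pd _ _.
pose M := 1 + C + w 1 / D 1 `^ b.
have q0 : 0 <= w 1 / D 1 `^ b by rewrite divr_ge0// powR_ge0.
have M0 : 0 < M by rewrite /M; lra.
have wM : forall t, 1 <= t -> w t <= M * D t `^ b.
  apply: (@pair_mom_le_gap _ _ _ lam0 b C M _ _ _ _ pd) => //.
  - by rewrite /M; lra.
  - by move=> r r1; have /andP[] := FD r r1.
  - rewrite -ler_pdivrMr ?powR_gt0// /M; lra.
exists ((k / M) `^ b^-1), T2; split => //; first by rewrite powR_gt0// divr_gt0.
move=> t tT; rewrite leNgt; apply/negP => hD.
have t1 := le_trans T21 tT.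
have t0 : 0 < t by exact: lt_le_trans t1.
have : D t `^ b < ((k / M) `^ b^-1 * t `^ (- alpha^-1)) `^ b.
  by apply: gt0_ltr_powR => //; rewrite nnegrE ?mulr_ge0 ?powR_ge0// ltW// Dgt0.
rewrite powRM ?powR_ge0// powR_gap_mom -powRrM mulVf ?gt_eqF// powRr1; last first.
  by rewrite divr_ge0 // ltW.
rewrite mulrAC ltr_pdivlMr// mulrC; apply/negP; rewrite -leNgt.
by apply: (le_trans (wk t tT)); exact: wM.
Qed.

End PairPowerDecay.

(** * The potential of the alignment weight *)

Section AlignmentPotential.
Context {R : realType}.
Local Notation mu := (@lebesgue_measure R).
Implicit Types (p q r s t x : R).

(** The fundamental theorem of calculus applies on the compact intervals
    [[r / n, r]], which exhaust the domain. *)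
Lemma integral_powR_le (alpha r : R) : 0 <= alpha -> alpha < 1 -> 0 < r ->
  (\int[mu]_(x in `]0%R, r]) (x `^ (- alpha))%:E <= (r `^ (1 - alpha) / (1 - alpha))%:E)%E.
Proof.
move=> a0 a1 r0; pose b := 1 - alpha.
have b0 : 0 < b by rewrite subr_gt0.
pose A (n : nat) := `[r / n.+2%:R, r]%classic.
have rn0 (n : nat) : 0 < r / n.+2%:R by rewrite divr_gt0.
have UA : \bigcup_n A n = `]0, r]%classic.
  apply/seteqP; split => x /=.
    move=> [n _]; rewrite /A/= !in_itv/= => /andP[nx ->].
    by rewrite (lt_le_trans _ nx).
  rewrite in_itv/= => /andP[x0 xr].
  exists (Num.truncn (r / x)) => //; rewrite /A/= in_itv/= xr andbT.
  rewrite ler_pdivrMr// mulrC -ler_pdivrMr//.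
  by rewrite (le_trans (ltW (truncnS_gt _)))// ler_nat.
have ndA : nondecreasing_seq A.
  move=> m n mn; apply/subsetPset => x; rewrite /A/= !in_itv/= => /andP[h ->].
  rewrite andbT (le_trans _ h)// ler_wpM2l ?(ltW r0)//.
  by rewrite lef_pV2 ?posrE// ler_nat.
have mp (D : set R) : measurable_fun D (EFin \o (fun x : R => x `^ (- alpha))).
  apply/measurable_EFinP; apply: measurable_funTS.
  exact: measurable_powR.
have h : (\int[mu]_(x in A n) (x `^ (- alpha))%:E @[n --> \oo] -->
    \int[mu]_(x in `]0%R, r]) (x `^ (- alpha))%:E)%E.
  rewrite -UA; apply: ge0_nondecreasing_set_cvg_integral.
  - exact: ndA.
  - by move=> n; exact: measurable_itv.
  - by move=> n; exact: mp.
  - by move=> n x _; rewrite lee_fin powR_ge0.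
suff nn : \forall n \near \oo, ((r `^ b / b)%:E >=
    \int[mu]_(x in A n) (x `^ (- alpha))%:E)%E by exact: (cvge_le nn h).
apply: nearW => n.
have nr : r / n.+2%:R < r.
  by rewrite ltr_pdivrMr// ltr_pMr// ltr1n.
have cp (c x : R) : 0 < x -> {for x, continuous (fun y : R => y `^ c)}.
  by move=> x0; apply: (is_derive_continuous (is_derive1_powR c x0)).
rewrite (@continuous_FTC2 _ _ (fun x => b^-1 * x `^ b))//.
- rewrite -EFinB lee_fin -/b mulrC lerBlDr lerDl.
  by rewrite mulr_ge0 ?powR_ge0// invr_ge0 ltW.
- apply: continuous_in_subspaceT => x; rewrite inE/= in_itv/= => /andP[nx _].
  by apply: cp; exact: lt_le_trans nx.
- have cF (x : R) : 0 < x -> {for x, continuous (fun x => b^-1 * x `^ b)}.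
    by move=> x0; apply: continuousM; [exact: cst_continuous|exact: cp].
  split.
  + move=> x; rewrite in_itv/= => /andP[nx _].
    have x0 : 0 < x by exact: lt_trans nx.
    by apply: derivableM => //; have [] := is_derive1_powR b x0.
  + by apply: cvg_at_right_filter; exact: cF.
  + by apply: cvg_at_left_filter; exact: cF.
- move=> x; rewrite in_itv/= => /andP[nx _].
  have x0 : 0 < x by exact: lt_trans nx.
  have hd := is_derive1_powR b x0.
  have hF : is_derive x (1 : R) (fun y : R => b^-1 * y `^ b) (x `^ (- alpha)).
    apply: is_derive_eq; rewrite /GRing.scale/= mulrA mulVf ?gt_eqF//.
    by rewrite mul1r; congr powR; rewrite /b; ring.
  by rewrite derive1E; have [_ ->] := hF.
Qed.

(** An odd primitive of the even weight [phi `|x|]: for a merely monotone [phi]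
    differentiability may fail, and the secant bounds are what survives. *)
Record alignment_potential (phi Psi : R -> R) : Prop := AlignmentPotential {
  pot_odd : forall x, Psi (- x) = - Psi x;
  pot_lower : forall p q, 0 <= p -> p <= q -> 0 < q ->
    phi q * (q - p) <= Psi q - Psi p;
  pot_upper : forall p q, 0 < p -> p <= q -> Psi q - Psi p <= phi p * (q - p) }.

Variable phi : R -> R.
Hypothesis phi_ge0 : forall r, 0 < r -> 0 <= phi r.
Hypothesis phi_nincr : forall r s, 0 < r -> r <= s -> phi s <= phi r.

Lemma measurable_nincr_pos : measurable_fun (`]0%R, +oo[%classic : set R) phi.
Proof.
apply: (measurability (@RGenCInfty.G R)) => [|/= _ [_] [r] -> <-].
  exact: RGenCInfty.measurableE.
apply: is_interval_measurable => s t/=.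
rewrite !in_itv/= !andbT => -[s0 fs] [t0 ft] u /andP[su ut].
have u0 : 0 < u by exact: lt_le_trans su.
by rewrite !in_itv/= !andbT; split=> //; rewrite (le_trans ft)// phi_nincr.
Qed.

Lemma measurable_radial_weight (psi : R -> R) : (forall x, psi x = phi `|x|) ->
  measurable_fun [set: measurableTypeR R] psi.
Proof.
move=> psiE.
(* The value at the origin is arbitrary, as [phi] is monotone on the positive
   half-line only. *)
rewrite (_ : psi = (fun x => if 0 < `|x| then phi `|x| else phi 0)); last first.
  apply/funext => x; rewrite psiE normr_gt0; case: eqVneq => // ->.
  by rewrite normr0.
apply: measurable_fun_if => //=.
- apply: measurable_fun_ltr => //; exact: measurable_normr.
- rewrite setTI; apply: (@measurable_comp _ _ _ _ _ _ (`]0%R, +oo[%classic : set (measurableTypeR R))) => //.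
  + by move=> _ [x /= x0 <-]; rewrite in_itv/= andbT.
  + exact: measurable_nincr_pos.
Qed.

Variables alpha B r0 : R.
Hypothesis alpha0 : 0 <= alpha.
Hypothesis alpha1 : alpha < 1.
Hypothesis r00 : 0 < r0.
Hypothesis B0 : 0 <= B.
Hypothesis phiB : forall r, 0 < r -> r <= r0 -> phi r <= B * r `^ (- alpha).

Let subitv r : `]0%R, r]%classic `<=` (`]0%R, +oo[%classic : set R).
Proof. by move=> x /=; rewrite !in_itv/= andbT => /andP[]. Qed.

Let mphi r : measurable_fun `]0, r] phi.
Proof.
apply: (measurable_funS _ _ measurable_nincr_pos) => //; exact: subitv.
Qed.

Let int_pow_fin r : 0 < r ->
  mu.-integrable `]0, r] (EFin \o (fun x : R => x `^ (- alpha))).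
Proof.
move=> rp; apply/integrableP; split.
  by apply/measurable_EFinP; apply: measurable_funTS; exact: measurable_powR.
under eq_integral do rewrite /= ger0_norm ?powR_ge0//.
by apply: (le_lt_trans (integral_powR_le alpha0 alpha1 rp)); rewrite ltry.
Qed.

Let int_cst r (c : R) : mu.-integrable `]0, r] (EFin \o (fun=> c)).
Proof.
apply/integrableP; split; first by apply/measurable_EFinP.
rewrite /= integral_cst//= lebesgue_measure_itv/=.
by case: ifPn => _; rewrite ?mule0// -EFinD -EFinM ltry.
Qed.

Let iphi r : 0 < r -> mu.-integrable `]0, r] (EFin \o phi).
Proof.
move=> rp; have hi := int_pow_fin rp.
have hB : mu.-integrable `]0, r]
    (EFin \o (fun x : R => B * x `^ (- alpha) + phi r0)).
  rewrite (_ : EFin \o _ = (fun x : R => B%:E * (EFin \o (fun x : R => (x `^ (- alpha))%R)) x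
       + (EFin \o (fun=> phi r0)) x)%E) //.
  by apply: integrableD => //; exact: integrableZl.
apply: (le_integrable _ _ _ hB) => //; first by apply/measurable_EFinP; exact: mphi.
move=> x /=; rewrite in_itv/= => /andP[x0 xr].
rewrite lee_fin ger0_norm ?phi_ge0// ger0_norm; last first.
  by rewrite addr_ge0 ?phi_ge0// mulr_ge0// powR_ge0.
have [xle|xgt] := leP x r0.
  by rewrite (le_trans (phiB x0 xle))// lerDl phi_ge0.
by rewrite (le_trans (phi_nincr r00 (ltW xgt)))// lerDr mulr_ge0// powR_ge0.
Qed.

Let Psi0 r := \int[mu]_(x in `]0, r]) phi x.

Let Psi0B p q : 0 <= p -> p <= q -> 0 < q ->
  Psi0 q - Psi0 p = \int[mu]_(x in `]p, q]) phi x.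
Proof.
by move=> p0 pq q0; apply: Rintegral_itvB; rewrite ?bnd_simp//; exact: iphi.
Qed.

Let Psi0_nonpos r : r <= 0 -> Psi0 r = 0.
Proof.
move=> rle; rewrite /Psi0 set_itv_ge ?Rintegral_set0//.
by rewrite bnd_simp -leNgt.
Qed.

Let int_cst_itv p q (c : R) : p <= q -> \int[mu]_(x in `]p, q]) c = c * (q - p).
Proof.
move=> pq; rewrite Rintegral_cst//= lebesgue_measure_itv/= lte_fin.
case: ltP => [_|qp]; first by rewrite -EFinD.
by congr (_ * _); apply/esym/eqP; rewrite /= subr_eq0 eq_le qp.
Qed.

Let iphi_sub p q : 0 <= p -> 0 < q -> mu.-integrable `]p, q] (EFin \o phi).
Proof.
move=> p0 q0; apply: (integrableS _ _ _ (iphi q0)) => //.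
by move=> x /=; rewrite !in_itv/= => /andP[px ->]; rewrite (le_lt_trans p0).
Qed.

Let icst_sub p q (c : R) : 0 <= p -> mu.-integrable `]p, q] (EFin \o (fun=> c)).
Proof.
move=> p0; apply: (integrableS _ _ _ (int_cst q c)) => //.
by move=> x /=; rewrite !in_itv/= => /andP[px ->]; rewrite (le_lt_trans p0).
Qed.

(** The integral of [phi] from [0], extended to an odd function; the bound near
    the singularity makes it finite. *)
Lemma alignment_potential_exists : exists Psi : R -> R,
  alignment_potential phi Psi /\
  forall r, 0 <= r -> r <= r0 -> Psi r <= B / (1 - alpha) * r `^ (1 - alpha).
Proof.
have b0 : 0 < 1 - alpha by rewrite subr_gt0.
exists (fun r => Psi0 r - Psi0 (- r)); split; first split.
- by move=> x; rewrite opprK opprB.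
- move=> p q p0 pq q0.
  rewrite !(Psi0_nonpos (r := - _)) ?oppr_le0 ?(ltW q0)// !subr0 Psi0B//.
  rewrite -int_cst_itv//; apply: le_Rintegral => //.
  + exact: icst_sub.
  + exact: iphi_sub.
  + move=> x /=; rewrite in_itv/= => /andP[px xq].
    by apply: phi_nincr => //; exact: le_lt_trans px.
- move=> p q p0 pq; have q0 : 0 < q by exact: lt_le_trans pq.
  rewrite !(Psi0_nonpos (r := - _)) ?oppr_le0 ?(ltW q0) ?(ltW p0)// !subr0.
  rewrite Psi0B ?(ltW p0)//.
  rewrite -int_cst_itv//; apply: le_Rintegral => //.
  + by apply: iphi_sub => //; exact: ltW.
  + by apply: icst_sub; exact: ltW.
  + move=> x /=; rewrite in_itv/= => /andP[px xq].
    by apply: phi_nincr => //; exact: ltW.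
- move=> r; rewrite le_eqVlt => /predU1P[<- _|rp rr].
    by rewrite oppr0 subrr powR0 ?mulr0// gt_eqF.
  rewrite (Psi0_nonpos (r := - _)) ?oppr_le0 ?(ltW rp)// subr0.
  apply: (@le_trans _ _ (\int[mu]_(x in `]0, r]) (B * x `^ (- alpha)))).
    apply: le_Rintegral => //; first exact: iphi.
    + rewrite (_ : EFin \o _ = (fun x : R => B%:E * (EFin \o (fun x : R => (x `^ (- alpha))%R)) x)%E) //.
      by apply: integrableZl => //; exact: int_pow_fin.
    + move=> x /=; rewrite in_itv/= => /andP[x0 xr].
      by apply: phiB => //; exact: le_trans rr.
  rewrite RintegralZl//; last exact: int_pow_fin.
  rewrite -mulrA ler_wpM2l// mulrC -lee_fin fineK; last first.
    by apply: integrable_fin_num => //; exact: int_pow_fin.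
  exact: integral_powR_le.
Qed.

End AlignmentPotential.

Section PotentialTheory.
Context {R : realType}.
Implicit Types (p q r s t x y : R).
Variables (phi Psi : R -> R).
Hypothesis phi_ge0 : forall r, 0 < r -> 0 <= phi r.
Hypothesis phi_nincr : forall r s, 0 < r -> r <= s -> phi s <= phi r.
Hypothesis pot : alignment_potential phi Psi.

Lemma pot0 : Psi 0 = 0.
Proof.
have := pot_odd pot 0; rewrite oppr0 => h.
by apply/eqP; rewrite -[_ == _](mulrn_eq0 _ 2) mulr2n {1}h addNr.
Qed.

Let nd0 p q : 0 <= p -> p <= q -> Psi p <= Psi q.
Proof.
move=> p0 pq; have [q0|q0] := ltP 0 q; last first.
  have -> : p = q by apply/eqP; rewrite eq_le pq (le_trans q0).
  by [].
rewrite -subr_ge0 (le_trans _ (pot_lower pot p0 pq q0))//.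
by rewrite mulr_ge0 ?phi_ge0// subr_ge0.
Qed.

Lemma pot_nondecreasing : {homo Psi : x y / x <= y}.
Proof.
move=> p q pq; have [p0|p0] := leP 0 p; first exact: nd0.
have [q0|q0] := leP q 0.
  rewrite -lerN2 -!(pot_odd pot); apply: nd0; by rewrite ?oppr_ge0// lerN2.
apply: (@le_trans _ _ (Psi 0)); last by apply: nd0 => //; exact: ltW.
rewrite -lerN2 -!(pot_odd pot) oppr0; apply: nd0 => //.
by rewrite oppr_ge0 ltW.
Qed.

Lemma pot_ge0 r : 0 <= r -> 0 <= Psi r.
Proof. by move=> r0; rewrite -pot0; exact: pot_nondecreasing. Qed.

Lemma pot_weight r : 0 < r -> r * phi r <= Psi r.
Proof.
move=> r0; have := pot_lower pot (lexx 0) (ltW r0) r0.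
by rewrite pot0 !subr0 mulrC.
Qed.

(** [Psi] is concave on the positive half-line.  Only secant bounds are at hand,
    so the shorter of [p] and [d] is used as the length of the secant. *)
Lemma pot_subadd p d : 0 <= p -> 0 <= d -> Psi (p + d) - Psi p <= Psi d.
Proof.
rewrite le_eqVlt => /predU1P[<- d0|p0]; first by rewrite add0r pot0 subr0.
rewrite le_eqVlt => /predU1P[<-|d0]; first by rewrite addr0 subrr pot0.
have [pd|dp] := leP p d.
  have : Psi (p + d) - Psi d <= phi d * p.
    by have := pot_upper pot d0 (_ : d <= p + d); rewrite addrK lerDr (ltW p0); exact.
  have : phi d * p <= phi p * p by rewrite ler_wpM2r ?phi_nincr// ltW.
  have := pot_weight p0; lra.
have : Psi (p + d) - Psi p <= phi p * d.
  have := pot_upper pot p0 (_ : p <= p + d).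
  by rewrite lerDl (ltW d0) addrAC subrr add0r; exact.
have : phi p * d <= phi d * d by rewrite ler_wpM2r ?phi_nincr// ltW.
have := pot_weight d0; lra.
Qed.

(** An increment is largest, up to the factor two, when it straddles the
    singularity symmetrically. *)
Lemma pot_incr_le p q : p <= q -> Psi q - Psi p <= 2 * Psi (q - p).
Proof.
move=> pq; have d0 : 0 <= q - p by rewrite subr_ge0.
have Pd := pot_ge0 d0.
have [p0|p0] := leP 0 p.
  by have := pot_subadd p0 d0; rewrite subrKC; lra.
have [q0|q0] := leP q 0.
  have q0' : 0 <= - q by rewrite oppr_ge0.
  have := pot_subadd q0' d0.
  have -> : - q + (q - p) = - p by ring.
  rewrite !(pot_odd pot); lra.
have h1 : Psi q <= Psi (q - p).
  by apply: pot_nondecreasing; rewrite lerDl oppr_ge0 ltW.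
have h2 : Psi (- p) <= Psi (q - p).
  by apply: pot_nondecreasing; rewrite lerDr ltW.
rewrite (pot_odd pot) in h2; lra.
Qed.

(** One of the end points is at least half their distance away from zero. *)
Lemma pot_incr_ge p q : p <= 0 -> 0 <= q -> Psi ((q - p) / 2) <= Psi q - Psi p.
Proof.
move=> p0 q0; have Pq := pot_ge0 q0.
have p0' : 0 <= - p by rewrite oppr_ge0.
have Pp := pot_ge0 p0'.
have [h|h] := leP (- p) q.
  have : Psi ((q - p) / 2) <= Psi q by apply: pot_nondecreasing; lra.
  rewrite (pot_odd pot) in Pp; lra.
have : Psi ((q - p) / 2) <= Psi (- p) by apply: pot_nondecreasing; lra.
rewrite (pot_odd pot); lra.
Qed.

(** Bounds for [phi] near zero control [Psi] on every bounded range at the price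
    of the constant, since [Psi] is monotone and positive. *)
Lemma pot_growth_ge (alpha A r0 M : R) : 0 <= alpha -> alpha < 1 -> 0 < A ->
  0 < r0 -> 0 < M -> (forall r, 0 < r -> r <= r0 -> A * r `^ (- alpha) <= phi r) ->
  exists2 k, 0 < k & forall r, 0 <= r -> r <= M -> k * r `^ (1 - alpha) <= Psi r.
Proof.
move=> a0 a1 A0 r00 M0 hA; set b := 1 - alpha.
have b0 : 0 < b by rewrite subr_gt0.
have hsmall r : 0 < r -> r <= r0 -> A * r `^ b <= Psi r.
  move=> rp rr; apply: le_trans (pot_weight rp).
  have -> : r `^ b = r * r `^ (- alpha).
    by rewrite -{2}(powRr1 (ltW rp)) -powRD_gt0.
  by rewrite mulrCA ler_wpM2l ?(ltW rp)// hA.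
pose c := (r0 + M) `^ b.
have c0 : 0 < c by rewrite powR_gt0// addr_gt0.
exists (A * r0 `^ b / c); first by rewrite !(divr_gt0, mulr_gt0)// powR_gt0.
move=> r; rewrite le_eqVlt => /predU1P[<- _|rp rM].
  by rewrite powR0 ?mulr0 ?pot0// gt_eqF.
have [rr|rr] := leP r r0.
  apply: le_trans (hsmall r rp rr); rewrite ler_wpM2r ?powR_ge0//.
  rewrite ler_pdivrMr// ler_wpM2l ?(ltW A0)//.
  by apply: le_powR; rewrite ?(ltW b0) ?(ltW r00)// lerDl ltW.
apply: (@le_trans _ _ (Psi r0)); last by apply: pot_nondecreasing; exact: ltW.
apply: le_trans (hsmall r0 r00 (lexx _)).
rewrite mulrAC ler_pdivrMr// ler_wpM2l ?mulr_ge0 ?powR_ge0 ?(ltW A0)//.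
by apply: le_powR; rewrite ?(ltW b0) ?(ltW rp)// (le_trans rM)// lerDr ltW.
Qed.

Lemma pot_growth_le (b B r0 M : R) : 0 <= b -> 0 <= B -> 0 < r0 -> 0 < M ->
  (forall r, 0 <= r -> r <= r0 -> Psi r <= B * r `^ b) ->
  exists2 C, 0 <= C & forall r, 0 <= r -> r <= M -> Psi r <= C * r `^ b.
Proof.
move=> b0 B0 r00 M0 hB; have PM := pot_ge0 (ltW M0).
have q0 : 0 <= Psi M / r0 `^ b by rewrite divr_ge0// powR_ge0.
exists (B + Psi M / r0 `^ b); first by rewrite addr_ge0.
move=> r rp rM; rewrite mulrDl; have [rr|rr] := leP r r0.
  by rewrite (le_trans (hB r rp rr))// lerDl mulr_ge0// powR_ge0.
apply: (@le_trans _ _ (Psi M / r0 `^ b * r `^ b)); last first.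
  by rewrite lerDr mulr_ge0// powR_ge0.
apply: (le_trans (pot_nondecreasing rM)).
rewrite mulrAC ler_pdivlMr ?powR_gt0// ler_wpM2l//.
by apply: le_powR => //; exact: ltW.
Qed.

(** The secant slopes lie between values of [phi] at their end points. *)
Lemma pot_is_derive r : 0 < r -> {for r, continuous phi} ->
  is_derive r (1 : R) Psi (phi r).
Proof.
move=> r0 cphi.
have key e : 0 < e -> \forall h \near (dnbhs (0 : R)), `|phi r - h^-1 * (Psi (h + r) - Psi r)| <= e.
  move=> e0.
  have h1 : \forall y \near r, `|phi r - phi y| <= e.
    by have /cvgrPdist_le := cphi; apply.
  have h2 : \forall h \near (nbhs (0 : R)), `|phi r - phi (h + r)| <= e.
    have h3 : h + r @[h --> (0 : R)] --> r.
      rewrite -[X in _ --> X]add0r; apply: cvgD; [exact: cvg_id|exact: cvg_cst].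
    exact: h3 _ h1.
  have h4 : \forall h \near (nbhs (0 : R)), 0 < h + r.
    have h3 : h + r @[h --> (0 : R)] --> r.
      rewrite -[X in _ --> X]add0r; apply: cvgD; [exact: cvg_id|exact: cvg_cst].
    by have := cvgr_gt _ h3; apply.
  rewrite near_withinE; near=> h => hn0.
  have hr : 0 < h + r by near: h.
  have he : `|phi r - phi (h + r)| <= e by near: h.
  apply: le_trans he.
  have [hp|hp|h0] := ltgtP h 0; last by rewrite h0 eqxx in hn0.
    have rh : h + r <= r by lra.
    have u := pot_upper pot hr rh.
    have l := pot_lower pot (ltW hr) rh r0.
    have -> : h^-1 * (Psi (h + r) - Psi r) = (Psi r - Psi (h + r)) / (- h).
      by field; rewrite lt_eqF.
    have nh : 0 < - h by rewrite oppr_gt0.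
    have dE : r - (h + r) = - h by ring.
    rewrite dE in u l.
    have l' : phi r <= (Psi r - Psi (h + r)) / (- h) by rewrite ler_pdivlMr.
    have u' : (Psi r - Psi (h + r)) / (- h) <= phi (h + r) by rewrite ler_pdivrMr.
    rewrite ler0_norm ?subr_le0// ler0_norm ?subr_le0 ?(le_trans l')//; lra.
  have rh : r <= h + r by lra.
  have u := pot_upper pot r0 rh.
  have l := pot_lower pot (ltW r0) rh hr.
  have dE : h + r - r = h by ring.
  rewrite dE in u l.
  have l' : phi (h + r) <= h^-1 * (Psi (h + r) - Psi r).
    by rewrite mulrC ler_pdivlMr.
  have u' : h^-1 * (Psi (h + r) - Psi r) <= phi r by rewrite mulrC ler_pdivrMr.
  rewrite ger0_norm ?subr_ge0// ger0_norm ?subr_ge0 ?(le_trans l')//; lra.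
have hc : h^-1 *: (Psi (h *: 1 + r) - Psi r) @[h --> 0^'] --> phi r.
  apply/cvgrPdist_le => e e0; near=> h.
  rewrite /GRing.scale/= mulr1; near: h; exact: key.
split; first by apply/cvg_ex; exists (phi r).
exact: cvg_lim hc.
Unshelve. all: end_near. Qed.

(** A rational strictly inside each jump separates the values of [phi] before it
    from those after it, so different jumps get different rationals. *)
Lemma weight_discontinuities_countable :
  countable [set r | 0 < r /\ ~ {for r, continuous phi}].
Proof.
set E := [set r | _].
have sep r : E r -> exists q : rat, (forall x, 0 < x -> x < r -> ratr q < phi x) /\
    (forall x, r < x -> phi x < ratr q).
  move=> [r0 nc].
  have [e e0 he] : exists2 e, 0 < e & ~ (\forall x \near r, `|phi r - phi x| <= e).
    apply: contrapT => h; apply: nc; apply/cvgrPdist_le => e e0.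
    by apply: contrapT => h'; apply: h; exists e.
  have jump : (forall x, r < x -> phi x <= phi r - e) \/
              (forall x, 0 < x -> x < r -> phi r + e <= phi x).
    apply: contrapT => /not_orP[/existsNP[x1 /not_implyP[rx1 /negP]]].
    rewrite -ltNge => hx1.
    move=> /existsNP[x2 /not_implyP[x20 /not_implyP[x2r /negP]]].
    rewrite -ltNge => hx2; apply: he.
    have : \forall x \near r, x2 < x < x1.
      by apply: near_in_itvoo; rewrite in_itv/= x2r.
    apply: filterS => x /andP[x2x xx1].
    have := phi_nincr x20 (ltW x2x).
    have := phi_nincr (lt_trans x20 x2x) (ltW xx1).
    rewrite ler_norml; lra.
  case: jump => jump.
    have /rat_in_itvoo[q] : phi r - e < phi r by lra.
    rewrite in_itv/= => /andP[q1 q2]; exists q; split => x.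
      by move=> x0 xr; apply: (lt_le_trans q2); apply: phi_nincr => //; exact: ltW.
    by move=> rx; apply: (le_lt_trans (jump x rx)).
  have /rat_in_itvoo[q] : phi r < phi r + e by lra.
  rewrite in_itv/= => /andP[q1 q2]; exists q; split => x.
    by move=> x0 xr; apply: (lt_le_trans q2); exact: jump.
  by move=> rx; apply: le_lt_trans q1; apply: phi_nincr => //; exact: ltW.
have [f hf] : exists f : R -> rat, forall r, E r ->
    (forall x, 0 < x -> x < r -> ratr (f r) < phi x) /\
    (forall x, r < x -> phi x < ratr (f r)).
  have h r : exists q : rat, E r -> (forall x, 0 < x -> x < r -> ratr q < phi x) /\
    (forall x, r < x -> phi x < ratr q).
    have [Er|nEr] := pselect (E r); last by exists 0.
    by have [q hq] := sep r Er; exists q.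
  by have [f hf] := choice h; exists f.
have finj : {in E &, injective f}.
  have lem r s : E r -> E s -> r < s -> f r <> f s.
    move=> Er Es rs fE.
    have [m] : exists m, r < m < s by exists ((r + s) / 2); lra.
    move=> /andP[rm ms].
    have h1 := (hf r Er).2 m rm.
    have h2 := (hf s Es).1 m (lt_trans Er.1 rm) ms.
    by have := lt_trans h2 h1; rewrite fE ltxx.
  move=> r s /set_mem Er /set_mem Es fE.
  have [rs|sr|//] := ltgtP r s; first by case: (lem r s Er Es rs).
  by case: (lem s r Es Er sr).
by rewrite -(eq_countable (inj_card_eq finj)).
Qed.
End PotentialTheory.

(** Both cases of the theorem, a bounded weight being the power [alpha = 0]. *)
Lemma power_weight_potential (R : realType) (phi : R -> R) (alpha A B r0 : R) :
  (forall r, 0 < r -> 0 <= phi r) ->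
  (forall r s, 0 < r -> r <= s -> phi s <= phi r) ->
  0 <= alpha -> alpha < 1 -> 0 < r0 -> 0 < A -> 0 < B ->
  (forall r, 0 < r -> r <= r0 ->
     A * r `^ (- alpha) <= phi r <= B * r `^ (- alpha)) ->
  exists Psi, [/\ alignment_potential phi Psi,
    forall M, 0 < M -> exists2 k, 0 < k &
      forall r, 0 <= r -> r <= M -> k * r `^ (1 - alpha) <= Psi r &
    forall M, 0 < M -> exists2 C, 0 <= C &
      forall r, 0 <= r -> r <= M -> Psi r <= C * r `^ (1 - alpha)].
Proof.
move=> phi_ge0 phi_nincr a0 a1 r00 A0 B0 hAB.
have hB r : 0 < r -> r <= r0 -> phi r <= B * r `^ (- alpha).
  by move=> rp rr; have /andP[] := hAB r rp rr.
have hA r : 0 < r -> r <= r0 -> A * r `^ (- alpha) <= phi r.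
  by move=> rp rr; have /andP[] := hAB r rp rr.
have [Psi [pot hPsi]] :=
  alignment_potential_exists phi_ge0 phi_nincr a0 a1 r00 (ltW B0) hB.
exists Psi; split => // M M0.
  exact: (pot_growth_ge phi_ge0 pot a0 a1 A0 r00 M0 hA).
apply: (pot_growth_le phi_ge0 pot _ _ r00 M0 hPsi); first by rewrite subr_ge0 ltW.
by rewrite divr_ge0 ?subr_ge0 ?ltW.
Qed.

Section PotentialAlongGap.
Context {R : realType}.
Variables (phi Psi : R -> R).
Hypothesis phi_ge0 : forall r, 0 < r -> 0 <= phi r.
Hypothesis phi_nincr : forall r s, 0 < r -> r <= s -> phi s <= phi r.
Hypothesis pot : alignment_potential phi Psi.

Let key (p q M k : R) : 0 < p -> p <= q -> q <= M -> 0 <= k ->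
  q <= p * expR k -> Psi q - Psi p <= Psi M * (k * expR k).
Proof.
move=> p0 pq qM k0 qp.
apply: (le_trans (pot_upper pot p0 pq)).
(* [expR k - 1 <= k * expR k]. *)
have h1 : q - p <= p * (k * expR k).
  have : 1 - k <= expR (- k) by have := expR_ge1Dx (- k); lra.
  rewrite expRN => h.
  have : (1 - k) * expR k <= 1 by rewrite -ler_pdivlMr ?expR_gt0// div1r.
  move=> h2; have : p * ((1 - k) * expR k) <= p * 1 by rewrite ler_wpM2l// ltW.
  lra.
have h2 : p * phi p <= Psi M.
  apply: (le_trans (pot_weight pot p0)).
  by apply: (pot_nondecreasing phi_ge0 pot); exact: le_trans qM.
have h3 : phi p * (q - p) <= phi p * (p * (k * expR k)).
  by rewrite ler_wpM2l// phi_ge0.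
apply: (le_trans h3); rewrite mulrA [phi p * p]mulrC ler_wpM2r//.
by rewrite mulr_ge0// expR_ge0.
Qed.

(** [r phi r] is bounded, so the potential is Lipschitz in the logarithm of the
    gap, whose speed the Lipschitz constant of the velocity controls. *)
Lemma pot_gap_lipschitz (D dD : R -> R) (a b L M s t : R) :
  0 <= L -> (forall r, a <= r <= b -> is_derive r (1 : R) D (dD r)) ->
  (forall r, a <= r <= b -> 0 < D r <= M) ->
  (forall r, a <= r <= b -> `|dD r| <= L * D r) ->
  a <= s <= b -> a <= t <= b ->
  `|Psi (D s) - Psi (D t)| <= Psi M * (L * expR (L * (b - a))) * `|s - t|.
Proof.
move=> L0 hD DM dL; wlog st : s t / s <= t.
  move=> h hs ht; have [st|/ltW ts] := leP s t; first exact: h.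
  by rewrite distrC [`|s - t|]distrC; exact: h.
move=> /[dup] hs /andP[ha_s hsb] /[dup] ht /andP[hat htb].
have inab r : s <= r <= t -> a <= r <= b.
  by move=> /andP[sr rt]; rewrite (le_trans ha_s sr) (le_trans rt htb).
have st0 : 0 <= t - s by rewrite subr_ge0.
have k0 : 0 <= L * (t - s) by rewrite mulr_ge0.
have dexp (c r : R) : is_derive r (1 : R) (fun r => expR (c * (r - s))) (c * expR (c * (r - s))).
  have dl : is_derive r (1 : R) (fun r => c * (r - s)) c.
    by apply: is_derive_eq; rewrite /GRing.scale/=; ring.
  have h := @is_derive1_comp _ expR _ r _ _ (is_derive_expR _) dl.
  by apply: (is_derive_eq h); rewrite mulrC.
have mono (c : R) r : s <= r <= t -> is_derive r (1 : R)
    (fun r => D r * expR (c * (r - s))) ((dD r + c * D r) * expR (c * (r - s))).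
  move=> hr; have := hD r (inab r hr) => ?; have := dexp c r => ?.
  by apply: is_derive_eq; rewrite /GRing.scale/=; ring.
have up : D t <= D s * expR (L * (t - s)).
  have := @is_derive_nincr _ (fun r => D r * expR (- L * (r - s)))
    (fun r => (dD r + - L * D r) * expR (- L * (r - s))) s t st.
  rewrite subrr mulr0 expR0 mulr1 mulNr expRN ler_pdivrMr ?expR_gt0// => h; apply: h.
  - exact: derive_within_continuous (mono (- L)).
  - by move=> r /andP[sr rt]; apply: mono; rewrite !ltW.
  - move=> r /andP[sr rt]; have hr : a <= r <= b by apply: inab; rewrite !ltW.
    have /ler_normlP[_ h] := dL r hr.
    apply: mulr_le0_ge0; [lra|exact: expR_ge0].
have dn : D s <= D t * expR (L * (t - s)).
  have := @is_derive_nincr _ (fun r => - (D r * expR (L * (r - s))))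
    (fun r => - ((dD r + L * D r) * expR (L * (r - s)))) s t st.
  rewrite subrr mulr0 expR0 mulr1 lerN2 => h; apply: h.
  - apply: (@derive_within_continuous _ _ (fun r => - ((dD r + L * D r) * expR (L * (r - s))))).
    by move=> r hr; have := mono L r hr => ?; exact: is_deriveN.
  - by move=> r /andP[sr rt]; apply: is_deriveN; apply: mono; rewrite !ltW.
  - move=> r /andP[sr rt]; have hr : a <= r <= b by apply: inab; rewrite !ltW.
    have /ler_normlP[h _] := dL r hr.
    rewrite oppr_le0; apply: mulr_ge0; [lra|exact: expR_ge0].
have /andP[Ds0 DsM] := DM s hs; have /andP[Dt0 DtM] := DM t ht.
have PM : 0 <= Psi M by apply: (pot_ge0 phi_ge0 pot); rewrite (le_trans _ DsM)// ltW.
have bound : Psi M * (L * (t - s) * expR (L * (t - s))) <=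
    Psi M * (L * expR (L * (b - a))) * `|s - t|.
  rewrite distrC ger0_norm//.
  have -> : Psi M * (L * expR (L * (b - a))) * (t - s) =
     Psi M * (L * (t - s) * expR (L * (b - a))) by ring.
  rewrite ler_wpM2l// ler_wpM2l// ler_expR ler_wpM2l//; lra.
apply: le_trans bound.
have [pq|qp] := leP (D s) (D t).
  rewrite distrC ger0_norm ?subr_ge0 ?(pot_nondecreasing phi_ge0 pot)//.
  exact: key.
rewrite ger0_norm ?subr_ge0 ?(pot_nondecreasing phi_ge0 pot) ?(ltW qp)//.
by apply: key => //; exact: ltW.
Qed.

End PotentialAlongGap.

(** * Probability measures with a density *)

Section DensityMeasure.
Context {R : realType}.
Local Notation mu := (@lebesgue_measure R).
Local Notation line := (measurableTypeR R).
Local Open Scope ereal_scope.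

(** The argument [hf] makes the probability structure inferable from the
    term. *)
Definition density_prob (f : R -> R) (hf : prob_density f) : set line -> \bar R :=
  density_measure f.

Section instance.
Variables (f : R -> R) (hf : prob_density f).

Let mf : measurable_fun [set: line] (EFin \o f).
Proof. by apply/measurable_EFinP; case: hf. Qed.

Let f0 x : 0 <= (f x)%:E. Proof. by rewrite lee_fin; case: hf. Qed.

Let density0 : density_prob hf set0 = 0.
Proof. by rewrite /density_prob /density_measure integral_set0. Qed.

Let density_ge0 A : 0 <= density_prob hf A.
Proof. by apply: integral_ge0 => x _; exact: f0. Qed.

Let density_sigma_additive : semi_sigma_additive (density_prob hf).
Proof. exact: semi_sigma_additive_nng_induced. Qed.

HB.instance Definition _ := isMeasure.Build _ _ _
  (density_prob hf) density0 density_ge0 density_sigma_additive.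

Let density_setT : density_prob hf [set: line] = 1.
Proof. by case: hf. Qed.

HB.instance Definition _ :=
  @Measure_isProbability.Build _ _ R (density_prob hf) density_setT.

End instance.

Import HBNNSimple.

(** By monotone convergence it suffices to treat simple functions, and for
    indicators the formula is the definition of the measure. *)
Lemma ge0_integral_density (f : R -> R) (hf : prob_density f) (g : line -> \bar R) :
  measurable_fun setT g -> (forall x, 0 <= g x) ->
  \int[density_prob hf]_x g x = \int[mu]_x (g x * (f x)%:E).
Proof.
move=> mg g0; have [mf f0 _] := hf.
have mF : measurable_fun [set: line] (EFin \o f) by exact/measurable_EFinP.
pose h := nnsfun_approx measurableT mg.
have -> : \int[density_prob hf]_x g x =
    lim (\int[density_prob hf]_x (EFin \o h n) x @[n --> \oo]).
  have gE x : g x = lim ((EFin \o h n) x @[n --> \oo]).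
    by apply/esym/cvg_lim => //; exact: cvg_nnsfun_approx.
  under eq_integral => x _ do rewrite gE.
  apply: monotone_convergence => //.
  - by move=> n; apply/measurable_EFinP; exact/measurable_funP.
  - by move=> n x _ /=; rewrite lee_fin.
  - by move=> x _ a b ab; rewrite lee_fin; exact/lefP/nd_nnsfun_approx.
have -> : \int[mu]_x (g x * (f x)%:E) =
    lim (\int[mu]_x ((EFin \o h n) x * (f x)%:E) @[n --> \oo]).
  have gfE x : g x * (f x)%:E = lim ((EFin \o h n) x * (f x)%:E @[n --> \oo]).
    by apply/esym/cvg_lim => //; apply: cvgeZr => //; exact: cvg_nnsfun_approx.
  under eq_integral => x _ do rewrite gfE.
  apply: monotone_convergence => [//| | |].
  - by move=> n; apply: emeasurable_funM => //; apply/measurable_EFinP.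
  - by move=> n x _ /=; rewrite mule_ge0 ?lee_fin.
  - by move=> x _ a b ab/=; rewrite lee_wpmul2r ?lee_fin//; exact/lefP/nd_nnsfun_approx.
suff suf n : \int[density_prob hf]_x (EFin \o h n) x =
    \int[mu]_x ((EFin \o h n) x * (f x)%:E).
  by under eq_fun do rewrite suf.
transitivity (\int[density_prob hf]_x
   (\sum_(y \in range (h n)) (y * \1_(h n @^-1` [set y]) x)%:E)).
  by apply: eq_integral => t _; rewrite /= fimfunE -fsumEFin.
have mind r : measurable_fun [set: line] (fun x => (r * \1_(h n @^-1` [set r]) x)%:E).
  by apply/measurable_EFinP; exact: measurable_funM.
rewrite ge0_integral_fsum//; last by move=> m y Ey; exact: nnfun_muleindic_ge0.
transitivity (\int[mu]_x (\sum_(y \in range (h n))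
    (y * \1_(h n @^-1` [set y]) x)%:E * (f x)%:E)); last first.
  under eq_integral => x _.
    rewrite -ge0_mule_fsuml => [|y]; last exact: nnfun_muleindic_ge0.
    rewrite fsumEFin // -(fimfunE _ x); over.
  by [].
rewrite ge0_integral_fsum//; last 2 first.
  - by move=> y; apply: emeasurable_funM.
  - move=> m y Ey; apply: mule_ge0; last by rewrite lee_fin.
    exact: nnfun_muleindic_ge0.
apply: eq_fsbigr => r rhn.
under eq_integral do rewrite EFinM.
rewrite integralZl_indic_nnsfun// integral_indic// setIT.
under eq_integral do rewrite EFinM -muleA.
have r0 : 0 <= r%:E by move: rhn; rewrite inE => -[t _ <-]; rewrite lee_fin.
rewrite ge0_integralZl//.
- congr (_ * _); rewrite /= /density_prob /density_measure [LHS]integral_mkcond.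
  by apply: eq_integral => x _; rewrite epatch_indic muleC.
- by apply: emeasurable_funM => //; exact/measurable_EFinP.
- by move=> t _; rewrite mule_ge0 ?lee_fin.
Qed.

Lemma integral_density (f : R -> R) (hf : prob_density f) (g : R -> R) :
  measurable_fun [set: line] g ->
  \int[density_prob hf]_x (g x)%:E = \int[mu]_x (g x * f x)%:E.
Proof.
move=> mg; have [_ f0 _] := hf; have mG : measurable_fun [set: line] (EFin \o g) by exact/measurable_EFinP.
have pE (h : line -> R) x : (maxe (h x)%:E 0 * (f x)%:E = maxe (h x * f x)%:E 0).
  by rewrite maxe_pMl ?lee_fin// mul0e.
rewrite [LHS]integralE [RHS]integralE !ge0_integral_density//.
- congr (_ - _); apply: eq_integral => x _; first by rewrite !funeposE; exact: pE.
  by rewrite !funenegE -!EFinN -mulNr; exact: (pE (fun y => - g y)%R).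
- exact: measurable_funeneg.
- exact: measurable_funepos.
Qed.

Lemma Rintegral_density (f : R -> R) (hf : prob_density f) (g : R -> R) :
  measurable_fun [set: line] g ->
  (\int[mu]_x (g x * f x) = \int[density_prob hf]_x g x)%R.
Proof. by move=> mg; rewrite /Rintegral integral_density. Qed.

End DensityMeasure.

(** * Distance to a point mass *)

Section Coupling.
Context {R : realType}.
Local Notation mu := (@lebesgue_measure R).
Local Notation line := (measurableTypeR R).
Local Notation plane := (measurableTypeR R * measurableTypeR R)%type.

(** Rational boxes form a countable base, so open sets of the plane belong to
    the product of the Borel fields. *)
Lemma open_plane_measurable (U : set (R * R)) :
  open U -> measurable (U : set plane).
Proof.
move=> oU.
pose box (q : (rat * rat) * (rat * rat)) : set plane :=
  (`]ratr q.1.1, ratr q.1.2[%classic : set line) `*` (`]ratr q.2.1, ratr q.2.2[%classic : set line).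
have -> : U = \bigcup_(q in [set q | box q `<=` U]) box q.
  apply/seteqP; split; last by move=> p [q /= qU]; exact: qU.
  move=> [x y] Uxy.
  have /nbhs_ballP[e /= e0 he] : nbhs (x, y) U by exact: open_nbhs_nbhs.
  have near_rat (z : R) : exists q : rat * rat, ratr q.1 < z < ratr q.2 /\
      forall w, ratr q.1 < w < ratr q.2 -> `|z - w| < e.
    have /rat_in_itvoo[q1] : z - e < z by lra.
    rewrite in_itv/= => /andP[q1z q1z'].
    have /rat_in_itvoo[q2] : z < z + e by lra.
    rewrite in_itv/= => /andP[q2z q2z'].
    exists (q1, q2) => /=; split; first by rewrite q1z'.
    by move=> w /andP[w1 w2]; rewrite ltr_norml; lra.
  have [qx [xin xe]] := near_rat x; have [qy [yin ye]] := near_rat y.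
  exists (qx, qy); last by split => /=; rewrite in_itv.
  move=> [a b] [/= ]; rewrite !in_itv/= => ha hb; apply: he.
  by split => /=; [exact: xe|exact: ye].
rewrite bigcup_mkcond; apply: countable_bigcupT_measurable => // q.
case: ifPn => // _; by apply: measurableX; exact: measurable_itv.
Qed.

(** The coupling of a distribution with a point mass is unique; its support is
    read off from the distribution. *)
Lemma dinfty_dirac_le (P : probability line R) (f X : R -> R) (c d : R) :
  measurable_fun [set: line] X ->
  (forall A : set line, measurable A -> density_measure f A = P (X @^-1` A)) ->
  (forall z, `|X z - c| <= d) ->
  (dinfty (density_measure f) (@dirac _ line c R) <= d%:E)%E.
Proof.
move=> mX fX Xd.
pose Y (z : line) : plane := (X z, c).
have mY : measurable_fun [set: line] Y by exact: measurable_fun_pair.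
pose mY_mixin := isMeasurableFun.Build _ _ _ _ Y mY.
pose mfY : {mfun line >-> plane} := HB.pack Y mY_mixin.
pose pi : probability plane R := distribution P mfY.
apply: ge_ereal_inf.
exists (ereal_sup [set `|p.1 - p.2|%:E | p in measure_supp pi]).
  exists pi => // A mA; split.
    by rewrite fX.
  rewrite /pushforward /= /distribution /pushforward diracE.
  have [Ac|Ac] := boolP (c \in A).
    rewrite (_ : _ @^-1` _ = setT) ?probability_setT//.
    by apply/seteqP; split => // z _ /=; exact/set_mem.
  rewrite (_ : _ @^-1` _ = set0) ?measure0//.
  by apply/seteqP; split => // z /= /mem_set; rewrite (negbTE Ac).
apply: ge_ereal_sup => _ [p psupp <-]; rewrite lee_fin leNgt; apply/negP => dp.
pose U := [set q : R * R | d < `|q.1 - q.2|].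
have oU : open U.
  have cU : continuous (fun q : R * R => `|q.1 - q.2|).
    by move=> q; apply: cvg_norm; apply: cvgB; [exact: cvg_fst|exact: cvg_snd].
  by have /continuousP/(_ _ (@open_gt _ d)) := cU.
have := psupp U oU dp.
rewrite /pi /= /distribution /pushforward (_ : _ @^-1` _ = set0) ?measure0 ?ltxx//.
by apply/seteqP; split => // z; rewrite /preimage /U /= ltNge Xd.
Qed.

(** Every coupling charges each neighbourhood of [(x, c)]: it lives on the line
    of second coordinate [c], and its first marginal charges the neighbourhoods
    of [x]. *)
Lemma dinfty_dirac_ge (f : R -> R) (c x : R) :
  (forall V : set R, open V -> V x -> (0 < density_measure f V)%E) ->
  (`|x - c|%:E <= dinfty (density_measure f) (@dirac _ line c R))%E.
Proof.
move=> fpos; apply: le_ereal_inf_tmp => _ [pi coup <-].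
apply: ereal_sup_ubound; exists (x, c) => // U oU Uxc.
have mU := open_plane_measurable oU.
have /nbhs_ballP[e /= e0 he] : nbhs (x, c) U by exact: open_nbhs_nbhs.
pose V : set line := ball x e; pose W : set line := ball c e.
have mV : measurable V by apply: open_measurable; exact: ball_open.
have mW : measurable W by apply: open_measurable; exact: ball_open.
have h1 : pi ((fst : plane -> line) @^-1` V) = density_measure f V by have [] := coup V mV.
have h2 : pi ((snd : plane -> line) @^-1` (~` W)) = 0%E.
  have [_ /=] := coup (~` W) (measurableC mW); rewrite diracE => h.
  have -> : pi ((snd : plane -> line) @^-1` (~` W)) = _ := h.
  by rewrite memNset//= => /(_ (ballxx c e0)).
have mpV : measurable ((fst : plane -> line) @^-1` V).
  by rewrite -[X in measurable X]setTI; apply: measurable_fst.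
have mpW : measurable ((snd : plane -> line) @^-1` (~` W)).
  by rewrite -[X in measurable X]setTI; apply: measurable_snd => //; exact: measurableC.
have : (pi ((fst : plane -> line) @^-1` V) <= pi U + pi ((snd : plane -> line) @^-1` (~` W)))%E.
  apply: (le_trans _ (measureU2 _ _ _)) => //.
  apply: le_measure; rewrite ?inE//; first exact: measurableU.
  move=> [a b] /= Va; have [Wb|Wb] := pselect (W b); last by right.
  by left; apply: he.
rewrite h1 h2 adde0; apply: lt_le_trans.
by apply: fpos; [exact: ball_open|exact: ballxx].
Qed.

Lemma Linfty_on_le (A : set R) (f : R -> R) (M : R) : 0 <= M ->
  (forall x, A x -> `|f x| <= M) -> (Linfty_on A f <= M%:E)%E.
Proof.
move=> M0 fM; rewrite /Linfty_on unlock /Lnorm.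
case: ifPn => // _; apply/ess_supP; apply: nearW => x /=.
rewrite patchE; case: ifPn => [/set_mem Ax|_]; last by rewrite abse0 lee_fin.
by rewrite /= lee_fin fM.
Qed.

End Coupling.

(** * Expectations *)

Section Expectation.
Context {R : realType} d (T : measurableType d) (P : probability T R).
Implicit Types (f g : T -> R).

Lemma bounded_integrable f (C : R) : measurable_fun setT f ->
  (forall z, `|f z| <= C) -> P.-integrable setT (EFin \o f).
Proof.
move=> mf fC.
have iC : P.-integrable setT (EFin \o (fun=> C)).
  apply/integrableP; split; first exact/measurable_EFinP.
  rewrite /= integral_cst//= probability_setT mule1 ltry//.
apply: (le_integrable _ _ _ iC) => //; first exact/measurable_EFinP.
by move=> z _ /=; rewrite lee_fin (le_trans (fC z))// ler_norm.
Qed.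

Lemma expectation_cst (c : R) : \int[P]_z c = c.
Proof. by rewrite Rintegral_cst//= probability_setT mulr1. Qed.

Lemma expectation_le f g (C : R) : measurable_fun setT f -> measurable_fun setT g ->
  (forall z, `|f z| <= C) -> (forall z, `|g z| <= C) ->
  (forall z, f z <= g z) -> \int[P]_z f z <= \int[P]_z g z.
Proof.
move=> mf mg fC gC fg; apply: le_Rintegral => //.
- exact: bounded_integrable fC.
- exact: bounded_integrable gC.
Qed.

Lemma expectation_norm_le f (C : R) : measurable_fun setT f ->
  (forall z, `|f z| <= C) -> `|\int[P]_z f z| <= C.
Proof.
move=> mf fC; rewrite -[leRHS]expectation_cst.
have i1 := bounded_integrable mf fC.
apply: (le_trans (le_normr_Rintegral measurableT i1)).
have C0 : 0 <= C by exact: le_trans (fC point).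
apply: (@expectation_le _ _ C) => //.
- exact: measurableT_comp.
- by move=> z; rewrite normr_id.
- by move=> z; rewrite ger0_norm.
Qed.

Lemma expectationB f g (C C' : R) : measurable_fun setT f -> measurable_fun setT g ->
  (forall z, `|f z| <= C) -> (forall z, `|g z| <= C') ->
  \int[P]_z (f z - g z) = \int[P]_z f z - \int[P]_z g z.
Proof.
by move=> mf mg fC gC; apply: RintegralB => //; [exact: bounded_integrable fC|
  exact: bounded_integrable gC].
Qed.

Lemma expectationD f g (C C' : R) : measurable_fun setT f -> measurable_fun setT g ->
  (forall z, `|f z| <= C) -> (forall z, `|g z| <= C') ->
  \int[P]_z (f z + g z) = \int[P]_z f z + \int[P]_z g z.
Proof.
by move=> mf mg fC gC; apply: RintegralD => //; [exact: bounded_integrable fC|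
  exact: bounded_integrable gC].
Qed.

Lemma expectationZ f (c C : R) : measurable_fun setT f ->
  (forall z, `|f z| <= C) ->
  \int[P]_z (c * f z) = c * \int[P]_z f z.
Proof. by move=> mf fC; apply: RintegralZl => //; exact: bounded_integrable fC. Qed.

Lemma expectation_cvg (f_ : nat -> T -> R) g (C : R) :
  (forall n, measurable_fun setT (f_ n)) -> measurable_fun setT g ->
  (forall n z, `|f_ n z| <= C) ->
  {ae P, forall z, f_ n z @[n --> \oo] --> g z} ->
  \int[P]_z f_ n z @[n --> \oo] --> \int[P]_z g z.
Proof.
move=> mf mg fC fg.
have iC : P.-integrable setT (EFin \o (fun=> C)).
  by apply: (@bounded_integrable _ `|C|).
have mf' n : measurable_fun setT (fun z => (f_ n z)%:E) by apply/measurable_EFinP.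
have mg' : measurable_fun setT (EFin \o g) by apply/measurable_EFinP.
have fg' : {ae P, forall z, setT z -> (f_ n z)%:E @[n --> \oo] --> (EFin \o g) z}.
  by apply: filterS fg => z hz _; apply: cvg_EFin => //; exact: nearW.
have fC' : {ae P, forall z n, setT z -> (`|(f_ n z)%:E| <= (EFin \o (fun=> C)) z)%E}.
  by apply: nearW => z n _; rewrite /= lee_fin.
have [ig _ h] := dominated_convergence measurableT mf' mg' fg' iC fC'.
rewrite /Rintegral; apply: fine_cvg; rewrite fineK; last first.
  exact: integrable_fin_num.
exact: h.
Qed.

Lemma expectation_cvg_at_right (f : R -> T -> R) (g : T -> R) (t C : R) :
  (forall s, t < s -> measurable_fun setT (f s)) -> measurable_fun setT g ->
  (exists2 e, 0 < e & forall s, t < s < t + e -> forall z, `|f s z| <= C) ->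
  {ae P, forall z, f s z @[s --> t^'+] --> g z} ->
  \int[P]_z f s z @[s --> t^'+] --> \int[P]_z g z.
Proof.
move=> mf mg [e e0 fC] fg; apply/cvg_at_rightP => u [ut cu].
have [N _ uN] : \forall n \near \oo, u n < t + e.
  by have /cvgr_lt := cu; apply; rewrite ltrDl.
rewrite -(cvg_shiftn N) /=.
apply: (@expectation_cvg (fun n => f (u (n + N)%N)) g C) => //.
- by move=> n; exact: mf.
- by move=> n z; apply: fC; rewrite ut uN//= leq_addl.
- apply: filterS fg => z /cvg_at_rightP; apply; split => //.
  by rewrite (cvg_shiftn N).
Qed.

(** The Lipschitz bound dominates the difference quotients, and the limit is
    tested along sequences. *)
Lemma is_derive_expectation (f : R -> T -> R) (g : T -> R) (t e C M : R) :
  0 < e -> (forall s, `|s - t| < e -> measurable_fun setT (f s)) ->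
  measurable_fun setT g ->
  (forall s z, `|s - t| < e -> `|f s z| <= M) ->
  (forall s z, `|s - t| < e -> `|f s z - f t z| <= C * `|s - t|) ->
  {ae P, forall z, is_derive t (1 : R) (f^~ z) (g z)} ->
  is_derive t (1 : R) (fun s => \int[P]_z f s z) (\int[P]_z g z).
Proof.
move=> e0 mf mg fM fC fg.
have et : `|t - t| < e by rewrite subrr normr0.
have hc : h^-1 *: ((fun s => \int[P]_z f s z) (h *: (1 : R) + t) - \int[P]_z f t z)
    @[h --> (0 : R)^'] --> \int[P]_z g z.
  apply/cvgr_dnbhsP => u [u0 cu].
  have [N _ uN] : \forall n \near \oo, `|u n| < e.
    have : `|u n| @[n --> \oo] --> `|0 : R| by apply: cvg_norm.
    by rewrite normr0 => /cvgr_lt; apply.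
  have eu n : `|u (n + N)%N *: (1 : R) + t - t| < e.
    by rewrite addrK /GRing.scale/= mulr1 uN//= leq_addl.
  rewrite -(cvg_shiftn N) /=.
  rewrite (_ : (fun n => _) = (fun n => \int[P]_z
     ((u (n + N)%N)^-1 * (f (u (n + N)%N *: (1 : R) + t) z - f t z)))); last first.
    apply/funext => n; rewrite (@expectationZ _ _ (M + M)).
    - by rewrite (@expectationB _ _ M M)//; [exact: mf|exact: mf|move=> z; exact: fM|move=> z; exact: fM].
    - by apply: measurable_funB; exact: mf.
    - by move=> z; rewrite (le_trans (ler_normB _ _))// lerD// fM.
  apply: (@expectation_cvg _ g C) => //.
  - move=> n; apply: measurable_funM => //.
    by apply: measurable_funB; exact: mf.
  - move=> n z; rewrite normrM normfV mulrC ler_pdivrMr ?normr_gt0//.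
    by apply: (le_trans (fC _ _ (eu n))); rewrite addrK /GRing.scale/= mulr1.
  - apply: filterS fg => z [dz hz].
    have : h^-1 *: (f (h *: (1 : R) + t) z - f t z) @[h --> (0 : R)^'] --> g z.
      by rewrite -hz; exact: dz.
    move=> /cvgr_dnbhsP/(_ (fun n => u (n + N)%N)); apply; split => //.
    by rewrite (cvg_shiftn N).
split; first by apply/cvg_ex; exists (\int[P]_z g z).
exact: cvg_lim hc.
Qed.

Section Product.
Variables (h : T * T -> R) (C : R).
Hypothesis mh : measurable_fun setT h.
Hypothesis hC : forall p, `|h p| <= C.

Let mH : measurable_fun setT (EFin \o h). Proof. exact/measurable_EFinP. Qed.

Let ih : (P \x P)%E.-integrable setT (EFin \o h).
Proof.
have cstE c : (\int[P]_x c%:E = c%:E)%E.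
  by rewrite integral_cst//= probability_setT mule1.
apply/integrable12ltyP => //.
apply: (@le_lt_trans _ _ (\int[P]_x \int[P]_y C%:E)%E); last first.
  by under eq_integral do rewrite cstE; rewrite cstE ltry.
apply: ge0_le_integral => //.
- by move=> x _; apply: integral_ge0.
- apply: (measurable_fun_fubini_tonelli_F (abse \o (EFin \o h))) => /=.
    exact: measurableT_comp.
  by move=> xy.
- move=> x _; apply: ge0_le_integral => //.
  + by apply: measurableT_comp => //; apply: measurable_fun_pair2.
  + by move=> y _; rewrite lee_fin; exact: le_trans (hC (x, y)).
Qed.

Let sec_fin x : (\int[P]_y (h (x, y))%:E \is a fin_num)%E.
Proof.
apply: integrable_fin_num => //; apply: (@bounded_integrable _ C) => //.
exact: measurable_fun_pair2.
Qed.

Lemma measurable_expectation : measurable_fun setT (fun x => \int[P]_y h (x, y)).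
Proof.
apply/measurable_EFinP.
have := measurable_fubini_F ih; rewrite /fubini_F; congr measurable_fun.
by apply/funext => x; rewrite /= /Rintegral fineK.
Qed.

(** Exchanging the order of integration changes the sign. *)
Lemma expectation_antisym :
  (forall x y, h (y, x) = - h (x, y)) -> \int[P]_x \int[P]_y h (x, y) = 0.
Proof.
move=> anti; pose E x := \int[P]_y h (x, y).
have mE : measurable_fun setT E by exact: measurable_expectation.
have EC x : `|E x| <= C.
  by apply: expectation_norm_le => //; exact: measurable_fun_pair2.
have E'N y : \int[P]_x h (x, y) = - E y.
  rewrite /E -mulN1r -(@expectationZ _ _ C)//; last exact: measurable_fun_pair2.
  by apply: eq_Rintegral => x _; rewrite mulN1r anti.
have : \int[P]_x E x = - \int[P]_x E x.
  rewrite -[RHS]mulN1r -(@expectationZ _ _ C)// /Rintegral; congr fine.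
  have := Fubini ih; rewrite /=.
  rewrite (eq_integral (fun x => (E x)%:E)); last first.
    by move=> x _; rewrite /E /Rintegral fineK.
  move=> ->; apply: eq_integral => y _; rewrite mulN1r -E'N /Rintegral fineK//.
  apply: integrable_fin_num => //; apply: (@bounded_integrable _ C) => //.
  exact: measurable_fun_pair1.
by move=> /eqP; rewrite -addr_eq0 -mulr2n mulrn_eq0 => /eqP.
Qed.
End Product.

End Expectation.

(** * Alignment flows *)

Section AlignmentFlow.
Context {R : realType}.
Local Notation line := (measurableTypeR R).
Implicit Types (r s t x y z : R).

(** The trajectories of a classical solution, seen as random variables on the
    space of labels.  [Om] is the set of labels that carry the mass: there the
    flow is injective, and every other label copies the trajectory of one in
    [Om], which turns bounds on [Om] into bounds everywhere. *)
Record alignment_flow (P : probability line R) (Om : set R)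
    (dW psi : R -> R) (X V : R -> R -> R) : Prop := AlignmentFlow {
  flow_meas_pos : forall t, 0 <= t -> measurable_fun [set: line] (X t);
  flow_meas_vel : forall t, 0 <= t -> measurable_fun [set: line] (V t);
  flow_pos : forall t z, 0 < t -> is_derive t (1 : R) (X^~ z) (V t z);
  flow_vel : forall t z, 0 < t -> is_derive t (1 : R) (V^~ z)
    (- (\int[P]_y dW (X t z - X t y)) -
     \int[P]_y (psi (X t z - X t y) * (V t z - V t y)));
  flow_vel0 : forall z, V t z @[t --> 0^'+] --> V 0 z;
  flow_bounded : forall T, 0 <= T -> exists K, forall t z, 0 <= t <= T ->
    `|X t z| <= K /\ `|V t z| <= K;
  flow_lipschitz : forall a b, 0 < a -> exists2 L, 0 <= L &
    forall t z y, a <= t <= b -> `|V t z - V t y| <= L * `|X t z - X t y|;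
  flow_order : forall t z y, 0 <= t -> Om z -> Om y -> z < y -> X t z < X t y;
  flow_proj : forall z, exists2 z', Om z' & forall t, X t z = X t z' /\ V t z = V t z';
  flow_meas_dom : measurable (Om : set line);
  flow_full : P (~` Om) = 0%E;
  flow_atomless : forall A : set line, countable A -> P A = 0%E }.

Definition damping (P : probability line R) (X : R -> R -> R) (Psi : R -> R)
  t x := \int[P]_y Psi (X t x - X t y).

(** The damping is a total time derivative; absorbing it into the velocity
    leaves the attraction as the only force. *)
Definition modified_velocity (P : probability line R) (X V : R -> R -> R)
  (Psi : R -> R) t x := V t x + damping P X Psi t x.

Definition mean_attraction (P : probability line R) (X : R -> R -> R)
  (dW : R -> R) t x := \int[P]_y dW (X t x - X t y).

Variables (P : probability line R) (Om : set R) (X V : R -> R -> R).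
Variables (dW phi psi Psi : R -> R) (lam Lam : R).
Hypothesis fl : alignment_flow P Om dW psi X V.
Hypothesis lam0 : 0 < lam.
Hypothesis dW_odd : forall x, dW (- x) = - dW x.
Hypothesis dW_mono : forall x y, y < x -> lam * (x - y) <= dW x - dW y <= Lam * (x - y).
Hypothesis psiE : forall x, psi x = phi `|x|.
Hypothesis phi_ge0 : forall r, 0 < r -> 0 <= phi r.
Hypothesis phi_nincr : forall r s, 0 < r -> r <= s -> phi s <= phi r.
Hypothesis pot : alignment_potential phi Psi.

Let nd_Psi : {homo Psi : x y / x <= y}. Proof. exact: (pot_nondecreasing phi_ge0 pot). Qed.

Let mPsi : measurable_fun [set: line] Psi.
Proof. by apply: nondecreasing_measurable => // x y; exact: nd_Psi. Qed.

Let nd_dW : {homo dW : x y / x <= y}.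
Proof.
move=> y x; rewrite le_eqVlt => /predU1P[->//|yx].
have /andP[h _] := dW_mono yx; rewrite -subr_ge0 (le_trans _ h)//.
by rewrite mulr_ge0 ?subr_ge0// ltW.
Qed.

Let mdW : measurable_fun [set: line] dW.
Proof. by apply: nondecreasing_measurable => // x y; exact: nd_dW. Qed.

Let mX t : 0 <= t -> measurable_fun [set: line] (X t).
Proof. exact: (flow_meas_pos fl). Qed.

Let mV t : 0 <= t -> measurable_fun [set: line] (V t).
Proof. exact: (flow_meas_vel fl). Qed.

Let mpsi : measurable_fun [set: line] psi.
Proof. exact: (measurable_radial_weight phi_nincr psiE). Qed.

Local Notation damp := (damping P X Psi).
Local Notation om := (modified_velocity P X V Psi).
Local Notation attr := (mean_attraction P X dW).

Let mgap t x : 0 <= t -> measurable_fun [set: line] (fun y => X t x - X t y).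
Proof. by move=> t0; apply: measurable_funB => //; exact: mX. Qed.

Let homo_bound (f : R -> R) (K r : R) : (forall x, f (- x) = - f x) ->
  {homo f : x y / x <= y} -> `|r| <= K -> `|f r| <= f K.
Proof.
by move=> fodd fnd; rewrite ler_norml => /andP[h1 h2]; rewrite ler_norml -fodd !fnd.
Qed.

Let gap_bound t K : (forall z, `|X t z| <= K) -> forall x y, `|X t x - X t y| <= K + K.
Proof. by move=> hK x y; rewrite (le_trans (ler_normB _ _))// lerD. Qed.

(** At a fixed time the potential fails to be differentiable along the gap only
    when the gap is one of the countably many jumps of the weight; the flow being
    injective, this concerns countably many labels. *)
Let ae_regular t x : 0 < t -> Om x ->
  {ae P, forall y, is_derive t (1 : R) (fun s => Psi (X s x - X s y))
     (psi (X t x - X t y) * (V t x - V t y))}.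
Proof.
move=> t0 Ox.
pose J := [set r : R | 0 < r /\ ~ {for r, continuous phi}].
have cJ : countable J by exact: weight_discontinuities_countable phi_nincr.
pose B := [set y | Om y /\ J `|X t x - X t y|].
have cB : countable B.
  have inj : {in B &, injective (fun y => X t x - X t y)}.
    move=> y z /set_mem[Oy _] /set_mem[Oz _] /addrI/oppr_inj h.
    have [yz|zy|//] := ltgtP y z.
      by have := flow_order fl (ltW t0) Oy Oz yz; rewrite h ltxx.
    by have := flow_order fl (ltW t0) Oz Oy zy; rewrite h ltxx.
  rewrite -(eq_countable (inj_card_eq inj)).
  apply: (@sub_countable _ _ _ (\bigcup_(b : bool) ((fun r => (-1) ^+ b * r) @` J))).
    apply: subset_card_le => _ [y [_ Jy] <-].
    exists (X t x - X t y < 0) => //; exists `|X t x - X t y| => //.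
    by rewrite -realEsign // num_real.
  apply: bigcup_countable => // i _.
  by apply: sub_countable cJ; exact: card_image_le.
exists (~` Om `|` B); split.
- apply: measurableU; first exact: measurableC (flow_meas_dom fl).
  exact: countable_measurable.
- rewrite measureU0; first exact: flow_full fl.
  + exact: measurableC (flow_meas_dom fl).
  + exact: countable_measurable.
  + by apply: (flow_atomless fl).
move=> y /= ny; apply: contrapT => /not_orP[/contrapT Oy nB]; apply: ny.
have dXx := flow_pos fl x t0; have dXy := flow_pos fl y t0.
have dgap : is_derive t (1 : R) (fun s => X s x - X s y) (V t x - V t y).
  exact: is_deriveB.
have [yx|xy|xyE] := ltgtP y x; last first.
- rewrite xyE; rewrite [X in is_derive _ _ X _](_ : _ = cst 0).
    by rewrite !subrr mulr0; exact: is_derive_cst.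
  by apply/funext => s; rewrite subrr (pot0 pot).
- have gapN : 0 < X t y - X t x by rewrite subr_gt0 (flow_order fl) // ltW.
  have dgapN : is_derive t (1 : R) (fun s => X s y - X s x) (V t y - V t x).
    exact: is_deriveB.
  have cphi : {for X t y - X t x, continuous phi}.
    apply: contrapT => nc; apply: nB; split => //.
    by rewrite distrC ger0_norm ?(ltW gapN).
  have dP := pot_is_derive pot gapN cphi.
  have h := @is_derive1_comp _ Psi (fun s => X s y - X s x) t _ _ dP dgapN.
  have hN := is_deriveN h.
  rewrite [X in is_derive _ _ X _](_ : _ = (- (Psi \o (fun s => X s y - X s x)))).
    apply: (is_derive_eq hN).
    by rewrite psiE distrC ger0_norm ?(ltW gapN)//; ring.
  by apply/funext => s; rewrite -[X s x - _]opprB (pot_odd pot).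
- have gapP : 0 < X t x - X t y by rewrite subr_gt0 (flow_order fl) // ltW.
  have cphi : {for X t x - X t y, continuous phi}.
    apply: contrapT => nc; apply: nB; split => //.
    by rewrite ger0_norm ?(ltW gapP).
  have dP := pot_is_derive pot gapP cphi.
  have h := @is_derive1_comp _ Psi (fun s => X s x - X s y) t _ _ dP dgap.
  by apply: (is_derive_eq h); rewrite psiE ger0_norm ?(ltW gapP)//; ring.
Qed.

Let Psi_bound t K x y : (forall z, `|X t z| <= K) ->
  `|Psi (X t x - X t y)| <= Psi (K + K).
Proof. by move=> hK; apply: homo_bound => //; [exact: pot_odd pot|exact: gap_bound]. Qed.

Let is_derive_damp t x : 0 < t -> Om x -> is_derive t (1 : R) (damp^~ x)
  (\int[P]_y (psi (X t x - X t y) * (V t x - V t y))).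
Proof.
move=> t0 Ox; have th : 0 < t / 2 by rewrite divr_gt0.
have t2 : 0 <= 2 * t by rewrite mulr_ge0// ltW.
have [K hK] := flow_bounded fl t2.
have [L L0 hL] := flow_lipschitz fl (2 * t) th.
have inI s : `|s - t| < t / 2 -> t / 2 <= s <= 2 * t.
  by rewrite ltr_norml => /andP[h1 h2]; apply/andP; split; lra.
have pI s : t / 2 <= s <= 2 * t -> 0 < s <= 2 * t.
  by move=> /andP[h ->]; rewrite (lt_le_trans th).
have hK' s : t / 2 <= s <= 2 * t -> forall z, `|X s z| <= K.
  move=> /pI/andP[s0 s2] z; have [] // := hK s z; by rewrite ltW.
have tI : t / 2 <= t <= 2 * t by apply/andP; split; lra.
apply: (@is_derive_expectation _ _ _ P (fun s y => Psi (X s x - X s y))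
  (fun y => psi (X t x - X t y) * (V t x - V t y)) t (t / 2)
  (Psi (K + K) * (L * expR (L * (2 * t - t / 2)))) (Psi (K + K))) => //.
- move=> s /inI/pI/andP[s0 _]; apply: measurableT_comp => //; apply: mgap.
  exact: ltW.
- apply: measurable_funM.
    by apply: measurableT_comp => //; apply: mgap; exact: ltW.
  by apply: measurable_funB => //; apply: mV; exact: ltW.
- by move=> s z /inI hs; apply: Psi_bound; exact: hK'.
- move=> s z /inI hs; have [z' Oz' zE] := flow_proj fl z.
  rewrite (zE s).1 (zE t).1 => {z zE}.
  have dgap r y z : 0 < r -> is_derive r (1 : R) (fun s => X s y - X s z) (V r y - V r z).
    move=> r0; have := flow_pos fl y r0 => ?; have := flow_pos fl z r0 => ?.
    exact: is_deriveB.
  have lip y z : Om y -> Om z -> y < z ->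
      `|Psi (X s z - X s y) - Psi (X t z - X t y)| <=
      Psi (K + K) * (L * expR (L * (2 * t - t / 2))) * `|s - t|.
    move=> Oy Oz yz.
    have gap0 r : t / 2 <= r <= 2 * t -> 0 < X r z - X r y.
      move=> /pI/andP[r0 _]; rewrite subr_gt0; apply: (flow_order fl) => //.
      exact: ltW.
    apply: (@pot_gap_lipschitz _ _ _ phi_ge0 pot (fun r => X r z - X r y)
      (fun r => V r z - V r y) (t / 2) (2 * t)) => //.
    - by move=> r /pI/andP[r0 _]; exact: dgap.
    - move=> r hr; rewrite gap0//=.
      by rewrite (le_trans (ler_norm _))// gap_bound//; exact: hK'.
    - by move=> r hr; rewrite -[X in L * X]ger0_norm ?(ltW (gap0 r hr))// hL.
  have [zx|xz|->] := ltgtP z' x.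
  + exact: lip.
  + rewrite -[X s x - _]opprB -[X t x - _]opprB !(pot_odd pot) -opprD normrN.
    exact: lip.
  + by rewrite !subrr normr0 !mulr_ge0 ?(pot_ge0 phi_ge0 pot) ?expR_ge0 ?normr_ge0//
      (le_trans _ (gap_bound (hK' t tI) x x)).
- exact: ae_regular.
Qed.

Let is_derive_om t x : 0 < t -> Om x -> is_derive t (1 : R) (om^~ x) (- attr t x).
Proof.
move=> t0 Ox; have dv := flow_vel fl x t0; have dd := is_derive_damp t0 Ox.
have h := is_deriveD dv dd; apply: (is_derive_eq h); rewrite /mean_attraction; ring.
Qed.

Let bounded_at t : 0 <= t -> exists K, forall z, `|X t z| <= K /\ `|V t z| <= K.
Proof.
move=> t0; have [K hK] := flow_bounded fl t0.
by exists K => z; apply: hK; rewrite t0 lexx.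
Qed.

Let mPsi_gap t x : 0 <= t -> measurable_fun [set: line] (fun y => Psi (X t x - X t y)).
Proof. by move=> t0; apply: measurableT_comp => //; exact: mgap. Qed.

Let mdW_gap t x : 0 <= t -> measurable_fun [set: line] (fun y => dW (X t x - X t y)).
Proof. by move=> t0; apply: measurableT_comp => //; exact: mgap. Qed.

Let dampB t x y : 0 <= t ->
  damp t y - damp t x = \int[P]_z (Psi (X t y - X t z) - Psi (X t x - X t z)).
Proof.
move=> t0; have [K hK] := bounded_at t0; rewrite /damping.
rewrite (@expectationB _ _ _ P _ _ (Psi (K + K)) (Psi (K + K)))//.
- exact: mPsi_gap.
- exact: mPsi_gap.
- by move=> z; apply: Psi_bound => w; have [] := hK w.
- by move=> z; apply: Psi_bound => w; have [] := hK w.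
Qed.

Let attrB t x y : 0 <= t ->
  attr t y - attr t x = \int[P]_z (dW (X t y - X t z) - dW (X t x - X t z)).
Proof.
move=> t0; have [K hK] := bounded_at t0; rewrite /mean_attraction.
have b w z : `|dW (X t w - X t z)| <= dW (K + K).
  by apply: homo_bound => //; apply: gap_bound => u; have [] := hK u.
by rewrite (@expectationB _ _ _ P _ _ (dW (K + K)) (dW (K + K)))//; exact: mdW_gap.
Qed.

Let expectation_between (f : R -> R) (a b : R) : measurable_fun [set: line] f ->
  (forall z, a <= f z <= b) -> a <= \int[P]_z f z <= b.
Proof.
move=> mf ab; have fC z : `|f z| <= Num.max `|a| `|b|.
  have /andP[h1 h2] := ab z; rewrite le_max; have [f0|f0] := leP 0 (f z).
    by apply/orP; right; rewrite ger0_norm// (le_trans h2)// ler_norm.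
  apply/orP; left; rewrite ltr0_norm// (le_trans (_ : - f z <= - a)) ?lerN2//.
  by rewrite -normrN ler_norm.
apply/andP; split.
  rewrite -[leLHS](expectation_cst P); apply: (@expectation_le _ _ _ P _ _ (Num.max `|a| `|b|)) => //.
    by move=> z; rewrite le_max lexx.
  by move=> z; have /andP[] := ab z.
rewrite -[leRHS](expectation_cst P); apply: (@expectation_le _ _ _ P _ _ (Num.max `|a| `|b|)) => //.
  by move=> z; rewrite le_max lexx orbT.
by move=> z; have /andP[] := ab z.
Qed.

(** Pointwise in the third label, the increments of [dW] lie between [lam] and
    [Lam] times the gap, and those of [Psi] are nonnegative. *)
Lemma pair_flow x y : Om x -> Om y -> x < y ->
  pair_dynamics lam Lam (fun t => X t y - X t x) (fun t => om t y - om t x)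
    (fun t => damp t y - damp t x) (fun t => - attr t y - - attr t x).
Proof.
move=> Ox Oy xy.
have gap0 t : 0 < t -> 0 < X t y - X t x.
  by move=> t0; rewrite subr_gt0 (flow_order fl)// ltW.
split => //.
- move=> t t0; have := flow_pos fl y t0 => ?; have := flow_pos fl x t0 => ?.
  by apply: is_derive_eq; rewrite /modified_velocity; ring.
- by move=> t t0; apply: is_deriveB; exact: is_derive_om.
- move=> t t0.
  have : lam * (X t y - X t x) <= attr t y - attr t x <= Lam * (X t y - X t x).
    rewrite attrB ?(ltW t0)//; apply: expectation_between.
      by apply: measurable_funB; apply: mdW_gap; exact: ltW.
    move=> z; have hg : X t x - X t z < X t y - X t z.
      by rewrite ltrD2r -subr_gt0 gap0.
    by have := dW_mono hg; rewrite (_ : _ - _ - (_ - _) = X t y - X t x)//; ring.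
  by move=> /andP[h1 h2]; apply/andP; split; lra.
- move=> t t0; rewrite dampB ?(ltW t0)//; apply: Rintegral_ge0 => z _.
  by rewrite subr_ge0 nd_Psi// lerD2r -subr_ge0 ltW ?gap0.
Qed.

Lemma pair_damping_le t x y : 0 < t -> Om x -> Om y -> x < y ->
  damp t y - damp t x <= 2 * Psi (X t y - X t x).
Proof.
move=> t0 Ox Oy xy; rewrite dampB ?(ltW t0)//.
have gap0 : X t x < X t y by rewrite (flow_order fl)// ltW.
suff /andP[] : 0 <= \int[P]_z (Psi (X t y - X t z) - Psi (X t x - X t z)) <=
  2 * Psi (X t y - X t x) by [].
apply: expectation_between.
  by apply: measurable_funB; apply: mPsi_gap; exact: ltW.
move=> z; have hg : X t x - X t z <= X t y - X t z by rewrite lerD2r ltW.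
rewrite subr_ge0 nd_Psi//=.
have := pot_incr_le phi_ge0 phi_nincr pot hg.
by rewrite (_ : _ - _ - (_ - _) = X t y - X t x)//; ring.
Qed.

(** For third labels between [p] and [q] the pair lies on both sides of the
    singularity, where an increment of [Psi] is bounded below by the value at
    half the gap; the other labels contribute nonnegatively. *)
Lemma pair_damping_ge t x p q y : 0 < t -> Om x -> Om p -> Om q -> Om y ->
  x <= p -> p < q -> q <= y ->
  fine (P (Om `&` `[p, q])) * Psi ((X t y - X t x) / 2) <= damp t y - damp t x.
Proof.
move=> t0 Ox Op Oq Oy xp pq qy; rewrite dampB ?(ltW t0)//.
have xy : x < y by rewrite (le_lt_trans xp)// (lt_le_trans pq).
have ordX u v : Om u -> Om v -> u <= v -> X t u <= X t v.
  move=> Ou Ov; rewrite le_eqVlt => /predU1P[->//|uv].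
  by apply/ltW/(flow_order fl) => //; exact: ltW.
set c := Psi _.
have mB : measurable ((Om `&` `[p, q]) : set line).
  by apply: measurableI; [exact: (flow_meas_dom fl)|exact: measurable_itv].
have c0 : 0 <= c.
  apply: (pot_ge0 phi_ge0 pot); rewrite divr_ge0// subr_ge0.
  by apply: ordX => //; exact: ltW.
have -> : fine (P (Om `&` `[p, q])) * c = \int[P]_z (c * \1_(Om `&` `[p, q]) z).
  rewrite (@expectationZ _ _ _ P _ c 1) => //.
    by rewrite mulrC /Rintegral integral_indic// setIT.
  by move=> z; rewrite indicE; case: (_ \in _); rewrite ?normr1 ?normr0.
have [K hK] := bounded_at (ltW t0).
have Pb u v : `|Psi (X t u - X t v)| <= Psi (K + K).
  by apply: Psi_bound => w; have [] := hK w.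
apply: (@expectation_le _ _ _ P _ _ (Num.max c (Psi (K + K) + Psi (K + K)))) => //.
- by apply: measurable_funM => //; exact: measurable_indic.
- by apply: measurable_funB; apply: mPsi_gap; exact: ltW.
- move=> z; rewrite indicE le_max; case: (_ \in _).
    by rewrite mulr1 ger0_norm// lexx.
  by rewrite mulr0 normr0 c0.
- by move=> z; rewrite (le_trans (ler_normB _ _))// le_max lerD ?Pb ?orbT.
move=> z; rewrite indicE; have [/set_mem[Oz]|_] := boolP (z \in _).
  rewrite /= in_itv/= => /andP[pz zq]; rewrite mulr1 /c.
  have h1 : X t x - X t z <= 0.
    by rewrite subr_le0; apply: ordX => //; exact: le_trans pz.
  have h2 : 0 <= X t y - X t z.
    by rewrite subr_ge0; apply: ordX => //; exact: le_trans qy.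
  have := pot_incr_ge phi_ge0 pot h1 h2.
  by rewrite (_ : _ - _ - (_ - _) = X t y - X t x)//; ring.
rewrite mulr0 subr_ge0 nd_Psi// lerD2r; apply: ordX => //; exact: ltW.
Qed.

(** The damping and the attraction are odd functions of the difference of two
    positions, so their means over independent labels vanish.  Passing to the
    modified velocity avoids integrating the singular weight over pairs. *)
Lemma flow_mean_velocity t : 0 <= t -> \int[P]_z V t z = \int[P]_z V 0 z.
Proof.
pose m (t : R) := \int[P]_z V t z.
have V_bound (s : R) : 0 <= s -> exists K, forall z, `|V s z| <= K.
  by move=> s0; have [K hK] := bounded_at s0; exists K => z; have [] := hK z.
have m_gap (f : R -> R) (s : R) : measurable_fun [set: line] f -> 0 <= s ->
    measurable_fun [set: line * line] (fun p => f (X s p.1 - X s p.2)).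
  move=> mf s0; apply: measurableT_comp => //; apply: measurable_funB.
    by apply: (measurableT_comp (mX s0)); exact: measurable_fst.
  by apply: (measurableT_comp (mX s0)); exact: measurable_snd.
have odd_mean (f : R -> R) (s : R) : measurable_fun [set: line] f ->
    (forall x, f (- x) = - f x) -> {homo f : x y / x <= y} -> 0 <= s ->
    \int[P]_x \int[P]_y f (X s x - X s y) = 0.
  move=> mf fo fn s0; have [K hK] := bounded_at s0.
  apply: (@expectation_antisym _ _ _ P (fun p => f (X s p.1 - X s p.2)) (f (K + K))).
  - exact: m_gap.
  - by move=> z /=; apply: homo_bound => //; apply: gap_bound => u; have [] := hK u.
  - by move=> x y /=; rewrite -fo opprB.
have m_dampT (s : R) : 0 <= s -> measurable_fun [set: line] (damp s).
  move=> s0; have [K hK] := bounded_at s0.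
  apply: (@measurable_expectation _ _ _ P (fun p => Psi (X s p.1 - X s p.2)) (Psi (K + K))).
  - exact: m_gap.
  - by move=> z /=; apply: Psi_bound => u; have [] := hK u.
have m_attrT (s : R) : 0 <= s -> measurable_fun [set: line] (attr s).
  move=> s0; have [K hK] := bounded_at s0.
  apply: (@measurable_expectation _ _ _ P (fun p => dW (X s p.1 - X s p.2)) (dW (K + K))).
  - exact: m_gap.
  - by move=> z /=; apply: homo_bound => //; apply: gap_bound => u; have [] := hK u.
have damp_bound (s K : R) : 0 <= s -> (forall z, `|X s z| <= K) -> forall x, `|damp s x| <= Psi (K + K).
  by move=> s0 hK x; apply: expectation_norm_le; [exact: mPsi_gap|move=> z; exact: Psi_bound].
have attr_bound (s K : R) : 0 <= s -> (forall z, `|X s z| <= K) -> forall x, `|attr s x| <= dW (K + K).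
  move=> s0 hK x; apply: expectation_norm_le; first exact: mdW_gap.
  by move=> z; apply: homo_bound => //; exact: gap_bound.
have omE (s : R) : 0 <= s -> \int[P]_x om s x = m s.
  move=> s0; have [K hK] := bounded_at s0.
  rewrite /modified_velocity (@expectationD _ _ _ P _ _ K (Psi (K + K))).
  - by rewrite (odd_mean Psi s) ?addr0//; exact: pot_odd pot.
  - exact: mV.
  - exact: m_dampT.
  - by move=> z; have [] := hK z.
  - by apply: damp_bound => // z; have [] := hK z.
have om_derive (s z : R) : 0 < s -> is_derive s (1 : R) (om^~ z) (- attr s z).
  move=> s0; have [z' Oz' zE] := flow_proj fl z.
  have h := is_derive_om s0 Oz'.
  have aE : attr s z' = attr s z by rewrite /mean_attraction (zE s).1.
  have fE : om^~ z' = om^~ z.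
    by apply/funext => r; rewrite /modified_velocity /damping (zE r).1 (zE r).2.
  rewrite aE in h.
  exact: (eq_ind _ (fun f => is_derive s (1 : R) f (- attr s z)) h _ fE).
have dm (s : R) : 0 < s -> is_derive s (1 : R) m 0.
  move=> s0; have sh : 0 < s / 2 by rewrite divr_gt0.
  have s2 : 0 <= 2 * s by rewrite mulr_ge0// ltW.
  have [K hK] := flow_bounded fl s2.
  have inI r : `|r - s| < s / 2 -> s / 2 <= r <= 2 * s.
    by rewrite ltr_norml => /andP[h1 h2]; apply/andP; split; lra.
  have pI r : s / 2 <= r <= 2 * s -> 0 < r <= 2 * s.
    by move=> /andP[h ->]; rewrite (lt_le_trans sh).
  have hKX r : s / 2 <= r <= 2 * s -> forall z, `|X r z| <= K.
    by move=> /pI/andP[r0 r2] z; have [] // := hK r z; rewrite ltW.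
  have hKV r : s / 2 <= r <= 2 * s -> forall z, `|V r z| <= K.
    by move=> /pI/andP[r0 r2] z; have [] // := hK r z; rewrite ltW.
  have sI : s / 2 <= s <= 2 * s by apply/andP; split; lra.
  have dE : is_derive s (1 : R) (fun r => \int[P]_z om r z) (\int[P]_z - attr s z).
    apply: (@is_derive_expectation _ _ _ P om (fun z => - attr s z) s (s / 2)
      (dW (K + K)) (K + Psi (K + K))) => //.
    - move=> r /inI/pI/andP[r0 _]; apply: measurable_funD; first by apply: mV; exact: ltW.
      by apply: m_dampT; exact: ltW.
    - by apply: measurable_funN; apply: m_attrT; exact: ltW.
    - move=> r z /inI hr; rewrite (le_trans (ler_normD _ _))// lerD ?hKV//.
      by have /pI/andP[r0 _] := hr; apply: damp_bound; [exact: ltW|exact: hKX].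
    - move=> r z /inI hr.
      have lip a b : s / 2 <= a <= 2 * s -> s / 2 <= b <= 2 * s -> a <= b ->
          `|om b z - om a z| <= dW (K + K) * `|b - a|.
        move=> ha hb ab.
        have inab c : a <= c <= b -> s / 2 <= c <= 2 * s.
          move: ha hb => /andP[ha _] /andP[_ hb] /andP[ac cb].
          by rewrite (le_trans ha ac) (le_trans cb hb).
        have dab c : a <= c <= b -> is_derive c (1 : R) (om^~ z) (- attr c z).
          by move=> /inab/pI/andP[c0 _]; exact: om_derive.
        have [||c] := @MVT_segment _ (om^~ z) (fun c => - attr c z) a b ab.
        - by move=> c; rewrite in_itv/= => /andP[ac cb]; apply: dab; rewrite !ltW.
        - exact: derive_within_continuous dab.
        rewrite in_itv/= => /inab hc ->; rewrite normrM normrN ler_wpM2r//.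
        by have /pI/andP[c0 _] := hc; apply: attr_bound; [exact: ltW|exact: hKX].
      have [rs|sr] := leP r s; last by apply: lip => //; exact: ltW.
      by rewrite distrC [`|r - s|]distrC; exact: lip.
    - by apply: nearW => z; exact: om_derive.
  have E0 : \int[P]_z - attr s z = 0.
    rewrite -oppr0 -(odd_mean dW s) ?(ltW s0)// -/(mean_attraction P X dW s) -mulN1r.
    rewrite -(@expectationZ _ _ _ P _ (-1) (dW (K + K))).
    - by apply: eq_Rintegral => z _; rewrite mulN1r.
    - by apply: m_attrT; exact: ltW.
    - by apply: attr_bound; [exact: ltW|exact: hKX].
  rewrite E0 in dE; apply: near_eq_is_derive dE.
  have : \forall r \near s, 0 < r by exact: lt_nbhsr.
  by apply: filterS => r r0; rewrite omE// ltW.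
have mc (a b : R) : 0 < a -> a <= b -> m b = m a.
  move=> a0 ab; have dab r : a <= r <= b -> is_derive r (1 : R) m 0.
    by move=> /andP[ar _]; apply: dm; exact: lt_le_trans ar.
  have dabN r : a <= r <= b -> is_derive r (1 : R) (- m) (- 0).
    by move=> hr; apply: is_deriveN; exact: dab.
  apply/eqP; rewrite eq_le; apply/andP; split.
    apply: (@is_derive_nincr _ m (fun=> 0)) => //.
    - exact: derive_within_continuous dab.
    - by move=> r /andP[ar rb]; apply: dab; rewrite !ltW.
  rewrite -lerN2; apply: (@is_derive_nincr _ (- m) (fun=> - 0)) => //.
  - exact: derive_within_continuous dabN.
  - by move=> r /andP[ar rb]; apply: dabN; rewrite !ltW.
rewrite le_eqVlt => /predU1P[t0|t0]; first by rewrite -t0.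
have m0 : m s @[s --> 0^'+] --> m 0.
  have [K hK] := flow_bounded fl ler01.
  apply: (@expectation_cvg_at_right _ _ _ P V (V 0) 0 K).
  - by move=> s s0; apply: mV; exact: ltW.
  - exact: mV.
  - exists 1 => // s /andP[s0 s1] z; have [] // := hK s z.
    by rewrite (ltW s0) ltW// -[ltRHS]add0r.
  - by apply: nearW => z; exact: flow_vel0 fl z.
have mt : m s @[s --> 0^'+] --> m t.
  apply: (@cvg_trans _ ((fun=> m t) @ 0^'+)); last exact: cvg_cst.
  apply: near_eq_cvg; near=> s.
  have s0 : 0 < s by near: s; exact: nbhs_right_gt.
  by apply: mc => //; near: s; exact: nbhs_right_le.
exact: cvg_unique mt m0.
Unshelve. all: end_near. Qed.

End AlignmentFlow.

(** * Decay along alignment flows *)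

Section FlowDecay.
Context {R : realType}.
Local Notation line := (measurableTypeR R).
Implicit Types (r s t x y z : R).
Variables (P : probability line R) (Om : set R) (X V : R -> R -> R).
Variables (dW phi psi Psi : R -> R) (lam Lam : R).
Hypothesis fl : alignment_flow P Om dW psi X V.
Hypothesis lam0 : 0 < lam.
Hypothesis lamLam : lam <= Lam.
Hypothesis dW_odd : forall x, dW (- x) = - dW x.
Hypothesis dW_mono : forall x y, y < x -> lam * (x - y) <= dW x - dW y <= Lam * (x - y).
Hypothesis psiE : forall x, psi x = phi `|x|.
Hypothesis phi_ge0 : forall r, 0 < r -> 0 <= phi r.
Hypothesis phi_nincr : forall r s, 0 < r -> r <= s -> phi s <= phi r.
Hypothesis pot : alignment_potential phi Psi.
Variables p q : R.
Hypothesis Omp : Om p.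
Hypothesis Omq : Om q.
Hypothesis pq : p < q.
Hypothesis mpq : 0 < fine (P (Om `&` `[p, q])).

Let Lam0 : 0 < Lam. Proof. exact: lt_le_trans lamLam. Qed.

Local Notation damp := (damping P X Psi).
Local Notation om := (modified_velocity P X V Psi).

(** Wide pairs enclose a fixed portion of the mass, so that their damping has a
    lower bound with a constant uniform in the pair. *)
Definition wide_pair x y := [/\ Om x, Om y, x <= p & q <= y].

Let D x y t := X t y - X t x.
Let w x y t := om t y - om t x.
Let F x y t := damp t y - damp t x.

Let wide_lt x y : wide_pair x y -> x < y.
Proof. by case=> _ _ xp qy; rewrite (le_lt_trans xp)// (lt_le_trans pq). Qed.

Let pd x y : Om x -> Om y -> x < y -> exists dw,
  pair_dynamics lam Lam (D x y) (w x y) (F x y) dw.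
Proof.
move=> Ox Oy xy; eexists.
exact: (pair_flow fl lam0 dW_odd dW_mono psiE phi_ge0 phi_nincr pot Ox Oy xy).
Qed.

Let ordX t u v : 0 <= t -> Om u -> Om v -> u <= v -> X t u <= X t v.
Proof.
move=> t0 Ou Ov; rewrite le_eqVlt => /predU1P[->//|uv].
by apply/ltW/(flow_order fl).
Qed.

Let nd_Psi : {homo Psi : x y / x <= y}. Proof. exact: (pot_nondecreasing phi_ge0 pot). Qed.

(** At time one the bounds come from the boundedness of the flow, and the gap of
    a wide pair is at least that of [(p, q)]; the energy extends the upper bound
    to later times. *)
Lemma wide_pair_bounds : exists M0 delta : R, [/\ 0 < delta, delta <= M0 &
  forall x y, wide_pair x y -> [/\ w x y 1 <= M0, delta <= D x y 1 &
    forall t, 1 <= t -> D x y t <= M0]].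
Proof.
have [K hK] := flow_bounded fl (@ler01 R).
have hX z : `|X 1 z| <= K by have [] // := hK 1 z; rewrite ler01 lexx.
have hV z : `|V 1 z| <= K by have [] // := hK 1 z; rewrite ler01 lexx.
have K0 : 0 <= K by exact: le_trans (hX 0).
have PK : 0 <= Psi (K + K) by apply: (pot_ge0 phi_ge0 pot); rewrite addr_ge0.
pose N := 2 * K + 2 * Psi (K + K) + 1.
have N0 : 0 < N by rewrite /N; lra.
have il0 : 0 < lam^-1 by rewrite invr_gt0.
pose M0 := (1 + lam^-1) * N.
have NM : N <= M0 by rewrite /M0 mulrDl mul1r lerDl mulr_ge0// ltW.
have hD x y : D x y 1 <= K + K.
  by rewrite /D (le_trans (ler_norm _))// (le_trans (ler_normB _ _))// lerD.
exists M0, (D p q 1); split.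
- by rewrite /D subr_gt0 (flow_order fl).
- by rewrite (le_trans (hD p q))// (le_trans _ NM)// /N; lra.
move=> x y wxy; have [Ox Oy xp qy] := wxy; have xy := wide_lt wxy.
have [dw pdxy] := pd Ox Oy xy.
have D10 : 0 < D x y 1 by exact: (pair_gap_gt0 pdxy).
have w1N : w x y 1 <= N.
  have h1 : damp 1 y - damp 1 x <= 2 * Psi (X 1 y - X 1 x).
    by apply: (pair_damping_le fl phi_ge0 phi_nincr pot).
  have h2 : Psi (D x y 1) <= Psi (K + K) by apply: nd_Psi.
  have /ler_normlP[h3 _] := hV x; have /ler_normlP[_ h4] := hV y.
  rewrite /D in h2; rewrite /w /modified_velocity /N; lra.
have w10 : 0 <= w x y 1 by exact: (pair_mom_ge0 lam0 pdxy).
split => //; first exact: le_trans NM.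
  rewrite /D; have := ordX ler01 Ox Omp xp; have := ordX ler01 Omq Oy qy; lra.
move=> t t1; have t0 : 0 < t by exact: lt_le_trans t1.
have en := pair_energy lam0 pdxy ltr01 t1.
have Dt0 : 0 < D x y t by exact: (pair_gap_gt0 pdxy).
have M00 : 0 <= M0 by rewrite (le_trans _ NM)// ltW.
rewrite -(ler_pXn2r (ltn0Sn 1)) ?nnegrE ?(ltW Dt0)//.
have D1N : D x y 1 <= N by rewrite (le_trans (hD x y))// /N; lra.
have h1 : lam * D x y t ^+ 2 <= N ^+ 2 + lam * N ^+ 2.
  have h2 : w x y 1 ^+ 2 <= N ^+ 2 by rewrite ler_pXn2r ?nnegrE// ltW.
  have h3 : D x y 1 ^+ 2 <= N ^+ 2 by rewrite ler_pXn2r ?nnegrE// ltW.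
  have h4 : lam * D x y 1 ^+ 2 <= lam * N ^+ 2 by rewrite ler_wpM2l// ltW.
  have : 0 <= w x y t ^+ 2 by rewrite sqr_ge0.
  lra.
have h2 : D x y t ^+ 2 <= (1 + lam^-1) * N ^+ 2.
  rewrite -(ler_pM2l lam0); apply: (le_trans h1).
  rewrite le_eqVlt; apply/orP; left; apply/eqP; field; exact: lt0r_neq0.
apply: (le_trans h2); rewrite /M0 exprMn ler_wpM2r ?sqr_ge0//.
by rewrite expr2 -[leLHS]mulr1 ler_wpM2l//; lra.
Qed.

Variable b : R.
Hypothesis b0 : 0 < b.
Hypothesis Psi_ge : forall M, 0 < M -> exists2 k, 0 < k &
  forall r, 0 <= r -> r <= M -> k * r `^ b <= Psi r.
Hypothesis Psi_le : forall M, 0 < M -> exists2 C, 0 <= C &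
  forall r, 0 <= r -> r <= M -> Psi r <= C * r `^ b.

Let power_damping M0 : 0 < M0 ->
    (forall x y, wide_pair x y -> forall t, 1 <= t -> D x y t <= M0) ->
  exists kap C : R, [/\ 0 < kap, 0 <= C & forall x y, wide_pair x y ->
    forall t, 1 <= t ->
    kap * D x y t `^ b <= F x y t <= C * D x y t `^ b /\
    2 * Psi (D x y t) <= C * D x y t `^ b].
Proof.
move=> M00 DM; have [k k0 hk] := Psi_ge M00; have [C C0 hC] := Psi_le M00.
exists (fine (P (Om `&` `[p, q])) * k * 2^-1 `^ b), (2 * C); split.
- by rewrite !mulr_gt0// powR_gt0.
- by rewrite mulr_ge0.
move=> x y wxy t t1; have [Ox Oy xp qy] := wxy; have xy := wide_lt wxy.
have t0 : 0 < t by exact: lt_le_trans t1.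
have D0 : 0 < D x y t by rewrite /D subr_gt0 (flow_order fl)// ltW.
have DM' := DM x y wxy t t1.
have hP : 2 * Psi (D x y t) <= 2 * C * D x y t `^ b.
  by rewrite -mulrA ler_wpM2l// hC// ltW.
split => //; apply/andP; split; last first.
  by apply: le_trans hP; apply: (pair_damping_le fl phi_ge0 phi_nincr pot).
have h1 : fine (P (Om `&` `[p, q])) * Psi (D x y t / 2) <= F x y t.
  by apply: (pair_damping_ge fl phi_ge0 pot).
apply: le_trans h1; rewrite -!mulrA ler_wpM2l ?(ltW mpq)//.
rewrite -powRM ?invr_ge0 ?(ltW D0)// mulrC [_ / 2]mulrC mulrC hk//; last by lra.
by rewrite mulr_ge0 ?invr_ge0// ltW.
Qed.

(** Moving the labels apart increases both gaps, as positions and modified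
    velocities are monotone in the label; the actual velocities differ from the
    modified ones by dampings, which [Psi] bounds. *)
Let enclose t z1 z2 : 0 < t -> exists x y, [/\ wide_pair x y,
  `|X t z1 - X t z2| <= D x y t &
  `|V t z1 - V t z2| <= w x y t + 2 * Psi (D x y t)].
Proof.
move=> t0; have [u Ou uE] := flow_proj fl z1; have [v Ov vE] := flow_proj fl z2.
rewrite !(uE t).1 !(uE t).2 !(vE t).1 !(vE t).2 => {uE vE}.
wlog uv : u v Ou Ov / u <= v.
  move=> h; have [uv|/ltW vu] := leP u v; first exact: h.
  have [x [y [wxy h1 h2]]] := h v u Ov Ou vu.
  by exists x, y; split; rewrite // distrC.
pose x := Num.min u p; pose y := Num.max v q.
have Ox : Om x by rewrite /x minElt; case: ifP.
have Oy : Om y by rewrite /y maxElt; case: ifP.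
have wxy : wide_pair x y.
  by split => //; [rewrite /x ge_min lexx orbT|rewrite /y le_max lexx orbT].
exists x, y; split => //.
  rewrite distrC ger0_norm ?subr_ge0 ?ordX ?(ltW t0)// /D lerB// ordX ?(ltW t0)//.
    by rewrite /y le_max lexx.
  by rewrite /x ge_min lexx.
have xu : x <= u by rewrite /x ge_min lexx.
have vy : v <= y by rewrite /y le_max lexx.
have om_mono a c : Om a -> Om c -> a <= c -> om t a <= om t c.
  move=> Oa Oc; rewrite le_eqVlt => /predU1P[->//|ac].
  have [dw pdac] := pd Oa Oc ac.
  by rewrite -subr_ge0; exact: (pair_mom_ge0 lam0 pdac).
have o1 := om_mono x u Ox Ou xu; have o2 := om_mono v y Ov Oy vy.
have o3 := om_mono u v Ou Ov uv.
have PD : Psi (D u v t) <= Psi (D x y t).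
  by apply: nd_Psi; rewrite /D lerB// ordX// ltW.
have F1 : 0 <= F u v t <= 2 * Psi (D u v t).
  move: uv; rewrite le_eqVlt => /predU1P[uvE|uv].
    by rewrite /F /D uvE !subrr (pot0 pot) mulr0 lexx.
  have [dw pduv] := pd Ou Ov uv.
  rewrite (pair_damping_ge0 pduv)//=; exact: (pair_damping_le fl phi_ge0 phi_nincr pot).
have PD0 : 0 <= Psi (D x y t).
  apply: (pot_ge0 phi_ge0 pot); rewrite /D subr_ge0 ordX ?(ltW t0)//.
  exact/ltW/wide_lt.
have VE : V t u - V t v = F u v t - (om t v - om t u).
  by rewrite /F /modified_velocity; ring.
rewrite VE /w; move: F1 => /andP[F0 F1].
by rewrite ler_norml; apply/andP; split; lra.
Qed.

Let wide_decay (K e : R) t : 0 < t ->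
  (forall x y, wide_pair x y -> D x y t <= e /\ w x y t + 2 * Psi (D x y t) <= K) ->
  forall z1 z2, `|X t z1 - X t z2| <= e /\ `|V t z1 - V t z2| <= K.
Proof.
move=> t0 h z1 z2; have [x [y [wxy h1 h2]]] := enclose z1 z2 t0.
by have [h3 h4] := h x y wxy; split; [exact: le_trans h3|exact: le_trans h4].
Qed.

Lemma flow_exp_decay : b = 1 -> exists K c : R, [/\ 0 < K, 0 < c &
  forall t z1 z2, 0 <= t -> `|X t z1 - X t z2| <= K * expR (- (c * t)) /\
                     `|V t z1 - V t z2| <= K * expR (- (c * t))].
Proof.
move=> b1; have [M0 [delta [delta0 dM wb]]] := wide_pair_bounds.
have M00 : 0 < M0 by exact: lt_le_trans dM.
have [|kap [C [kap0 C0 hF]]] := power_damping M00.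
  by move=> x y /wb[].
have [K [c [K0 c0 hKc]]] := pair_exp_decay Lam lam0 kap0 C0 delta0 dM.
have [K1 hK1] := flow_bounded fl (@ler01 R).
have K10 : 0 <= K1 by have [|h _] := hK1 0 0; [rewrite lexx ler01|exact: le_trans h].
(* The last term covers the times before one. *)
pose K' := K + C * K + 2 * K1 * expR c.
have CK : 0 <= C * K by rewrite mulr_ge0// ltW.
have KE : 0 <= 2 * K1 * expR c by rewrite !mulr_ge0// expR_ge0.
exists K', c; split=> //; first by rewrite /K'; lra.
move=> t z1 z2 t0; have [t1|t1] := leP 1 t.
  have tp : 0 < t by exact: lt_le_trans t1.
  have e0 : 0 <= expR (- (c * t)) by exact: expR_ge0.
  have E0 := mulr_ge0 KE e0; have E1 := mulr_ge0 CK e0; have E2 := mulr_ge0 (ltW K0) e0.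
  apply: wide_decay => // x y wxy; have [Ox Oy xp qy] := wxy.
  have xy := wide_lt wxy; have [dw pdxy] := pd Ox Oy xy.
  have [w1 D1 DM] := wb x y wxy.
  have Dp s : 1 <= s -> 0 < D x y s.
    by move=> s1; apply: (pair_gap_gt0 pdxy); exact: lt_le_trans s1.
  have [|||wt Dt] := hKc _ _ _ _ pdxy _ _ _ t t1 => //.
  - by move=> s s1; have [+ _] := hF x y wxy s s1; rewrite b1 powRr1// ltW// Dp.
  - by rewrite D1 DM.
  have [_] := hF x y wxy t t1; rewrite b1 powRr1 ?(ltW (Dp t t1))// => hP.
  have h3 : C * D x y t <= C * (K * expR (- (c * t))) by rewrite ler_wpM2l.
  by rewrite /K'; split; lra.
have h4 : 1 <= expR c * expR (- (c * t)).
  rewrite -expRD -expR0 ler_expR; have : c * t <= c * 1 by rewrite ler_wpM2l// ltW.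
  lra.
have h5 : 2 * K1 <= K' * expR (- (c * t)).
  have E2 : 0 <= (K + C * K) * expR (- (c * t)).
    by rewrite mulr_ge0 ?expR_ge0// addr_ge0// ltW.
  have : 2 * K1 * 1 <= 2 * K1 * (expR c * expR (- (c * t))) by rewrite ler_wpM2l// mulr_ge0.
  rewrite /K'; lra.
have ht : 0 <= t <= 1 by rewrite t0 ltW.
have [x1 v1] := hK1 t z1 ht; have [x2 v2] := hK1 t z2 ht.
by split; rewrite (le_trans (ler_normB _ _))// (le_trans _ h5)//; lra.
Qed.

Lemma flow_power_decay alpha : 0 < alpha -> alpha < 1 -> b = 1 - alpha ->
  exists K T : R, [/\ 0 < K, 1 <= T &
  forall t z1 z2, T <= t -> `|X t z1 - X t z2| <= K * t `^ (- alpha^-1) /\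
                     `|V t z1 - V t z2| <= K * t `^ (- (alpha^-1 - 1))].
Proof.
move=> a0 a1 bE; have [M0 [delta [delta0 dM wb]]] := wide_pair_bounds.
have M00 : 0 < M0 by exact: lt_le_trans dM.
have [|kap [C [kap0 C0 hF]]] := power_damping M00.
  by move=> x y /wb[].
have [K [T [K0 T1 hKT]]] := pair_power_decay Lam lam0 a0 a1 kap0 C0 delta0 M00.
pose K' := K + C * K `^ b.
have CK : 0 <= C * K `^ b by rewrite mulr_ge0// powR_ge0.
exists K', T; split => //; first by rewrite /K'; lra.
move=> t z1 z2 Tt; have t1 := le_trans T1 Tt.
have tp : 0 < t by exact: lt_le_trans t1.
apply: wide_decay => // x y wxy; have [Ox Oy xp qy] := wxy.
have xy := wide_lt wxy; have [dw pdxy] := pd Ox Oy xy.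
have [w1 D1 DM] := wb x y wxy.
have Dp : 0 < D x y t by exact: (pair_gap_gt0 pdxy).
have FD s : 1 <= s -> kap * D x y s `^ (1 - alpha) <= F x y s <= C * D x y s `^ (1 - alpha).
  by move=> s1; rewrite -bE; have [] := hF x y wxy s s1.
have [wK DK] := hKT _ _ _ _ pdxy FD w1 D1 DM.
have Dt := DK t Tt; have wt := wK t t1.
split; first by apply: (le_trans Dt); rewrite ler_wpM2r ?powR_ge0// /K' lerDl.
have [_ hP] := hF x y wxy t t1.
have h3 : D x y t `^ b <= K `^ b * t `^ (- (alpha^-1 - 1)).
  rewrite -(powR_gap_mom a0 t) -bE -powRM ?powR_ge0 ?(ltW K0)//.
  by apply: le_powR => //; exact: ltW.
have h4 : C * D x y t `^ b <= C * (K `^ b * t `^ (- (alpha^-1 - 1))).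
  by rewrite ler_wpM2l.
rewrite /K'; lra.
Qed.

Lemma flow_power_lower alpha : 0 < alpha -> alpha < 1 -> b = 1 - alpha ->
  exists c T : R, [/\ 0 < c, 1 <= T &
  forall t, T <= t -> c * t `^ (- alpha^-1) <= X t q - X t p].
Proof.
move=> a0 a1 bE; have [M0 [delta [delta0 dM wb]]] := wide_pair_bounds.
have M00 : 0 < M0 by exact: lt_le_trans dM.
have [|kap [C [kap0 C0 hF]]] := power_damping M00.
  by move=> x y /wb[].
have [K [T [K0 T1 hKT]]] := pair_power_decay Lam lam0 a0 a1 kap0 C0 delta0 M00.
have wpq : wide_pair p q by [].
have [dw pdpq] := pd Omp Omq pq; have [w1 D1 DM] := wb p q wpq.
have FD t : 1 <= t -> kap * D p q t `^ (1 - alpha) <= F p q t <= C * D p q t `^ (1 - alpha).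
  by move=> t1; rewrite -bE; have [] := hF p q wpq t t1.
have [_ DK] := hKT _ _ _ _ pdpq FD w1 D1 DM.
exact: (pair_power_lower lam0 Lam0 a0 a1 pdpq kap0 C0 K0 T1 FD DK).
Qed.

End FlowDecay.

(** * Regular functions along paths *)

Section Regularity.
Context {R : realType}.
Local Notation mu := (@lebesgue_measure R).
Local Notation line := (measurableTypeR R).
Implicit Types (f : R -> R -> R) (g : R -> R) (s t x y z : R).

Lemma continuous_within_compact_bounded (g : R * R -> R) (A : set (R * R)) :
  compact A -> {within A, continuous g} -> exists K, forall p, A p -> `|g p| <= K.
Proof.
move=> cA cg; have [->|A0] := eqVneq A set0; first by exists 0.
have {}A0 : A !=set0 by exact/set0P.
have cng : {within A, continuous (fun p => `|g p|)}.
  by move=> p; apply: continuous_comp; [exact: cg|exact: norm_continuous].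
have [c _ hc] := compact_EVT_max A0 cA cng.
by exists `|g c| => p Ap; apply: hc; rewrite inE.
Qed.

Lemma rectangle_compact (a b c d : R) :
  compact [set p : R * R | a <= p.1 <= b /\ c <= p.2 <= d].
Proof.
have := compact_setX (@segment_compact R a b) (@segment_compact R c d).
by congr compact; apply/seteqP; split => -[p q] /=; rewrite !in_itv.
Qed.

(** The continuity up to the initial time, in the form used along a
    trajectory. *)
Lemma regular_cvg f t (F : set_system R) (gam : R -> R) (x : R) : Filter F ->
  classically_regular f -> 0 <= t -> s @[s --> F] --> t ->
  (\forall s \near F, 0 <= s) ->
  gam s @[s --> F] --> x -> f s (gam s) @[s --> F] --> f t x.
Proof.
move=> FF [/subspace_continuousP cf _] t0 Ft F0 Fx.
have := cf (t, x) t0 => cfx.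
have hp : (fun s => (s, gam s)) @ F --> within [set p : R * R | 0 <= p.1] (nbhs (t, x)).
  have h : (s, gam s) @[s --> F] --> (t, x).
    exact: (@cvg_pair _ _ _ F (nbhs t) (nbhs x) _ _ _ id gam Ft Fx).
  move=> A hA; have hA' := h _ hA.
  by apply: filterS2 F0 hA' => s s0 /=; apply.
exact: cvg_comp hp cfx.
Qed.

Lemma regular_slice_continuous f t : classically_regular f -> 0 <= t ->
  continuous (f t).
Proof.
move=> rf t0 x; have [/subspace_continuousP cf _] := rf.
have := cf (t, x) t0 => cfx.
have hp : (fun y => (t, y)) @ x --> within [set p : R * R | 0 <= p.1] (nbhs (t, x)).
  have h : (t, y) @[y --> x] --> (t, x).
    exact: (@cvg_pair _ _ _ (nbhs x) (nbhs t) (nbhs x) _ _ _ (fun=> t) id (cvg_cst _) (@cvg_id _ _)).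
  move=> A hA; have hA' : \forall y \near x, 0 <= t -> A (t, y) := h _ hA.
  suff : \forall y \near x, A (t, y) by [].
  by apply: filterS hA' => y; apply.
exact: cvg_comp hp cfx.
Qed.

Lemma regular_bounded f T K : classically_regular f ->
  exists M, forall t x, 0 <= t <= T -> `|x| <= K -> `|f t x| <= M.
Proof.
move=> [cf _]; have := continuous_within_compact_bounded (@rectangle_compact 0 T (- K) K).
move=> /(_ (fun p => f p.1 p.2)) [].
  by apply: continuous_subspaceW cf => p /= [/andP[]].
move=> M hM; exists M => t x tT xK; apply: (hM (t, x)).
by split => //=; rewrite -ler_norml.
Qed.

Lemma regular_dx_bounded f a b K : classically_regular f -> 0 < a ->
  exists2 L, 0 <= L & forall t x, a <= t <= b -> `|x| <= K -> `|dx f t x| <= L.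
Proof.
move=> [_ rf] a0; have := continuous_within_compact_bounded (@rectangle_compact a b (- K) K).
move=> /(_ (fun p => dx f p.1 p.2)) [].
  apply: continuous_in_subspaceT => -[t x]; rewrite inE => -[/= /andP[at_ _] _].
  by have [] := rf t x (lt_le_trans a0 at_).
move=> M hM; exists `|M| => // t x tT xK.
by apply: le_trans (ler_norm _); apply: (hM (t, x)); split => //=; rewrite -ler_norml.
Qed.

Lemma regular_dx f t x : classically_regular f -> 0 < t ->
  is_derive x (1 : R) (f t) (dx f t x).
Proof.
move=> [_ rf] t0; have [_ h _ _] := rf t x t0.
by rewrite /dx derive1E; apply: DeriveDef.
Qed.

Lemma regular_dt f t x : classically_regular f -> 0 < t ->
  is_derive t (1 : R) (f^~ x) (dt f t x).
Proof.
move=> [_ rf] t0; have [h _ _ _] := rf t x t0.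
by rewrite /dt derive1E; apply: DeriveDef.
Qed.

Lemma regular_lipschitz f t K L x y : classically_regular f -> 0 < t ->
  (forall x, `|x| <= K -> `|dx f t x| <= L) -> `|x| <= K -> `|y| <= K ->
  `|f t x - f t y| <= L * `|x - y|.
Proof.
move=> rf t0 hL; wlog yx : x y / y <= x.
  move=> h xK yK; have [yx|/ltW xy] := leP y x; first exact: h.
  by rewrite distrC [`|x - y|]distrC; exact: h.
move=> xK yK; have dfr (z : R) : y <= z <= x -> is_derive z (1 : R) (f t) (dx f t z).
  by move=> _; exact: regular_dx.
have [||c] := @MVT_segment _ (f t) (dx f t) y x yx.
- by move=> c _; exact: regular_dx.
- exact: derive_within_continuous dfr.
rewrite in_itv/= => /andP[yc cx] ->; rewrite normrM ler_wpM2r//; apply: hL.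
move: xK yK; rewrite !ler_norml => /andP[_ xK] /andP[yK _].
by rewrite (le_trans yK)//= (le_trans cx).
Qed.

(** Partial derivatives suffice for the chain rule along a path, since the space
    derivative is continuous. *)
Lemma regular_chain f (gam : R -> R) t d : classically_regular f -> 0 < t ->
  is_derive t (1 : R) gam d ->
  is_derive t (1 : R) (fun s => f s (gam s)) (dt f t (gam t) + dx f t (gam t) * d).
Proof.
move=> rf t0 dgam; set x := gam t.
have [_ rf'] := rf; have [_ _ _ cdx] := rf' t x t0.
pose T (h : R) := h *: (1 : R) + t.
have TE h : T h = h + t by rewrite /T /GRing.scale/= mulr1.
(* The mean value theorem in space, at the shifted time. *)
have slope h : exists xi, `|xi - x| <= `|gam (T h) - x| /\
    (0 < T h -> f (T h) (gam (T h)) - f (T h) x = dx f (T h) xi * (gam (T h) - x)).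
  have [ht|ht] := ltP 0 (T h); last by exists x; split=> //; rewrite ?subrr ?normr0.
  have cf (a b : R) : {within `[a, b], continuous (f (T h))}.
    apply: (@derive_within_continuous _ _ (dx f (T h))) => r _; exact: regular_dx.
  have hd (a b : R) : forall r, r \in `]a, b[%R -> is_derive r (1 : R) (f (T h)) (dx f (T h) r).
    by move=> r _; exact: regular_dx.
  have [xg|gx] := leP x (gam (T h)).
    have [c] := MVT_segment xg (hd _ _) (cf _ _).
    rewrite in_itv/= => /andP[xc cg] E; exists c; split => //.
    by rewrite !ger0_norm ?subr_ge0// lerB.
  have [c] := MVT_segment (ltW gx) (hd _ _) (cf _ _).
  rewrite in_itv/= => /andP[gc cx] E; exists c; split.
    by rewrite !ler0_norm ?subr_le0 ?(ltW gx)// lerN2 lerB.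
  by move=> _; rewrite -opprB E; ring.
have [xi hxi] := choice slope.
have cT : T h @[h --> (0 : R)] --> t.
  have -> : T = (fun h => h + t) by apply/funext.
  rewrite -[X in _ --> X]add0r; apply: cvgD; [exact: cvg_id|exact: cvg_cst].
have cgam : gam (T h) @[h --> (0 : R)] --> x.
  exact: cvg_comp cT (is_derive_continuous dgam).
have cxi : xi h @[h --> (0 : R)] --> x.
  apply/cvgrPdist_le => e e0; have /cvgrPdist_le/(_ e e0) := cgam.
  apply: filterS => h; rewrite distrC => hh; rewrite distrC.
  exact: le_trans (hxi h).1 hh.
have cq : dx f (T h) (xi h) @[h --> (0 : R)^'] --> dx f t x.
  have hp : (T h, xi h) @[h --> (0 : R)] --> (t, x).
    exact: (@cvg_pair _ _ _ (nbhs (0 : R)) (nbhs t) (nbhs x) _ _ _ T xi cT cxi).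
  apply: cvg_trans (cvg_comp _ _ hp cdx); apply: cvg_app; exact: cvg_within.
have cg' : h^-1 *: (gam (T h) - x) @[h --> (0 : R)^'] --> d.
  by have [dg <-] := dgam; exact: dg.
have cf' : h^-1 *: (f (T h) x - f t x) @[h --> (0 : R)^'] --> dt f t x.
  by have [dg <-] := regular_dt x rf t0; exact: dg.
have hc : h^-1 *: (f (T h) (gam (T h)) - f t x) @[h --> (0 : R)^'] -->
    dt f t x + dx f t x * d.
  have hs : h^-1 *: (f (T h) x - f t x) +
     dx f (T h) (xi h) * (h^-1 *: (gam (T h) - x)) @[h --> (0 : R)^'] -->
      dt f t x + dx f t x * d by apply: cvgD => //; exact: cvgM.
  apply: cvg_trans hs; apply: near_eq_cvg.
  have : \forall h \near (0 : R)^', 0 < T h.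
    by apply: cvg_within; have := cvgr_gt _ cT; apply.
  apply: filterS => h Th; have := (hxi h).2 Th => E.
  have -> : f (T h) (gam (T h)) - f t x =
      (f (T h) x - f t x) + dx f (T h) (xi h) * (gam (T h) - x) by rewrite -E; ring.
  by rewrite /GRing.scale/=; ring.
split; first by apply/cvg_ex; eexists; exact: hc.
exact: cvg_lim hc.
Qed.

Lemma density_measure_gt0 (g : R -> R) (x : R) (V : set R) :
  prob_density g -> {for x, continuous g} -> 0 < g x -> open V -> V x ->
  (0 < density_measure g V)%E.
Proof.
move=> [mg g0 _] cg gx oV Vx.
have gx2 : g x / 2 < g x by rewrite ltr_pdivrMr// ltr_pMr// ltr1n.
have : \forall y \near x, V y /\ g x / 2 < g y.
  near=> y; split; first by near: y; exact: open_nbhs_nbhs.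
  by near: y; have := cvgr_gt _ cg; apply.
move=> /nbhs_ballP[e /= e0 he].
pose B : set line := ball x e.
have mB : measurable B by apply: open_measurable; exact: ball_open.
have mV : measurable (V : set line) by exact: open_measurable.
have BV : B `<=` V by move=> y /he[].
have mgE : measurable_fun [set: line] (EFin \o g) by exact/measurable_EFinP.
apply: (@lt_le_trans _ _ (\int[mu]_(y in B) (g x / 2)%:E)%E).
  rewrite integral_cst//= /B (lebesgue_measure_ball _ (ltW e0)) -EFinM lte_fin.
  by rewrite !mulr_gt0 // mulrn_wgt0.
apply: (@le_trans _ _ (\int[mu]_(y in B) (g y)%:E)%E).
  apply: ge0_le_integral => //.
  - by move=> y _; rewrite lee_fin divr_ge0// ltW.
  - exact: measurable_funTS.
  - by move=> y /he[_ /ltW]; rewrite lee_fin.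
apply: ge0_subset_integral => //; first exact: measurable_funTS.
by move=> y _; rewrite lee_fin.
Unshelve. all: end_near. Qed.

(** The change of variables under a push-forward, for real integrals. *)
Lemma Rintegral_transfer (P Q : probability line R) (Y g : R -> R) :
  measurable_fun [set: line] Y -> measurable_fun [set: line] g ->
  (forall A : set line, measurable A -> Q A = P (Y @^-1` A)) ->
  \int[Q]_y g y = \int[P]_z g (Y z).
Proof.
move=> mY mg QP; rewrite /Rintegral; congr fine.
pose Z : line -> line := Y.
have mZ : measurable_fun [set: line] Z by [].
pose mZ_mixin := isMeasurableFun.Build _ _ _ _ Z mZ.
pose mfY : {mfun line >-> line} := HB.pack Z mZ_mixin.
have mgE : measurable_fun [set: line] (EFin \o g) by exact/measurable_EFinP.
have ge0 (h : line -> \bar R) : measurable_fun setT h -> (forall y, 0 <= h y)%E ->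
    (\int[Q]_y h y = \int[P]_z h (Y z))%E.
  move=> mh h0; transitivity (\int[distribution P mfY]_y h y)%E.
    by apply: eq_measure_integral => A mA _; exact: QP.
  exact: ge0_integral_distribution.
rewrite [LHS]integralE [RHS]integralE; congr (_ - _)%E.
  rewrite ge0; last 2 first.
  - by apply: measurable_funepos.
  - by move=> y; exact: funepos_ge0.
  by apply: eq_integral => z _; rewrite !funeposE.
rewrite ge0; last 2 first.
- by apply: measurable_funeneg.
- by move=> y; exact: funeneg_ge0.
by apply: eq_integral => z _; rewrite !funenegE.
Qed.

End Regularity.

(** * The flow of a classical solution *)

Definition positive_set (R : realType) (f : R -> R) : set R := [set z | 0 < f z].

Section SolutionFlow.
Context {R : realType}.
Local Notation mu := (@lebesgue_measure R).
Local Notation line := (measurableTypeR R).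
Implicit Types (r s t x y z : R).
Variables (W psi rho0 u0 : R -> R) (rho u : R -> R -> R).
Hypothesis mpsi : measurable_fun [set: line] psi.
Hypothesis mdW : measurable_fun [set: line] (derive1 W).
Hypothesis sol : classical_solution W psi rho0 u0 rho u.
Hypothesis rho0_supp : compact (supp rho0).
Variable eta : R -> R -> R.
Hypothesis is_eta : is_flow rho0 rho u eta.

Local Notation S0 := (supp rho0).
Local Notation Om := (positive_set rho0).

Let rrho : classically_regular rho. Proof. exact: (sol_rho_reg sol). Qed.
Let ru : classically_regular u. Proof. exact: (sol_u_reg sol). Qed.

Lemma solution_density0 : prob_density rho0.
Proof. by rewrite -(sol_rho_init sol); apply: (sol_density sol). Qed.

Let hf0 := solution_density0.
Let P : probability line R := density_prob hf0.

Let rho_ge0 t x : 0 <= t -> 0 <= rho t x.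
Proof. by move=> t0; have [_ + _] := sol_density sol t0. Qed.

Let rho0_ge0 x : 0 <= rho0 x. Proof. by case: hf0. Qed.

Let rho0_neq0 x : rho0 x != 0 -> Om x.
Proof. by move=> n0; rewrite /positive_set /= lt_neqAle eq_sym n0 rho0_ge0. Qed.

Let crho0 : continuous rho0.
Proof. by rewrite -(sol_rho_init sol); exact: (regular_slice_continuous rrho). Qed.

Let Om_supp z : Om z -> S0 z.
Proof. by move=> Oz; apply: subset_closure => /=; rewrite gt_eqF. Qed.

Let open_Om : open Om.
Proof. by have /continuousP/(_ _ (@open_gt _ 0)) := crho0. Qed.

Let mOm : measurable (Om : set line).
Proof. exact: open_measurable. Qed.

Let Om_nonempty : exists z, Om z.
Proof.
apply: contrapT => h; have [_ _] := hf0.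
rewrite integral0_eq => [|x _]; first by move=> /eqP; rewrite eq_sym onee_eq0.
by congr EFin; apply/eqP; apply: contrapT => /negP n0; apply: h; exists x; exact: rho0_neq0.
Qed.

Let base := projT1 (cid Om_nonempty).
Let Obase : Om base. Proof. exact: (projT2 (cid Om_nonempty)). Qed.

Let pr z := if pselect (Om z) then z else base.
Let Opr z : Om (pr z). Proof. by rewrite /pr; case: pselect. Qed.
Let prE z : Om z -> pr z = z. Proof. by rewrite /pr; case: pselect. Qed.

(** Labels outside the support are sent to a fixed trajectory, so that pointwise
    bounds hold for every label. *)
Definition lagrangian_position t z := eta t (pr z).
Definition lagrangian_velocity t z := u t (eta t (pr z)).
Local Notation X := lagrangian_position.
Local Notation V := lagrangian_velocity.

Let eta0 z : S0 z -> eta 0 z = z.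
Proof. by case: is_eta => + _ _ => /[apply] -[]. Qed.

Let ceta z : S0 z -> {within [set t : R | 0 <= t], continuous (fun t => eta t z)}.
Proof. by case: is_eta => + _ _ => /[apply] -[]. Qed.

Let deta t z : S0 z -> 0 < t -> is_derive t (1 : R) (fun s => eta s z) (u t (eta t z)).
Proof. by case: is_eta => + _ _ => /[apply] -[_ _]; apply. Qed.

Let ceta_itv z a b : S0 z -> 0 <= a -> {within `[a, b], continuous (fun t => eta t z)}.
Proof.
move=> Sz a0; apply: continuous_subspaceW (ceta Sz) => t /=.
by rewrite in_itv/= => /andP[/(le_trans a0)].
Qed.

Let eta_cvg0 z : S0 z -> eta s z @[s --> 0^'+] --> z.
Proof.
move=> Sz; have cz : eta s z @[s --> within [set t : R | 0 <= t] (nbhs (0 : R))] --> eta 0 z.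
  by have /subspace_continuousP h := ceta Sz; exact: (h 0 (lexx _)).
rewrite eta0// in cz; apply: cvg_trans cz; apply: cvg_app.
move=> A hA; have {}hA : \forall s \near (0 : R), 0 <= s -> A s := hA.
suff : \forall s \near (0 : R), 0 < s -> A s by [].
by apply: filterS hA => s hs s0; apply: hs; exact: ltW.
Qed.

(** Trajectories in one dimension cannot overtake one another without meeting. *)
Lemma eta_increasing t y z : 0 <= t -> S0 y -> S0 z -> y < z -> eta t y < eta t z.
Proof.
move=> t0 Sy Sz yz; rewrite ltNge; apply/negP => h.
pose g s := eta s z - eta s y.
have cg : {within `[0, t], continuous g}.
  by move=> s; apply: continuousB; [exact: ceta_itv|exact: ceta_itv].
have g0 : g 0 = z - y by rewrite /g !eta0.
have [|c] := IVT (v := 0) t0 cg.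
  have h1 : g t <= 0 by rewrite subr_le0.
  have h2 : 0 <= g 0 by rewrite g0 subr_ge0 ltW.
  by rewrite ge_min h1 orbT le_max h2.
rewrite in_itv/= => /andP[c0 ct] /eqP; rewrite subr_eq0 => /eqP E.
have [_ inj _] := is_eta.
have := inj c c0 z y (mem_set Sz) (mem_set Sy) E => zy.
by rewrite zy ltxx in yz.
Qed.

Let eta_nd t y z : 0 <= t -> S0 y -> S0 z -> y <= z -> eta t y <= eta t z.
Proof.
move=> t0 Sy Sz; rewrite le_eqVlt => /predU1P[->//|yz].
by apply/ltW/eta_increasing.
Qed.

Lemma eta_bounded (T : R) : 0 <= T -> exists K : R, forall t z, 0 <= t <= T -> S0 z -> `|eta t z| <= K.
Proof.
move=> T0; have S0ne : S0 !=set0 by exists base; exact: Om_supp.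
have cid0 : {within S0, continuous (@idfun R)}.
  by apply: continuous_in_subspaceT => x _; exact: cvg_id.
have [zM /set_mem SM hM] := compact_EVT_max S0ne rho0_supp cid0.
have [zm /set_mem Sm hm] := compact_EVT_min S0ne rho0_supp cid0.
have bd z : S0 z -> exists K, forall t, 0 <= t <= T -> `|eta t z| <= K.
  move=> Sz; have cn : {within `[0, T], continuous (fun t => `|eta t z|)}.
    by move=> t; apply: continuous_comp; [exact: ceta_itv|exact: norm_continuous].
  have [c _ hc] := EVT_max T0 cn.
  by exists `|eta c z| => t tT; apply: hc; rewrite in_itv.
have [KM hKM] := bd zM SM; have [Km hKm] := bd zm Sm.
exists (Num.max KM Km) => t z tT Sz; have t0 : 0 <= t by case/andP: tT.
have h1 : eta t z <= eta t zM by apply: eta_nd => //; apply: hM; rewrite inE.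
have h2 : eta t zm <= eta t z by apply: eta_nd => //; apply: hm; rewrite inE.
have /ler_normlP[_ h3] := hKM t tT; have /ler_normlP[h4 _] := hKm t tT.
rewrite le_max; have [e0|e0] := leP 0 (eta t z).
  by rewrite ger0_norm// (le_trans h1 h3).
by rewrite ltr0_norm// (le_trans _ h4) ?orbT// lerN2.
Qed.

Let product_rule t x : 0 < t ->
  [/\ dt (fun s y => rho s y * u s y) t x = dt rho t x * u t x + rho t x * dt u t x,
      dx (fun s y => rho s y * u s y) t x = dx rho t x * u t x + rho t x * dx u t x &
      dx (fun s y => rho s y * u s y ^+ 2) t x =
        dx rho t x * u t x ^+ 2 + 2 * rho t x * u t x * dx u t x].
Proof.
move=> t0.
have h1 := regular_dt x rrho t0; have h2 := regular_dt x ru t0.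
have h3 := regular_dx x rrho t0; have h4 := regular_dx x ru t0.
split.
- have h : is_derive t (1 : R) (fun s => rho s x * u s x) (dt rho t x * u t x + rho t x * dt u t x).
    by apply: is_derive_eq; rewrite /GRing.scale/=; ring.
  by rewrite {1}/dt derive1E; have [_ ->] := h.
- have h : is_derive x (1 : R) (fun y => rho t y * u t y) (dx rho t x * u t x + rho t x * dx u t x).
    by apply: is_derive_eq; rewrite /GRing.scale/=; ring.
  by rewrite {1}/dx derive1E; have [_ ->] := h.
- have h : is_derive x (1 : R) (fun y => rho t y * u t y ^+ 2)
      (dx rho t x * u t x ^+ 2 + 2 * rho t x * u t x * dx u t x).
    by apply: is_derive_eq; rewrite /GRing.scale/=; ring.
  by rewrite {1}/dx derive1E; have [_ ->] := h.
Qed.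

(** The continuity equation turns into a linear equation for the density along a
    trajectory, whose solutions keep their sign. *)
Lemma density_pos_along t z : 0 <= t -> Om z -> 0 < rho t (eta t z).
Proof.
rewrite le_eqVlt => /predU1P[<-|t0] Oz; have Sz := Om_supp Oz.
  by rewrite eta0// (sol_rho_init sol).
pose g s := rho s (eta s z).
have g_ge0 s : 0 <= s -> 0 <= g s by move=> s0; exact: rho_ge0.
have dg s : 0 < s -> is_derive s (1 : R) g (- dx u s (eta s z) * g s).
  move=> s0; have h := regular_chain rrho s0 (deta Sz s0).
  apply: (is_derive_eq h); have := sol_continuity sol (eta s z) s0.
  have [_ -> _] := product_rule (eta s z) s0; rewrite /g; lra.
have cg0 : g s @[s --> 0^'+] --> rho0 z.
  rewrite -(sol_rho_init sol); apply: regular_cvg => //.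
  - by apply: cvg_at_right_filter; exact: cvg_id.
  - by near=> s; apply/ltW; near: s; exact: nbhs_right_gt.
  - exact: eta_cvg0.
have [a [a0 aT ga]] : exists a, [/\ 0 < a, a < t & 0 < g a].
  have : \forall s \near 0^'+, [/\ 0 < s, s < t & 0 < g s].
    near=> s; split; near: s; [exact: nbhs_right_gt|exact: nbhs_right_lt|].
    by have := cvgr_gt _ cg0; apply.
  by move=> /filter_ex[a ha]; exists a.
have [K hK] := eta_bounded (ltW t0).
have [L L0 hL] := regular_dx_bounded t K ru a0.
pose h s := - (g s * expR (L * (s - a))).
pose dh s := - ((- dx u s (eta s z) * g s) * expR (L * (s - a)) + g s * (L * expR (L * (s - a)))).
have dhE s : a <= s <= t -> is_derive s (1 : R) h (dh s).
  move=> /andP[as_ st]; have s0 : 0 < s by exact: lt_le_trans as_.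
  have hg := dg s s0.
  have dl : is_derive s (1 : R) (fun r => L * (r - a)) L.
    by apply: is_derive_eq; rewrite /GRing.scale/=; ring.
  have he := @is_derive1_comp _ expR _ s _ _ (is_derive_expR _) dl.
  have he' : is_derive s (1 : R) (fun r => expR (L * (r - a))) (L * expR (L * (s - a))).
    by apply: (is_derive_eq he); rewrite mulrC.
  by rewrite /h /dh; apply: is_derive_eq; rewrite /GRing.scale/=; ring.
have : h t <= h a.
  apply: (@is_derive_nincr _ h dh) => //; first exact: ltW.
  - exact: derive_within_continuous dhE.
  - by move=> s /andP[as_ st]; apply: dhE; rewrite !ltW.
  - move=> s /andP[as_ st]; have s0 : 0 < s by exact: lt_trans as_.
    have /ler_normlP[_ hdx] : `|dx u s (eta s z)| <= L.
      by apply: hL; rewrite ?(ltW as_) ?(ltW st)//; apply: hK; rewrite // !ltW.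
    have : 0 <= (L - dx u s (eta s z)) * (g s * expR (L * (s - a))).
      by rewrite !mulr_ge0 ?expR_ge0 ?subr_ge0// g_ge0// ltW.
    rewrite /dh; lra.
rewrite /h subrr mulr0 expR0 mulr1 lerN2 => hh.
have : 0 < g t * expR (L * (t - a)) by exact: lt_le_trans hh.
by rewrite pmulr_lgt0 ?expR_gt0.
Unshelve. all: end_near. Qed.

Let SpS z : S0 (pr z). Proof. exact/Om_supp/Opr. Qed.

Let mX t : 0 <= t -> measurable_fun [set: line] (X t).
Proof.
move=> t0; apply: (measurability (@RGenCInfty.G R)) => [|/= _ [_] [r] -> <-].
  exact: RGenCInfty.measurableE.
pose I := [set y | exists z, [/\ Om z, r <= eta t z & z <= y]].
have mI : measurable (I : set line).
  apply: is_interval_measurable => a b [z [Oz rz za]] _ c /andP[ac _].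
  by exists z; split => //; exact: le_trans ac.
rewrite setTI (_ : _ @^-1` _ = (Om `&` I) `|` (~` Om `&` [set _ | r <= eta t base])).
  apply: measurableU; first exact: measurableI.
  apply: measurableI; first exact: measurableC.
  have [h|h] := boolP (r <= eta t base).
    by rewrite (_ : [set _ | _] = setT)//; apply/seteqP; split.
  by rewrite (_ : [set _ | _] = set0)//; apply/seteqP; split => // y /=; rewrite (negbTE h).
apply/seteqP; split => z /=; rewrite in_itv/= andbT /lagrangian_position /pr.
  by case: pselect => Oz h; [left; split => //; exists z|right].
case: pselect => Oz [[Oz' [y [Oy ry yz]]]|[nOz h]] //.
by rewrite (le_trans ry)//; apply: eta_nd => //; exact: Om_supp.
Qed.

(** The labels at which [rho0] vanishes, where [X] differs from the flow, do not
    contribute. *)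
Lemma distribution_density t (A : set line) : 0 <= t -> measurable A ->
  density_measure (rho t) A = P (X t @^-1` A).
Proof.
move=> t0 mA; have [_ _ push] := is_eta; rewrite (push t t0 A mA).
rewrite /P /= /density_prob /density_measure integral_mkcond [RHS]integral_mkcond.
apply: eq_integral => z _; rewrite !patchE.
have [z0|/rho0_neq0 Oz] := eqVneq (rho0 z) 0; first by rewrite z0; do 2 case: ifP.
congr (if _ then _ else _); apply/idP/idP => /set_mem h; apply/mem_set.
  by move: h => [_]; rewrite /preimage /= /lagrangian_position prE.
by split; [exact: Om_supp|move: h; rewrite /preimage /= /lagrangian_position prE].
Qed.

Lemma transfer t (g : R -> R) : 0 <= t -> measurable_fun [set: line] g ->
  \int[mu]_y (g y * rho t y) = \int[P]_z g (X t z).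
Proof.
move=> t0 mg; rewrite (Rintegral_density (sol_density sol t0))//.
apply: Rintegral_transfer => //; first exact: mX.
by move=> A mA; rewrite -distribution_density.
Qed.

Let cu t : 0 <= t -> continuous (u t).
Proof. exact: regular_slice_continuous. Qed.

Let mu_t t : 0 <= t -> measurable_fun [set: line] (u t).
Proof. by move=> t0; apply: continuous_measurable_fun; exact: cu. Qed.

(** The continuity equation times [u] cancels the terms of the momentum equation
    that do not differentiate the velocity; the rest is divided by the density,
    which is positive along the trajectory. *)
Lemma velocity_derive t z : 0 < t -> is_derive t (1 : R) (V^~ z)
    (- (\int[P]_y derive1 W (X t z - X t y)) -
     \int[P]_y (psi (X t z - X t y) * (V t z - V t y))).
Proof.
move=> t0; have h := regular_chain ru t0 (deta (@SpS z) t0).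
apply: (is_derive_eq h); set x := eta t (pr z).
have rp : 0 < rho t x by apply: density_pos_along; [exact: ltW|exact: Opr].
have [E1 E2 E3] := product_rule x t0.
have := sol_momentum sol x t0; have := sol_continuity sol x t0.
rewrite E1 E2 E3 => c m.
have -> : \int[P]_y derive1 W (X t z - X t y) = attraction W (rho t) x.
  rewrite /attraction (@transfer t (fun y => derive1 W (x - y))) ?(ltW t0)//.
  by apply: measurableT_comp => //; apply: measurable_funB.
have -> : \int[P]_y (psi (X t z - X t y) * (V t z - V t y)) = alignment psi (rho t) (u t) x.
  rewrite /alignment (@transfer t (fun y => psi (x - y) * (u t x - u t y))) ?(ltW t0)//.
  apply: measurable_funM; first by apply: measurableT_comp => //; apply: measurable_funB.
  by apply: measurable_funB => //; apply: mu_t; exact: ltW.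
apply: (mulfI (lt0r_neq0 rp)).
have -> : rho t x * (dt u t x + dx u t x * u t x) =
  (dt rho t x * u t x + rho t x * dt u t x + (dx rho t x * u t x ^+ 2 + 2 * rho t x * u t x * dx u t x))
   - u t x * (dt rho t x + (dx rho t x * u t x + rho t x * dx u t x)) by ring.
by rewrite c m; ring.
Qed.

Lemma solution_alignment_flow : alignment_flow P Om (derive1 W) psi X V.
Proof.
split.
- exact: mX.
- by move=> t t0; apply: (measurableT_comp (mu_t t0)); exact: mX.
- by move=> t z t0; exact: deta.
- by move=> t z t0; exact: velocity_derive.
- move=> z; apply: (@regular_cvg _ u 0 _ (fun s => eta s (pr z)) (eta 0 (pr z))) => //.
  + by apply: cvg_at_right_filter; exact: cvg_id.
  + by near=> s; apply/ltW; near: s; exact: nbhs_right_gt.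
  + by rewrite eta0//; exact: eta_cvg0.
- move=> T T0; have [K hK] := eta_bounded T0.
  have [M hM] := regular_bounded T K ru.
  exists (Num.max K M) => t z tT; have hX := hK t (pr z) tT (@SpS z).
  by split; rewrite le_max ?hX// hM ?orbT.
- move=> a b a0; have [|K hK] := @eta_bounded `|b| _; first exact: normr_ge0.
  have [L L0 hL] := regular_dx_bounded b K ru a0.
  exists L => // t z y /andP[at_ tb]; have t0 : 0 < t by exact: lt_le_trans at_.
  have tI : 0 <= t <= `|b| by rewrite ltW//= (le_trans tb)// ler_norm.
  apply: (regular_lipschitz ru t0 (K := K)).
  + by move=> x; apply: hL; rewrite at_.
  + exact: hK.
  + exact: hK.
- move=> t z y t0 Oz Oy zy; rewrite /lagrangian_position !prE//.
  by apply: eta_increasing => //; exact: Om_supp.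
- move=> z; exists (pr z) => // t.
  by rewrite /lagrangian_position /lagrangian_velocity !(prE (Opr _)).
- exact: mOm.
- rewrite /P /= /density_prob /density_measure; apply: integral0_eq => z /= nO.
  by congr EFin; apply/eqP; apply: contrapT => /negP /rho0_neq0.
- move=> A cA; rewrite /P /= /density_prob /density_measure; apply: null_set_integral.
  + exact: countable_measurable.
  + by apply: measurable_funTS; apply/measurable_EFinP; case: hf0.
  + exact: countable_lebesgue_measure0.
Unshelve. all: end_near. Qed.

(** An interval around a point where the continuous [rho0] is positive. *)
Lemma charged_interval : exists p q, [/\ Om p, Om q, p < q &
  0 < fine (P (Om `&` `[p, q]))].
Proof.
have /nbhs_ballP[e /= e0 he] : nbhs base Om by exact: open_nbhs_nbhs.
have e2 : 0 < e / 2 by rewrite divr_gt0.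
have inO x : `|base - x| <= e / 2 -> Om x.
  move=> h; apply: he; apply: (le_lt_trans h).
  by rewrite ltr_pdivrMr// ltr_pMr// ltr1n.
exists (base - e / 2), (base + e / 2); split.
- by apply: inO; rewrite opprB addrC subrK gtr0_norm.
- by apply: inO; rewrite opprD addNKr normrN gtr0_norm.
- by lra.
rewrite fine_gt0//; apply/andP; split; last first.
  by apply: (le_lt_trans (probability_le1 P _)); rewrite ?ltry//; apply: measurableI.
apply: (@lt_le_trans _ _ (density_measure rho0 `]base - e / 2, base + e / 2[%classic)).
  apply: (density_measure_gt0 hf0 (@crho0 base) Obase); first exact: interval_open.
  by rewrite /= in_itv/=; apply/andP; split; lra.
apply: (@le_measure _ _ _ P); rewrite ?inE//=; first by apply: measurableI.
move=> x /=; rewrite !in_itv/= => /andP[h1 h2]; split; last by rewrite !ltW.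
by apply: inO; rewrite ler_norml; apply/andP; split; lra.
Qed.

Let lagrangian_bounded t : 0 <= t -> exists K, forall z, `|X t z| <= K /\ `|V t z| <= K.
Proof.
move=> t0; have [K hK] := flow_bounded solution_alignment_flow t0.
by exists K => z; apply: hK; rewrite t0 lexx.
Qed.

Let mV t : 0 <= t -> measurable_fun [set: line] (V t).
Proof. by move=> t0; apply: (measurableT_comp (mu_t t0)); exact: mX. Qed.

Let dist_mean (f : R -> R) (K d : R) z : measurable_fun [set: line] f ->
  (forall z, `|f z| <= K) -> (forall z y, `|f z - f y| <= d) ->
  `|f z - \int[P]_y f y| <= d.
Proof.
move=> mf fK fd; rewrite -[X in X - _](expectation_cst P).
rewrite -(@expectationB _ _ _ P _ _ K K) => //.
by apply: expectation_norm_le => //; apply: measurable_funB.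
Qed.

Let centerE t : 0 <= t -> center_of_mass (rho t) = \int[P]_z X t z.
Proof. by move=> t0; rewrite /center_of_mass (@transfer t id). Qed.

Lemma mean_velocityE : mean_velocity rho0 u0 = \int[P]_z V 0 z.
Proof.
rewrite /mean_velocity -(sol_u_init sol) -[in LHS](sol_rho_init sol).
under eq_Rintegral do rewrite mulrC.
by rewrite (@transfer 0 (u 0))//; exact: mu_t.
Qed.

Lemma position_error_le t (d : R) : 0 <= t ->
  (forall z y, `|X t z - X t y| <= d) -> (position_error rho t <= d%:E)%E.
Proof.
move=> t0 hd; have [K hK] := lagrangian_bounded t0.
apply: (@dinfty_dirac_le _ P _ (X t)).
- exact: mX.
- by move=> A mA; exact: distribution_density.
- move=> z; rewrite centerE//; apply: (@dist_mean (X t) K) => //; first exact: mX.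
  by move=> y; have [] := hK y.
Qed.

Let density_pos_nbhs t z (A : set R) : 0 <= t -> Om z -> open A -> A (eta t z) ->
  (0 < density_measure (rho t) A)%E.
Proof.
move=> t0 Oz oA Az; apply: (@density_measure_gt0 _ _ (eta t z) A) => //.
- exact: (sol_density sol t0).
- exact: (regular_slice_continuous rrho t0).
- exact: density_pos_along.
Qed.

(** One of two trajectories is at least half their gap away from the center,
    and both run through the support of the density. *)
Lemma position_error_ge t p q : 0 <= t -> Om p -> Om q ->
  (((X t q - X t p) / 2)%:E <= position_error rho t)%E.
Proof.
move=> t0 Op Oq; set c := center_of_mass (rho t).
have far z : Om z -> (`|X t z - c|%:E <= position_error rho t)%E.
  move=> Oz; apply: dinfty_dirac_ge => A oA Az.
  by apply: (@density_pos_nbhs t z) => //; move: Az; rewrite /lagrangian_position prE.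
have [h|h] := leP ((X t q - X t p) / 2) `|X t q - c|.
  by apply: le_trans (far q Oq); rewrite lee_fin.
apply: le_trans (far p Op); rewrite lee_fin.
have : X t q - X t p <= `|X t q - c| + `|X t p - c|.
  have := ler_norm (X t q - c); have := ler_norm (- (X t p - c)); rewrite normrN; lra.
lra.
Qed.

(** The trajectories carry all the mass, so the closed set where the velocity is
    within [w] of its mean contains the support of the continuous density. *)
Lemma velocity_error_le t (w : R) : 0 <= t -> \int[P]_z V t z = \int[P]_z V 0 z ->
  (forall z y, `|V t z - V t y| <= w) -> (velocity_error rho0 u0 rho u t <= w%:E)%E.
Proof.
move=> t0 mean hw; have [K hK] := lagrangian_bounded t0.
have w0 : 0 <= w by exact: le_trans (hw 0 0).
apply: Linfty_on_le => // x; rewrite mean_velocityE -mean; set m := \int[P]_z _.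
pose C := [set y | `|u t y - m| <= w].
have cC : closed C.
  have cf : continuous (fun y => `|u t y - m|).
    by move=> y; apply: cvg_norm; apply: cvgB; [exact: cu|exact: cvg_cst].
  by have /continuous_closedP/(_ _ (@closed_le _ w)) := cf.
have XC z : C (X t z).
  rewrite /C /=; apply: (@dist_mean (V t) K w z) => //; first exact: mV.
  by move=> y; have [] := hK y.
suff : closure [set y | rho t y != 0] `<=` C by apply.
rewrite [X in _ `<=` X](closure_id C).1//; apply: closureS => y /= ry.
apply: contrapT => nCy; have oC : open (~` C) by exact: closed_openC.
have ry0 : 0 < rho t y by rewrite lt_neqAle eq_sym ry rho_ge0.
have := @density_measure_gt0 _ (rho t) y (~` C) (sol_density sol t0)
  (regular_slice_continuous rrho t0 (x := y)) ry0 oC nCy.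
rewrite distribution_density//; last exact: open_measurable.
rewrite (_ : _ @^-1` _ = set0) ?measure0 ?ltxx//.
by apply/seteqP; split => // z /=; apply; exact: XC.
Qed.

End SolutionFlow.

(** * Decay of classical solutions *)

Lemma even_derive1_odd (R : realType) (W : R -> R) : C1 W ->
  (forall x, W x = W (- x)) -> forall x, derive1 W (- x) = - derive1 W x.
Proof.
move=> [dW _] Wev x.
have dE y : is_derive y (1 : R) W (derive1 W y).
  by rewrite derive1E; apply: DeriveDef.
have dN : is_derive x (1 : R) (fun y : R => - y) (- 1) by exact: is_deriveNid.
have h := @is_derive1_comp _ W (fun y : R => - y) x _ _ (dE (- x)) dN.
have WE : W \o (fun y : R => - y) = W by apply/funext => y /=; rewrite -Wev.
rewrite WE in h.
have : derive1 W x = derive1 W (- x) * - 1 by rewrite [LHS]derive1E; have [_ ->] := h.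
by move=> ->; rewrite mulrN1 opprK.
Qed.

Theorem theorem1p1 (R : realType) (W phi psi : R -> R)
    (rho0 u0 : R -> R) (rho u : R -> R -> R) (lambda Lambda : R)
    (W_C1 : C1 W)
    (W_sym : forall x, W x = W (- x))
    (psi_def : forall x, psi x = phi `|x|)
    (phi_ge0 : forall r : R, 0 < r -> 0 <= phi r)
    (phi_noninc : forall r s : R, 0 < r -> r <= s -> phi s <= phi r)
    (sol : classical_solution W psi rho0 u0 rho u)
    (lambda_gt0 : 0 < lambda)
    (lambda_le : lambda <= Lambda)
    (W_convex : forall x y : R, y < x ->
       lambda * (x - y) <= derive1 W x - derive1 W y <= Lambda * (x - y))
    (rho0_supp : compact (supp rho0)) :
  ((exists r psim psiM : R,
      [/\ 0 < r, 0 < psim, psim <= psiM &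
          forall x : R, `|x| <= r -> psim <= psi x <= psiM]) ->
   exp_fast (fun t =>
     (position_error rho t + velocity_error rho0 u0 rho u t)%E))
  /\
  (forall alpha : R, 0 < alpha -> alpha < 1 ->
   (exists r A B : R,
      [/\ 0 < r, 0 < A, 0 < B &
          forall x : R, x != 0 -> `|x| <= r ->
            A / (`|x| `^ alpha) <= psi x <= B / (`|x| `^ alpha)]) ->
   bigTheta_pinfty (position_error rho) (fun t => (t `^ (- alpha^-1))%:E) /\
   bigO_pinfty (velocity_error rho0 u0 rho u)
        (fun t => (t `^ (- (alpha^-1 - 1)))%:E)).
Proof.
have [eta is_eta] := sol_flow sol.
have dW_odd := even_derive1_odd W_C1 W_sym.
have mpsi := measurable_radial_weight phi_noninc psi_def.
have mdW : measurable_fun [set: measurableTypeR R] (derive1 W).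
  apply: nondecreasing_measurable => // y x.
  rewrite le_eqVlt => /predU1P[->//|yx]; have /andP[h _] := W_convex x y yx.
  by rewrite -subr_ge0 (le_trans _ h)// mulr_ge0 ?subr_ge0// ltW.
have fl := solution_alignment_flow mpsi mdW sol rho0_supp is_eta.
have [p [q [Op Oq pq mpq]]] := charged_interval sol.
split.
  move=> [r [psim [psiM [r0 m0 mM hpsi]]]].
  have M0 : 0 < psiM by exact: lt_le_trans mM.
  have hphi s : 0 < s -> s <= r -> psim * s `^ (- 0) <= phi s <= psiM * s `^ (- 0).
    move=> s0 sr; rewrite oppr0 powRr0 !mulr1.
    by have := hpsi s; rewrite psi_def !ger0_norm ?(ltW s0)//; apply.
  have [Psi [pot hge hle]] := power_weight_potential phi_ge0 phi_noninc
    (lexx 0) ltr01 r0 m0 M0 hphi.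
  have mean := flow_mean_velocity fl lambda_gt0 dW_odd W_convex psi_def phi_ge0 phi_noninc pot.
  have [K [c [K0 c0 hK]]] := flow_exp_decay fl lambda_gt0 dW_odd W_convex
    psi_def phi_ge0 phi_noninc pot Op Oq pq mpq hge hle (subr0 1).
  exists (2 * K), c; split => //; first by rewrite mulr_gt0.
  move=> t t0; rewrite -mulrA mulr_natl mulr2n EFinD leeD//.
    by apply: (position_error_le mpsi mdW (sol := sol) rho0_supp is_eta t0) => // z y; have [] := hK t z y t0.
  apply: (velocity_error_le mpsi mdW (sol := sol) rho0_supp is_eta t0) => //.
    exact: mean.
  by move=> z y; have [] := hK t z y t0.
move=> alpha a0 a1 [r [A [B [r0 A0 B0 hpsi]]]].
have hphi s : 0 < s -> s <= r -> A * s `^ (- alpha) <= phi s <= B * s `^ (- alpha).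
  move=> s0 sr; rewrite powRN.
  by have := hpsi s; rewrite psi_def !ger0_norm ?(ltW s0)//; apply=> //; rewrite gt_eqF.
have [Psi [pot hge hle]] := power_weight_potential phi_ge0 phi_noninc
  (ltW a0) a1 r0 A0 B0 hphi.
have mean := flow_mean_velocity fl lambda_gt0 dW_odd W_convex psi_def phi_ge0 phi_noninc pot.
have b0 : 0 < 1 - alpha by rewrite subr_gt0.
have [K [T [K0 T1 hK]]] := flow_power_decay fl lambda_gt0 dW_odd W_convex
  psi_def phi_ge0 phi_noninc pot Op Oq pq mpq b0 hge hle a0 a1 erefl.
have [c [T' [c0 T1' hc]]] := flow_power_lower fl lambda_gt0 lambda_le dW_odd W_convex
  psi_def phi_ge0 phi_noninc pot Op Oq pq mpq hge hle a0 a1 erefl.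
split; first split.
- exists K => //; near=> t.
  have Tt : T <= t by near: t; apply: nbhs_pinfty_ge; rewrite num_real.
  have t0 : 0 <= t by rewrite (le_trans _ Tt)// (le_trans _ T1).
  rewrite -EFinM; apply: (position_error_le mpsi mdW (sol := sol) rho0_supp is_eta t0) => // z y.
  by have [] := hK t z y Tt.
- exists (2 / c); first by rewrite divr_gt0.
  near=> t; have Tt : T' <= t by near: t; apply: nbhs_pinfty_ge; rewrite num_real.
  have t0 : 0 <= t by rewrite (le_trans _ Tt)// (le_trans _ T1').
  have h := position_error_ge sol rho0_supp is_eta t0 Op Oq.
  have ic : (0 <= (2 / c)%:E)%E by rewrite lee_fin ltW// divr_gt0.
  apply: (le_trans _ (lee_wpmul2l ic h)); rewrite -EFinM lee_fin.
  have := hc t Tt; rewrite -ler_pdivlMl// => /le_trans; apply.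
  by rewrite le_eqVlt; apply/orP; left; apply/eqP; field; rewrite gt_eqF.
- exists K => //; near=> t.
  have Tt : T <= t by near: t; apply: nbhs_pinfty_ge; rewrite num_real.
  have t0 : 0 <= t by rewrite (le_trans _ Tt)// (le_trans _ T1).
  rewrite -EFinM; apply: (velocity_error_le mpsi mdW (sol := sol) rho0_supp is_eta t0) => //.
    exact: mean.
  by move=> z y; have [] := hK t z y Tt.
Unshelve. all: end_near. Qed.
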